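(* Assume that $\widetilde\mu,\widetilde\sigma,\widetilde\rho\colon\mathbb R\to\mathbb R$ are Lipschitz continuous, and that there are $\widetilde m\in\mathbb N$ and $-\infty=\zeta_0<\zeta_1<\dots<\zeta_{\widetilde m}<\zeta_{\widetilde m+1}=\infty$ such that $\widetilde\mu$ and $\widetilde\sigma$ are differentiable with Lipschitz continuous derivatives on $(\zeta_{k-1},\zeta_k)$ for every $k\in\{1,\dots,\widetilde m+1\}$ and $\widetilde\sigma(\zeta_k)\ne0$ for every $k\in\{1,\dots,\widetilde m\}$. Let $\widetilde\xi\in\mathbb R$, let $Z^{(\delta)}$, $\delta\in(0,\delta_0]$, be the doubly-adaptive quasi-Milstein scheme with grid points $(\tau_n)_{n\in\mathbb N_0}$ (defined in the context), and let $$n(Z^{(\delta)}_T)=\min\{k\in\mathbb N:\tau_k=T\}.$$ Then there exists a constant $c_{11}\in(0,\infty)$ such that for all $\delta\in(0,\delta_0]$, $$\mathbb E\big[n(Z^{(\delta)}_T)\big]\le c_{11}\big(\delta^{-1}+\mathbb E[N_T]\big).$$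
   Context: Notation: $\mathbb N=\{1,2,\dots\}$, $\mathbb N_0=\mathbb N\cup\{0\}$. $T,\lambda\in(0,\infty)$ are fixed. $(\Omega,\mathcal F,\mathbb P)$ is a complete probability space carrying a standard Brownian motion $W=(W_t)_{t\ge0}$ and an independent homogeneous Poisson process $N=(N_t)_{t\ge0}$ with intensity $\lambda$; the filtration $\mathbb F=(\mathbb F_t)_{t\ge0}$ is the natural filtration of $(W,N)$ augmented by all $\mathbb P$-null sets. The underlying SDE is $dZ_t=\widetilde\mu(Z_t)\,dt+\widetilde\sigma(Z_t)\,dW_t+\widetilde\rho(Z_{t-})\,dN_t$, $t\in[0,T]$, $Z_0=\widetilde\xi$. Let $d_{\widetilde\sigma}(x)=\widetilde\sigma'(x)$ if $\widetilde\sigma$ is differentiable at $x$ and $d_{\widetilde\sigma}(x)=0$ otherwise. Step-size function. Let $\Theta=\{\zeta_1,\dots,\zeta_{\widetilde m}\}$, $d(x,\Theta)$ the distance of $x$ to $\Theta$, and $\Theta^\varepsilon=\{x\in\mathbb R: d(x,\Theta)<\varepsilon\}$ for $\varepsilon>0$. Fix $\varepsilon_0\in(0,1]$ with $\varepsilon_0\le\frac12\min\{\zeta_i-\zeta_{i-1}: i\in\{2,\dots,\widetilde m\}\}$ if $\widetilde m\ge2$. For $\delta>0$ let $\varepsilon_1^\delta=\sqrt\delta\,\log^2(\delta^{-1})$, $\varepsilon_2^\delta=\delta\log^4(\delta^{-1})$ (natural logarithm). Fix $\delta_0\in(0,1)$ such that $\varepsilon_2^\delta\le\varepsilon_1^\delta\le\varepsilon_0/2$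 for all $\delta\in(0,\delta_0]$. For $\delta\in(0,\delta_0]$ define $h^\delta\colon\mathbb R\to(0,1)$ by $h^\delta(x)=\delta$ if $x\notin\Theta^{\varepsilon_1^\delta}$, $h^\delta(x)=\big(d(x,\Theta)/\log^2(\delta^{-1})\big)^2$ if $x\in\Theta^{\varepsilon_1^\delta}\setminus\Theta^{\varepsilon_2^\delta}$, and $h^\delta(x)=\delta^2\log^4(\delta^{-1})$ if $x\in\Theta^{\varepsilon_2^\delta}$. Doubly-adaptive quasi-Milstein scheme. Let $(\nu_i)_{i\in\mathbb N}$ be the jump times of $N$. For $\delta\in(0,\delta_0]$ set $\tau_0=0$, $Z^{(\delta)}_0=\widetilde\xi$, and for $n\in\mathbb N_0$ $$\tau_{n+1}=\big(\tau_n+h^\delta(Z^{(\delta)}_{\tau_n})\big)\wedge\min\{\nu_i: i\in\mathbb N,\ \nu_i>\tau_n\}\wedge T,$$ $$Z^{(\delta)}_{\tau_{n+1}-}=Z^{(\delta)}_{\tau_n}+\widetilde\mu(Z^{(\delta)}_{\tau_n})(\tau_{n+1}-\tau_n)+\widetilde\sigma(Z^{(\delta)}_{\tau_n})(W_{\tau_{n+1}}-W_{\tau_n})+\tfrac12\widetilde\sigma(Z^{(\delta)}_{\tau_n})d_{\widetilde\sigma}(Z^{(\delta)}_{\tau_n})\big((W_{\tau_{n+1}}-W_{\tau_n})^2-(\tau_{n+1}-\tau_n)\big),$$ $$Z^{(\delta)}_{\tau_{n+1}}=Z^{(\delta)}_{\tau_{n+1}-}+\widetilde\rho(Z^{(\delta)}_{\tau_{n+1}-})(N_{\tau_{n+1}}-N_{\tau_n}),$$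 and for $t\in(\tau_n,\tau_{n+1})$ $$Z^{(\delta)}_t=Z^{(\delta)}_{\tau_n}+\widetilde\mu(Z^{(\delta)}_{\tau_n})(t-\tau_n)+\widetilde\sigma(Z^{(\delta)}_{\tau_n})(W_t-W_{\tau_n})+\tfrac12\widetilde\sigma(Z^{(\delta)}_{\tau_n})d_{\widetilde\sigma}(Z^{(\delta)}_{\tau_n})\big((W_t-W_{\tau_n})^2-(t-\tau_n)\big).$$ *)

(* Defs.v *)
From mathcomp Require Export all_boot all_order all_algebra.
From mathcomp Require Export all_classical all_reals all_analysis.

Set Implicit Arguments.
Unset Strict Implicit.
Unset Printing Implicit Defensive.

Export Order.TTheory GRing.Theory Num.Theory.
Export numFieldNormedType.Exports.

Local Open Scope classical_set_scope.
Local Open Scope ring_scope.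

Section processes.
Context {d : measure_display} {Omega : measurableType d} {R : realType}.
Variable P : probability Omega R.

(* The product rule is only asked for the full family: subfamilies are covered
   by taking [B i = setT] for the remaining indices. *)
Definition independent_RVs (n : nat) (X : 'I_n -> Omega -> R) : Prop :=
  forall B : 'I_n -> set R, (forall i, measurable (B i)) ->
    P (\bigcap_(i in [set: 'I_n]) (X i @^-1` B i)) =
    (\prod_(i < n) P (X i @^-1` B i))%E.

(* Processes are indexed by [R]; only the times [t >= 0] are constrained. *)
Definition independent_increments (X : R -> Omega -> R) : Prop :=
  forall (n : nat) (t : nat -> R), 0 <= t 0%N -> (forall i, t i <= t i.+1) ->
    independent_RVs (fun (i : 'I_n) w => X (t i.+1) w - X (t i) w).

(* [normal_prob m s] is parameterized by the standard deviation [s]. *)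
Record standard_brownian_motion (W : R -> {RV P >-> R}) : Prop := {
  bm_start : {ae P, forall w, W 0 w = 0} ;
  bm_indep : independent_increments (fun t w => W t w) ;
  bm_normal : forall s t : R, 0 <= s -> s < t ->
    forall B : set R, measurable B ->
      P [set w | B (W t w - W s w)] = normal_prob 0 (Num.sqrt (t - s)) B ;
  bm_continuous : {ae P, forall w,
    {within [set t : R | 0 <= t], continuous (fun t => W t w)}}
}.

Record poisson_process (lambda : R) (N : R -> {RV P >-> nat}) : Prop := {
  pp_start : {ae P, forall w, N 0 w = 0%N} ;
  pp_indep : independent_increments (fun t w => (N t w)%:R) ;
  pp_poisson : forall s t : R, 0 <= s -> s < t -> forall k : nat,
    P [set w | N t w = (N s w + k)%N] =
    (poisson_pmf (lambda * (t - s)) k)%:E ;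
  pp_nondecreasing : {ae P, forall w,
    forall s t : R, 0 <= s -> s <= t -> (N s w <= N t w)%N} ;
  pp_right_continuous : {ae P, forall w, forall t : R, 0 <= t ->
    ((N s w)%:R : R) @[s --> t^'+] --> ((N t w)%:R : R)}
}.

Definition sigma_process d' (S : measurableType d') (X : R -> Omega -> S) :
    set (set Omega) :=
  <<s [set A | exists t : R, 0 <= t /\
         exists2 B : set S, measurable B & A = X t @^-1` B] >>.

Definition independent_processes d1 (S1 : measurableType d1)
    d2 (S2 : measurableType d2)
    (X : R -> Omega -> S1) (Y : R -> Omega -> S2) : Prop :=
  forall A B, sigma_process X A -> sigma_process Y B ->
    P (A `&` B) = (P A * P B)%E.

End processes.

Section coefficients.
Context {R : realType}.

(* [zeta 0 = -oo < zeta 1 < ... < zeta m < zeta m.+1 = +oo]; values of [zeta]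
   beyond [m.+1] are irrelevant. *)
Definition is_subdivision (m : nat) (zeta : nat -> \bar R) : Prop :=
  [/\ zeta 0%N = -oo%E, zeta m.+1 = +oo%E &
      forall i, (i <= m)%N -> (zeta i < zeta i.+1)%E].

Definition exceptional_points (m : nat) (zeta : nat -> \bar R) : set R :=
  [set x | exists2 k, (1 <= k <= m)%N & zeta k = x%:E].

Definition piecewise_C1Lip (m : nat) (zeta : nat -> \bar R) (f : R -> R) :
    Prop :=
  forall k, (1 <= k <= m.+1)%N ->
    let I := [set x : R | (zeta k.-1 < x%:E < zeta k)%E] in
    (forall x, I x -> derivable f x 1) /\ [lipschitz derive1 f x | x in I].

Definition diff_or_zero (f : R -> R) (x : R) : R :=
  if `[< derivable f x 1 >] then derive1 f x else 0.

Definition dist (x : R) (Theta : set R) : R :=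
  inf [set `|x - z| | z in Theta].

Definition eps1 (delta : R) : R := Num.sqrt delta * ln delta^-1 ^+ 2.
Definition eps2 (delta : R) : R := delta * ln delta^-1 ^+ 4.

Definition step_size (Theta : set R) (delta x : R) : R :=
  if dist x Theta >= eps1 delta then delta
  else if dist x Theta >= eps2 delta then (dist x Theta / ln delta^-1 ^+ 2) ^+ 2
  else delta ^+ 2 * ln delta^-1 ^+ 4.

End coefficients.

Section scheme.
Context {R : realType}.
Variables (mu sigma rho : R -> R) (xi T : R) (Theta : set R) (delta : R).

(* The scheme is a deterministic functional of one path of the Brownian motion
   and one path of the Poisson process. *)
Variables (W : R -> R) (N : R -> nat).

(* [i]-th jump time; [+oo] if there are fewer than [i] jumps. *)
Definition jump_time (i : nat) : \bar R :=
  ereal_inf [set t%:E | t in [set t : R | 0 <= t /\ (i <= N t)%N]].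

Definition next_jump (s : R) : \bar R :=
  ereal_inf [set v | exists2 i, (1 <= i)%N &
                     v = jump_time i /\ (s%:E < v)%E].

Definition next_time (s z : R) : R :=
  fine (Order.min (Order.min (s + step_size Theta delta z)%:E (next_jump s))
                  T%:E).

Definition milstein_step (z dt dW : R) : R :=
  z + mu z * dt + sigma z * dW
    + 2^-1 * sigma z * diff_or_zero sigma z * (dW ^+ 2 - dt).

(* [grid n] is the pair of the grid point [tau_n] and the value of the scheme
   at that point. *)
Fixpoint grid (n : nat) : R * R :=
  if n is n'.+1 then
    let: (s, z) := grid n' in
    let t := next_time s z in
    let z_left := milstein_step z (t - s) (W t - W s) in
    (t, z_left + rho z_left * ((N t)%:R - (N s)%:R))
  else (0, xi).

Definition tau (n : nat) : R := (grid n).1.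

(* The minimum of [k >= 1] with [tau k = T], with the convention that it is
   [+oo] if there is none. *)
Definition num_steps : \bar R :=
  ereal_inf [set (k%:R : R)%:E | k in [set k : nat | (1 <= k)%N /\ tau k = T]].

End scheme.

(* Main.v *)
(* A step that is neither cut by a jump of N nor by T has length h(Z).  Jumps and
   T account for at most N_T + 1 steps, and uncut steps started far from Theta,
   which have length delta, for at most T / delta of them.  The uncut steps
   started near Theta are counted by a bounded Lyapunov function: G(z) is
   1/delta times the sum over zeta in Theta of a smoothed and truncated |z - zeta|,
   so 0 <= G <= m / delta.  Along one step with increment x of W, G increases by at
   least b x - (C / delta) (dt + x^2) + kappa 1{uncut near step, x ~ sqrt dt}.
   Given the past, x is a centred normal variable with variance about dt, so taking
   expectations and summing bounds kappa times the expected number of such steps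
   by (C / delta) (1 + E N_T + T).  For delta bounded away from 0 the minimal
   step size gives the bound directly. *)

(* The obstacle is that a step length is random and may be cut by a jump, so an increment of [W]
   over a step is Gaussian given the past only if the length is already known when the step starts.
   The past therefore contains the whole path of [N]; by independence [W] is still Brownian for this
   larger filtration, and each grid point is determined at the preceding one. Conditional
   expectations are replaced by an inequality on dyadic cells, with a time error [r] that is sent to
   0 at the end.

   The factor [delta^-1] in the Lyapunov function is forced by the calibration
   [eps2 delta = delta * L ^+ 2]: the gain of the unscaled well over a near step is of order
   [eps2 / L ^+ 2 = delta], so the rescaled gain is of order one.

   A jump may move the scheme anywhere, hence costs up to [size pts / delta] of Lyapunov value. This
   yields a bound of order [delta^-1 * (1 + E N_T)]; as [E N_T] does not depend on [delta], it goes
   into the constant [c11]. The paths are replaced by zero off an event of full measure, so that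
   regularity holds for every sample point. *)
Require Import Defs.
From mathcomp Require Import measurable_realfun.
From mathcomp Require Import ring lra.

Set Implicit Arguments.
Unset Strict Implicit.
Unset Printing Implicit Defensive.

Local Open Scope classical_set_scope.
Local Open Scope ring_scope.

(** * The Lyapunov well *)

(* [vee e] behaves like [|x|], with curvature of order
   [sqrt e / (e + |x|)^(3/2)] at [x]: over a full time step of length
   [((e + |x|) / L)^2], where [e = delta * L^2], it gains at least a multiple of
   [sqrt (e * (e + |x|)) / L^2 >= delta], whatever the distance [|x|]. *)
Section vee.
Context {R : realType}.
Variables (e : R) (e_gt0 : 0 < e).

Definition vee (x : R) : R := (Num.sqrt (e + `|x|) - Num.sqrt e) ^+ 2.
(** The derivative of [vee]; it vanishes at 0, where the two branches meet smoothly. *)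
Definition dvee (x : R) : R := Num.sg x * (1 - Num.sqrt e / Num.sqrt (e + `|x|)).

Let sqrt_gt0' (x : R) : 0 < Num.sqrt (e + `|x|).
Proof. by rewrite sqrtr_gt0 ltr_wpDr. Qed.

Let sqr_sqrt' (x : R) : Num.sqrt (e + `|x|) ^+ 2 = e + `|x|.
Proof. by rewrite sqr_sqrtr// addr_ge0// ltW. Qed.

Let sqr_sqrt_e : Num.sqrt e ^+ 2 = e.
Proof. by rewrite sqr_sqrtr// ltW. Qed.

Let sqrt_le' (x : R) : Num.sqrt e <= Num.sqrt (e + `|x|).
Proof. by rewrite ler_wsqrtr// lerDl. Qed.

Lemma vee_ge0 x : 0 <= vee x. Proof. exact: sqr_ge0. Qed.

Lemma veeN x : vee (- x) = vee x. Proof. by rewrite /vee normrN. Qed.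

Lemma dveeN x : dvee (- x) = - dvee x.
Proof. by rewrite /dvee normrN sgrN mulNr. Qed.

Lemma vee_le x : vee x <= `|x|.
Proof.
have := sqr_sqrt' x; have := sqr_sqrt_e; have := sqrt_le' x.
have := sqrt_gt0' x; have : 0 <= Num.sqrt e by exact: sqrtr_ge0.
rewrite /vee; set p := Num.sqrt (e + _); set r := Num.sqrt e => *.
nra.
Qed.

Lemma norm_dvee_le1 x : `|dvee x| <= 1.
Proof.
rewrite /dvee normrM.
have h : 0 <= Num.sqrt e / Num.sqrt (e + `|x|) <= 1.
  by rewrite divr_ge0// ?sqrtr_ge0//= ler_pdivrMr// mul1r.
have -> : 1 = 1 * 1 :> R by rewrite mulr1.
rewrite ler_pM//; first by rewrite normr_sg lern1 leq_b1.
by rewrite ger0_norm; lra.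
Qed.

(** The Bregman divergence of the convex function [vee]. *)
Definition tvee (z y : R) := vee y - vee z - dvee z * (y - z).

Let tveeN z y : tvee (- z) (- y) = tvee z y.
Proof. by rewrite /tvee !veeN dveeN; ring. Qed.

(** With [p], [q], [r] the square roots of [e + z], [e + y], [e], one has [y - z = q ^+ 2 - p ^+ 2]
    and the divergence is a rational function of [p], [q], [r]. *)
Let tvee_same z y : 0 <= z -> 0 <= y ->
  tvee z y = Num.sqrt e * (Num.sqrt (e + `|y|) - Num.sqrt (e + `|z|)) ^+ 2
             / Num.sqrt (e + `|z|).
Proof.
move=> z0 y0; have := sqr_sqrt' z; have := sqr_sqrt' y.
have := sqrt_gt0' z; have := sqr_sqrt_e.
rewrite /tvee /vee /dvee (ger0_norm z0) (ger0_norm y0).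
set p := Num.sqrt (e + z); set q := Num.sqrt (e + y); set r := Num.sqrt e.
move=> r2 p0 q2 p2.
have -> : y - z = q ^+ 2 - p ^+ 2 by rewrite q2 p2; ring.
have p0' : p != 0 by rewrite gt_eqF.
have [z0'|z0'] := eqVneq z 0.
  have pr : p = r by rewrite /p z0' addr0.
  by rewrite z0' sgr0 pr; field; rewrite -pr.
by rewrite gtr0_sg ?lt0r ?z0' ?z0//; field.
Qed.

Lemma tvee0 y : tvee 0 y = vee y.
Proof.
rewrite /tvee /dvee sgr0 !mul0r subr0 /vee normr0 addr0 subrr expr0n/=.
by rewrite subr0.
Qed.

(** Across the origin the divergence is split at 0, so that each piece stays on one branch. *)
Let tvee_opp z y : 0 <= z -> y <= 0 ->
  tvee z y = tvee z 0 + dvee z * `|y| + vee y.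
Proof.
move=> z0 y0; have d0 : dvee 0 = 0 by rewrite /dvee sgr0 mul0r.
by rewrite -(tvee0 y) /tvee (ler0_norm y0) d0; ring.
Qed.

Let dvee_ge0 z : 0 <= z -> 0 <= dvee z.
Proof.
move=> z0; rewrite /dvee mulr_ge0 ?sgr_ge0// subr_ge0.
by rewrite ler_pdivrMr// mul1r.
Qed.

Let tvee_same_ge0 z y : 0 <= z -> 0 <= y -> 0 <= tvee z y.
Proof.
by move=> z0 y0; rewrite tvee_same// divr_ge0// ?sqrtr_ge0// mulr_ge0 ?sqr_ge0.
Qed.

Lemma tvee_ge0 z y : 0 <= tvee z y.
Proof.
wlog z0 : z y / 0 <= z.
  move=> h; have [z0|z0] := leP 0 z; first exact: h.
  by rewrite -tveeN h// oppr_ge0 ltW.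
have [y0|y0] := leP 0 y; first exact: tvee_same_ge0.
rewrite tvee_opp ?(ltW y0)//.
have := tvee_same_ge0 z0 (lexx 0); have := vee_ge0 y.
have := mulr_ge0 (dvee_ge0 z0) (normr_ge0 y); lra.
Qed.

(** By convexity [vee] lies above its tangent at the higher of the two points, whose slope is at
    most 1. *)
Lemma vee_lip y z : `|vee y - vee z| <= `|y - z|.
Proof.
wlog yz : y z / vee z <= vee y.
  move=> h; have [/ltW|] := ltP (vee y) (vee z); last exact: h.
  by rewrite distrC (distrC y); exact: h.
rewrite ger0_norm ?subr_ge0//.
have := tvee_ge0 y z; rewrite /tvee => t0.
have : dvee y * (y - z) <= `|y - z|.
  rewrite (le_trans (ler_norm _))// normrM ler_piMl//.
  exact: norm_dvee_le1.
by lra.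
Qed.

Let quad_aux (p q r a : R) : 0 < r -> r <= p -> 0 <= q -> q ^+ 2 <= 2 * p ^+ 2 ->
  a ^+ 2 = (q - p) ^+ 2 * (q + p) ^+ 2 ->
  r * a ^+ 2 / (6 * p ^+ 2 * p) <= r * (q - p) ^+ 2 / p.
Proof.
move=> r0 rp q0 qp ->; have p0 : 0 < p by apply: lt_le_trans rp.
rewrite ler_pdivrMr ?mulr_gt0// ?exprn_gt0//.
have -> : r * (q - p) ^+ 2 / p * (6 * p ^+ 2 * p)
   = r * (q - p) ^+ 2 * (6 * p ^+ 2) by field; rewrite gt_eqF.
rewrite -mulrA ler_wpM2l ?(ltW r0)// ler_wpM2l ?sqr_ge0//.
have := sqr_ge0 (p - q); rewrite sqrrB sqrrD => ?; nra.
Qed.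

(** On one branch [(q + p) ^+ 2 <= 6 * p ^+ 2] turns the exact formula into a quadratic bound with
    constant 6. When [y] is on the other side of 0, the pieces from [z] to 0 and from 0 to [y] are
    bounded separately, and [(y - z) ^+ 2 <= 2 * (y ^+ 2 + z ^+ 2)] costs the factor that makes it
    12. *)
Lemma tvee_quad z y : `|y - z| <= e + `|z| ->
  Num.sqrt e * (y - z) ^+ 2 / (12 * (e + `|z|) * Num.sqrt (e + `|z|)) <= tvee z y.
Proof.
wlog z0 : z y / 0 <= z.
  move=> h; have [z0|z0] := leP 0 z; first exact: h.
  move: (h (- z) (- y)); rewrite tveeN normrN -opprD normrN sqrrN; apply; rewrite oppr_ge0; exact: ltW.
move=> yz.
have r0 : 0 < Num.sqrt e by rewrite sqrtr_gt0.
have same y' : 0 <= y' -> `|y' - z| <= e + `|z| ->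
  Num.sqrt e * (y' - z) ^+ 2 / (6 * (e + `|z|) * Num.sqrt (e + `|z|)) <= tvee z y'.
  move=> y0 y'z; rewrite tvee_same// -{1}(sqr_sqrt' z); apply: quad_aux => //.
  - rewrite !sqr_sqrt'; rewrite (ger0_norm y0) (ger0_norm z0).
    by have := ler_norm (y' - z); move: y'z; rewrite (ger0_norm z0); lra.
  - rewrite -exprMn -subr_sqr !sqr_sqrt' (ger0_norm y0) (ger0_norm z0).
    by congr (_ ^+ 2); ring.
have D0 : 0 < (e + `|z|) * Num.sqrt (e + `|z|) by rewrite mulr_gt0// ltr_wpDr.
have e12 x : Num.sqrt e * x / (12 * (e + `|z|) * Num.sqrt (e + `|z|)) =
  2^-1 * (Num.sqrt e * x / (6 * (e + `|z|) * Num.sqrt (e + `|z|))).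
  by field; rewrite !gt_eqF// ltr_wpDr.
have pos x : 0 <= x -> 0 <= Num.sqrt e * x / (6 * (e + `|z|) * Num.sqrt (e + `|z|)).
  by move=> x0; rewrite -[6 * _ * _]mulrA divr_ge0// mulr_ge0// ltW.
rewrite e12.
have [y0|y0] := leP 0 y.
  have := same y y0 yz; have := pos _ (sqr_ge0 (y - z)); lra.
rewrite tvee_opp ?(ltW y0)//.
have h1 := same 0 (lexx 0).
have {}h1 : Num.sqrt e * z ^+ 2 / (6 * (e + `|z|) * Num.sqrt (e + `|z|)) <= tvee z 0.
  move: h1; rewrite sub0r sqrrN normrN; apply.
  by rewrite lerDr ltW.
have h2 : 0 <= dvee z * `|y| by rewrite mulr_ge0// dvee_ge0.
have h3 : Num.sqrt e * y ^+ 2 / (6 * (e + `|z|) * Num.sqrt (e + `|z|)) <= vee y.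
  rewrite /vee.
  have h4 : Num.sqrt e * y ^+ 2 / (6 * (e + `|z|) * Num.sqrt (e + `|z|)) <=
            y ^+ 2 / (6 * (e + `|z|)).
    rewrite ler_pdivrMr; last by rewrite -mulrA mulr_gt0.
    have -> : y ^+ 2 / (6 * (e + `|z|)) * (6 * (e + `|z|) * Num.sqrt (e + `|z|))
       = y ^+ 2 * Num.sqrt (e + `|z|).
      by field; rewrite gt_eqF// ltr_wpDr.
    by rewrite mulrC ler_wpM2l ?sqr_ge0.
  apply: (le_trans h4); rewrite ler_pdivrMr ?mulr_gt0// ?ltr_wpDr//.
  have E : y ^+ 2 = (Num.sqrt (e + `|y|) - Num.sqrt e) ^+ 2 *
     (Num.sqrt (e + `|y|) + Num.sqrt e) ^+ 2.
    by rewrite -exprMn -subr_sqr sqr_sqrt' sqr_sqrt_e addrAC subrr add0r real_normK ?num_real.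
  rewrite {1}E ler_wpM2l ?sqr_ge0//.
  have l1 : Num.sqrt (e + `|y|) ^+ 2 <= 2 * (e + `|z|).
    rewrite sqr_sqrt'; have := ler_norm (z - y); move: yz.
    by rewrite distrC (ltr0_norm y0) (ger0_norm z0); lra.
  have l2 : Num.sqrt e ^+ 2 <= e + `|z| by rewrite sqr_sqrt_e lerDl.
  have := sqr_ge0 (Num.sqrt (e + `|y|) - Num.sqrt e); rewrite sqrrB sqrrD; lra.
have h5 : (y - z) ^+ 2 <= 2 * (y ^+ 2 + z ^+ 2).
  by have := sqr_ge0 (y + z); rewrite sqrrB sqrrD; lra.
have h6 : Num.sqrt e * (y - z) ^+ 2 / (6 * (e + `|z|) * Num.sqrt (e + `|z|)) <=
  2 * (Num.sqrt e * y ^+ 2 / (6 * (e + `|z|) * Num.sqrt (e + `|z|)) +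
       Num.sqrt e * z ^+ 2 / (6 * (e + `|z|) * Num.sqrt (e + `|z|))).
  rewrite -mulrDl -mulrDr mulrA ler_wpM2r//.
    by rewrite invr_ge0 -mulrA mulr_ge0// ltW.
  by have := ler_wpM2l (ltW r0) h5; lra.
lra.
Qed.

End vee.

(** * A compactly supported cut-off with curvature bounded below *)

Section cut.
Context {R : realType}.
Implicit Types x y z : R.

Definition cut x : R := Num.max 0 (1 - x ^+ 2) ^+ 2.
Definition dcut x : R := - 4 * x * Num.max 0 (1 - x ^+ 2).

Let pos_part x : 0 <= Num.max 0 (1 - x ^+ 2) <= 1.
Proof. by rewrite le_max lexx/= ge_max ler01/= gerBl sqr_ge0. Qed.

Lemma cut_ge0 x : 0 <= cut x. Proof. exact: sqr_ge0. Qed.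

Lemma cut_le1 x : cut x <= 1.
Proof. by have /andP[? ?] := pos_part x; rewrite /cut exprn_ile1. Qed.

Lemma cut_eq0 x : 1 <= `|x| -> cut x = 0.
Proof.
move=> x1; rewrite /cut max_l ?expr0n// subr_le0.
by rewrite -(real_normK (num_real x)) expr_ge1.
Qed.

Lemma cut_ge x : `|x| <= 2^-1 -> 2^-1 <= cut x.
Proof.
move=> x1; have : `|x| ^+ 2 <= 2^-1 ^+ 2 by rewrite lerXn2r ?nnegrE.
rewrite real_normK ?num_real// => h.
rewrite /cut max_r; last by lra.
have h2 : 3 / 4 <= 1 - x ^+ 2 by lra.
have : (3 / 4) ^+ 2 <= (1 - x ^+ 2) ^+ 2 by rewrite lerXn2r ?nnegrE//; lra.
lra.
Qed.

(** The second derivative of [cut] is at least -4, inside and outside of the unit interval. *)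
Lemma cut_tangent z y : - 2 * (y - z) ^+ 2 <= cut y - cut z - dcut z * (y - z).
Proof.
rewrite /cut /dcut; have /andP[p0 p1] := pos_part z.
set p := Num.max 0 (1 - z ^+ 2) in p0 p1 *; set q := Num.max 0 (1 - y ^+ 2).
have q1 : 1 - y ^+ 2 <= q by rewrite le_max lexx orbT.
(* Complementarity of the positive part; it removes the only term of the identity below without a
   sign. *)
have pz : p * (p - (1 - z ^+ 2)) = 0.
  by rewrite /p; have [h|h] := leP (1 - z ^+ 2) 0; rewrite ?mul0r// subrr mulr0.
have h0 := sqr_ge0 (p - q).
have h1 : 0 <= p * (q - (1 - y ^+ 2)) by rewrite mulr_ge0// subr_ge0.
have h2 : 0 <= (1 - p) * (y - z) ^+ 2 by rewrite mulr_ge0 ?sqr_ge0// subr_ge0.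
have -> : q ^+ 2 - p ^+ 2 - (- 4 * z * p) * (y - z) =
  (p - q) ^+ 2 + 2 * (p * (q - (1 - y ^+ 2))) + 2 * ((1 - p) * (y - z) ^+ 2)
   - 2 * (y - z) ^+ 2 - 2 * (p * (p - (1 - z ^+ 2))).
  by ring.
by rewrite pz mulr0 subr0; lra.
Qed.

(** [cut] is the square of a function with values in [0, 1] that is 2-Lipschitz. *)
Lemma cut_lip y z : `|cut y - cut z| <= 4 * `|y - z|.
Proof.
wlog yz : y z / `|z| <= `|y|.
  move=> h; have [/ltW|] := ltP `|y| `|z|; last exact: h.
  by rewrite distrC (distrC y); exact: h.
have /andP[p0 p1] := pos_part z; have /andP[q0 q1] := pos_part y.
rewrite /cut subr_sqr normrM.
set p := Num.max 0 (1 - z ^+ 2) in p0 p1 *.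
set q := Num.max 0 (1 - y ^+ 2) in q0 q1 *.
have h1 : `|q + p| <= 2 by rewrite ger0_norm ?addr_ge0//; lra.
have h2 : `|q - p| <= 2 * `|y - z|.
  have [z1|z1] := leP 1 `|z|.
    rewrite /p /q !max_l ?subrr ?normr0 ?mulr_ge0//
      subr_le0 -(real_normK (num_real _)) expr_ge1//.
    exact: le_trans yz.
  have ab := lerB_dist y z.
  have z2 : `|z| ^+ 2 < 1 by rewrite expr_lt1.
  have pE : p = 1 - `|z| ^+ 2.
    by rewrite /p max_r ?real_normK ?num_real// subr_ge0 -(real_normK (num_real z)) ltW.
  have yz2 : `|z| ^+ 2 <= `|y| ^+ 2 by rewrite lerXn2r ?nnegrE.
  have := normr_ge0 z; move: z1.
  rewrite {p p0 p1 h1}pE /q -(real_normK (num_real y)).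
  move: (`|y - z| : R) (`|y| : R) (`|z| : R) yz ab z2 yz2 => d a b ab' abd z2 yz2 b1 b0.
  have [h|h] := leP (1 - a ^+ 2) 0.
    have a1 : 1 <= a by rewrite leNgt; apply/negP => a1; nra.
    by rewrite sub0r normrN ger0_norm ?subr_ge0 ?(ltW z2)//; nra.
  have a1 : a <= 1 by rewrite leNgt; apply/negP => a1; nra.
  by rewrite distrC ger0_norm; nra.
have -> : 4 * `|y - z| = (2 * `|y - z|) * 2 by ring.
by rewrite ler_pM.
Qed.

End cut.

(** * The truncated well and its one-sided Taylor estimate *)

Section well.
Context {R : realType}.
Variables (e : R) (e_gt0 : 0 < e).
Implicit Types x y z : R.

Definition well x : R := vee e x * cut x.
Definition dwell x : R := dvee e x * cut x + vee e x * dcut x.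

Lemma well_ge0 x : 0 <= well x.
Proof. by rewrite mulr_ge0 ?vee_ge0 ?cut_ge0. Qed.

Lemma well_eq0 x : 1 <= `|x| -> well x = 0.
Proof. by move=> x1; rewrite /well cut_eq0// mulr0. Qed.

Lemma well_le1 x : well x <= 1.
Proof.
have [/well_eq0->//|x1] := leP 1 `|x|.
rewrite /well mulr_ile1 ?vee_ge0 ?cut_ge0 ?cut_le1//.
by rewrite (le_trans (vee_le e_gt0 _))// ltW.
Qed.

Lemma well_lip y z : `|well y - well z| <= 5 * `|y - z|.
Proof.
wlog yz : y z / `|y| <= `|z|.
  move=> h; have [/ltW|] := ltP `|z| `|y|; last exact: h.
  by rewrite distrC (distrC y); exact: h.
have [y1|y1] := leP 1 `|y|.
  by rewrite !well_eq0 ?subrr ?normr0 ?mulr_ge0// (le_trans y1).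
have -> : well y - well z = vee e y * (cut y - cut z) + (vee e y - vee e z) * cut z.
  by rewrite /well; ring.
rewrite (le_trans (ler_normD _ _))// (normrM (vee e y)) (normrM (vee e y - vee e z)).
have h1 : `|vee e y| * `|cut y - cut z| <= 1 * (4 * `|y - z|).
  rewrite ler_pM// ?cut_lip// ger0_norm ?vee_ge0//.
  by rewrite (le_trans (vee_le e_gt0 _))// ltW.
have h2 : `|vee e y - vee e z| * `|cut z| <= `|y - z| * 1.
  by rewrite ler_pM ?vee_lip// ger0_norm ?cut_ge0 ?cut_le1.
by lra.
Qed.

(** Product rule: the convexity of [vee] is kept with weight [cut y], the concavity of [cut] costs 2
    and the cross term [dvee * (cut y - cut z)] costs 4, which makes the 6. *)
Lemma well_tangent z y : `|z| <= 1 ->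
  cut y * tvee e z y - 6 * (y - z) ^+ 2 <= well y - well z - dwell z * (y - z).
Proof.
move=> z1.
have -> : well y - well z - dwell z * (y - z) =
  cut y * tvee e z y + vee e z * (cut y - cut z - dcut z * (y - z))
   + dvee e z * (y - z) * (cut y - cut z) by rewrite /well /dwell /tvee; ring.
have v1 : vee e z <= 1 by rewrite (le_trans (vee_le e_gt0 _)).
have h1 : - (2 * (y - z) ^+ 2) <= vee e z * (cut y - cut z - dcut z * (y - z)).
  have v0 := vee_ge0 e z.
  apply: (@le_trans _ _ (vee e z * (- 2 * (y - z) ^+ 2))); last first.
    by rewrite ler_wpM2l ?cut_tangent.
  by have := sqr_ge0 (y - z); nra.
have h2 : - (4 * (y - z) ^+ 2) <= dvee e z * (y - z) * (cut y - cut z).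
  rewrite lerNl (le_trans (ler_norm _))// normrN (normrM (dvee e z * _)) (normrM (dvee e z)).
  have -> : 4 * (y - z) ^+ 2 = 1 * `|y - z| * (4 * `|y - z|).
    by rewrite -(real_normK (num_real (y - z))); ring.
  rewrite ler_pM ?mulr_ge0 ?cut_lip//.
  by rewrite ler_wpM2r// norm_dvee_le1.
lra.
Qed.

End well.

(** * Step sizes and the Lyapunov function *)

Section dist.
Context {R : realType}.
Implicit Types (pts : seq R) (x y z : R).

Lemma exceptional_points_seq (m : nat) (zeta : nat -> \bar R) :
  is_subdivision m zeta ->
  exceptional_points m zeta =
  [set` [seq fine (zeta k.+1) | k <- iota 0 m]].
Proof.
move=> [z0 zm lt_zeta].
have fin k : (k < m)%N -> zeta k.+1 \is a fin_num.
  move=> km; rewrite fin_numE; apply/andP; split.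
    by rewrite gt_eqF// (le_lt_trans (leNye _) (lt_zeta k (ltnW km))).
  by rewrite lt_eqF// (lt_le_trans (lt_zeta k.+1 km)) ?leey.
apply/seteqP; split => x /=.
  move=> [[|k]//= km zk]; apply/mapP; exists k; first by rewrite mem_iota.
  by rewrite zk.
move=> /mapP[k]; rewrite mem_iota/= => km ->; exists k.+1 => //.
by rewrite fineK// fin.
Qed.

Lemma dist_attained pts x : pts != [::] ->
  exists2 z, z \in pts & dist x [set` pts] = `|x - z|.
Proof.
move=> pts0.
have [z zpts zmin] : exists2 z, z \in pts & forall y, y \in pts -> `|x - z| <= `|x - y|.
  elim: pts pts0 => // a [|b s] ih _.
    by exists a; rewrite ?inE// => y; rewrite inE => /eqP ->.
  have [z zs zmin] := ih isT.
  have [h|h] := leP `|x - a| `|x - z|.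
    exists a; rewrite ?inE ?eqxx// => y; rewrite in_cons => /orP[/eqP ->//|ys].
    exact: le_trans (zmin _ ys).
  exists z; first by rewrite in_cons zs orbT.
  move=> y; rewrite in_cons => /orP[/eqP ->|]; [exact: ltW|exact: zmin].
exists z => //; apply/eqP; rewrite eq_le; apply/andP; split.
  by apply: ge_inf; [exists 0 => _ [y _ <-]|exists z].
apply: lb_le_inf; first by exists `|x - z|, z.
by move=> _ [y ys <-]; exact: zmin.
Qed.

Lemma dist_le pts x z : z \in pts -> dist x [set` pts] <= `|x - z|.
Proof. by move=> zs; apply: ge_inf; [exists 0 => _ [y _ <-]|exists z]. Qed.

Lemma dist_ge0 pts x : pts != [::] -> 0 <= dist x [set` pts].
Proof. by move=> /(dist_attained x)[z _ ->]. Qed.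

Lemma dist_lip pts x y : pts != [::] ->
  `|dist x [set` pts] - dist y [set` pts]| <= `|x - y|.
Proof.
move=> pts0; wlog xy : x y / dist y [set` pts] <= dist x [set` pts].
  by move=> h; have [/ltW /h//|/h] := ltP (dist y [set` pts]) (dist x [set` pts]);
    rewrite distrC (distrC x).
rewrite ger0_norm ?subr_ge0//; have [z zs ->] := dist_attained y pts0.
have := dist_le x zs; have := ler_distD y x z; lra.
Qed.

End dist.

Section step_size.
Context {R : realType}.
Variables (Theta : set R) (delta : R).
Hypothesis delta_gt0 : 0 < delta.
Let L : R := ln delta^-1 ^+ 2.
Hypothesis L_gt0 : 0 < L.
Hypothesis eps21 : eps2 delta <= eps1 delta.

Lemma eps2E : eps2 delta = delta * L ^+ 2.
Proof. by rewrite /eps2 /L -exprM. Qed.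

Lemma eps2_gt0 : 0 < eps2 delta.
Proof. by rewrite eps2E mulr_gt0// exprn_gt0. Qed.

Lemma step_size_far x : eps1 delta <= dist x Theta ->
  step_size Theta delta x = delta.
Proof. by rewrite /step_size => ->. Qed.

(** In the innermost zone [delta ^+ 2 * L ^+ 2 = (eps2 / L) ^+ 2], so the maximum unites both
    regimes near the exceptional points. *)
Lemma step_size_near x : dist x Theta < eps1 delta ->
  step_size Theta delta x = (Num.max (eps2 delta) (dist x Theta) / L) ^+ 2.
Proof.
move=> x1; rewrite /step_size leNgt x1/=.
have [h|h] := leP (eps2 delta) (dist x Theta); first by rewrite -/L.
rewrite eps2E -/L (_ : ln delta^-1 ^+ 4 = L ^+ 2); last by rewrite /L -exprM.
by field; rewrite gt_eqF.
Qed.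

Lemma step_size_ge x : eps2 delta <= 1 ->
  delta * eps2 delta <= step_size Theta delta x.
Proof.
move=> e21; have [h|h] := leP (eps1 delta) (dist x Theta).
  by rewrite step_size_far// ler_piMr// ltW.
rewrite step_size_near//.
have -> : delta * eps2 delta = (eps2 delta / L) ^+ 2.
  by rewrite eps2E; field; rewrite gt_eqF.
rewrite lerXn2r ?nnegrE ?divr_ge0 ?(ltW L_gt0) ?(ltW eps2_gt0)//.
  by rewrite le_max (ltW eps2_gt0).
by rewrite ler_pM2r ?invr_gt0// le_max lexx.
Qed.

Lemma step_size_gt0 x : eps2 delta <= 1 -> 0 < step_size Theta delta x.
Proof.
by move=> /(step_size_ge x); apply: lt_le_trans; rewrite mulr_gt0// eps2_gt0.
Qed.

End step_size.

(** * Gain of the Lyapunov function along one step *)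

Section lyapunov.
Context {R : realType}.

(** Only the diffusive move [s * x] is expanded; it costs [6 * K ^+ 2 * x ^+ 2]. Drift and Milstein
    correction together are at most [2 * K * (dt + x ^+ 2)], and the 5-Lipschitz bound on [well]
    turns this into [10 * K]. *)
Lemma well_step_ge (e K u m s q dt x : R) : 0 < e -> `|u| <= 1 ->
  `|m| <= K -> `|s| <= K -> `|q| <= K -> 0 <= dt ->
  dwell e u * s * x + cut (u + s * x) * tvee e u (u + s * x)
    - (6 * K ^+ 2 + 10 * K) * (dt + x ^+ 2)
  <= well e (u + (m * dt + s * x + q * (x ^+ 2 - dt))) - well e u.
Proof.
move=> e0 u1 mK sK qK dt0; have K0 : 0 <= K by apply: le_trans sK.
have := well_tangent e0 (u + s * x) u1; rewrite addrAC subrr add0r => h1.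
set B := m * dt + q * (x ^+ 2 - dt).
have -> : u + (m * dt + s * x + q * (x ^+ 2 - dt)) = (u + s * x) + B.
  by rewrite /B; ring.
have h2 := well_lip e0 (u + s * x + B) (u + s * x).
rewrite [X in 5 * `|X|]addrAC subrr add0r in h2.
have x2 : 0 <= x ^+ 2 := sqr_ge0 x.
have h3 : `|B| <= 2 * K * (dt + x ^+ 2).
  rewrite /B (le_trans (ler_normD _ _))// !normrM (ger0_norm dt0).
  have g1 : `|m| * dt <= K * dt by rewrite ler_wpM2r.
  have g2 : `|q| * `|x ^+ 2 - dt| <= K * (x ^+ 2 + dt).
    rewrite ler_pM// (le_trans (ler_normB _ _))// (ger0_norm dt0).
    by rewrite ger0_norm.
  by have := mulr_ge0 K0 x2; lra.
have h4 : (s * x) ^+ 2 <= K ^+ 2 * (dt + x ^+ 2).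
  rewrite exprMn ler_pM ?sqr_ge0//; last by rewrite lerDr.
  by rewrite -(real_normK (num_real s)) lerXn2r ?nnegrE.
move: h2; rewrite ler_norml => /andP[h2 _]; lra.
Qed.

(** Here [a / L] is the square root of the full step length. The condition [2 * |s| <= L] keeps the
    displacement below [a], inside the range of the quadratic bound and where [cut] is at least 1/2.
    The factor 96 is 12, times 4 from [e + |u| <= 2 * a] and [r * w <= 2 * a], times 2 from [cut];
    the dependence on [a] cancels. *)
Lemma near_gain (e L s0 s u a x : R) : 0 < e -> `|u| <= a -> e <= a -> a <= e + `|u| ->
  a <= 4^-1 -> 0 < L -> 0 <= s0 -> s0 <= `|s| -> 2 * `|s| <= L ->
  a / L <= x <= 2 * (a / L) ->
  s0 ^+ 2 / 96 * (e / L ^+ 2) <= cut (u + s * x) * tvee e u (u + s * x).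
Proof.
move=> e0 ua ea aeu a4 L0 s00 s0s sL /andP[x1 x2].
have a0 : 0 < a by apply: lt_le_trans ea.
have aL : 0 < a / L by rewrite divr_gt0.
have x0 : 0 < x by apply: lt_le_trans x1.
have sx : `|s * x| <= a.
  rewrite normrM (gtr0_norm x0).
  apply: (@le_trans _ _ (`|s| * (2 * (a / L)))); first by rewrite ler_wpM2l.
  have -> : `|s| * (2 * (a / L)) = (2 * `|s|) * (a / L) by ring.
  apply: (@le_trans _ _ (L * (a / L))); first by rewrite ler_wpM2r// ltW.
  by rewrite mulrCA divff ?mulr1// gt_eqF.
have c2 : 2^-1 <= cut (u + s * x).
  by rewrite cut_ge// (le_trans (ler_normD _ _))//; lra.
have t0 := @tvee_quad _ e e0 u (u + s * x).
rewrite addrAC subrr add0r in t0.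
have {}t0 := t0 (le_trans sx aeu).
have r0 : 0 < Num.sqrt e by rewrite sqrtr_gt0.
have Z0 : 0 < e + `|u| by rewrite ltr_wpDr.
have w0 : 0 < Num.sqrt (e + `|u|) by rewrite sqrtr_gt0.
have r2 : Num.sqrt e ^+ 2 = e by rewrite sqr_sqrtr// ltW.
have w2 : Num.sqrt (e + `|u|) ^+ 2 = e + `|u| by rewrite sqr_sqrtr// ltW.
have sx2 : s0 ^+ 2 * (a / L) ^+ 2 <= (s * x) ^+ 2.
  rewrite -exprMn -(real_normK (num_real (s * x))) lerXn2r ?nnegrE//.
    by rewrite mulr_ge0// ltW.
  by rewrite normrM (gtr0_norm x0) ler_pM// ltW.
have h1 : s0 ^+ 2 / 48 * (e / L ^+ 2) <= tvee e u (u + s * x).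
  apply: le_trans t0; rewrite ler_pdivlMr ?mulr_gt0//.
  apply: (@le_trans _ _ (Num.sqrt e * (s0 ^+ 2 * (a / L) ^+ 2))); last first.
    by rewrite ler_wpM2l// ltW.
  rewrite -{1}r2; move: (Num.sqrt e) (Num.sqrt (e + `|u|)) r0 w0 r2 w2 => r w r0 w0 r2 w2.
  have -> : s0 ^+ 2 / 48 * (r ^+ 2 / L ^+ 2) * (12 * (e + `|u|) * w) =
     (s0 ^+ 2 / L ^+ 2) * (r * ((e + `|u|) * (r * w) / 4)).
    by field; rewrite gt_eqF.
  have -> : r * (s0 ^+ 2 * (a / L) ^+ 2) = (s0 ^+ 2 / L ^+ 2) * (r * a ^+ 2).
    by field; rewrite gt_eqF.
  rewrite ler_wpM2l ?divr_ge0 ?sqr_ge0// ler_wpM2l ?(ltW r0)//.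
  have rw : r * w <= 2 * a.
    have := sqr_ge0 (r - w); rewrite sqrrB r2 w2; lra.
  have : (e + `|u|) * (r * w) <= (2 * a) * (2 * a).
    by apply: ler_pM => //; [exact: ltW|rewrite mulr_ge0 ?ltW|lra].
  lra.
have h2 : 0 <= s0 ^+ 2 / 48 * (e / L ^+ 2).
  by rewrite mulr_ge0// divr_ge0 ?sqr_ge0// ltW.
apply: (@le_trans _ _ (2^-1 * (s0 ^+ 2 / 48 * (e / L ^+ 2)))); first lra.
by rewrite ler_pM.
Qed.

Lemma ler_sum_gain (I : eqType) (r : seq I) (i0 : I) (f g : I -> R) (c : R) :
  i0 \in r -> (forall i, i \in r -> f i <= g i) -> f i0 + c <= g i0 ->
  \sum_(i <- r) f i + c <= \sum_(i <- r) g i.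
Proof.
move=> ir fg fgc; rewrite (big_rem i0)//= [leRHS](big_rem i0)//= addrAC lerD//.
rewrite big_seq [leRHS]big_seq; apply: ler_sum => i /mem_rem; exact: fg.
Qed.

Lemma sumr_const_seq (I : Type) (r : seq I) (c : R) :
  \sum_(i <- r) c = (size r)%:R * c.
Proof. by rewrite big_const_seq count_predT iter_addr addr0 mulr_natl. Qed.

Variables (mu sigma : R -> R) (pts : seq R) (K s0 rad delta : R).
Hypothesis pts0 : pts != [::].
Hypothesis bound_coef : forall p z, p \in pts -> `|z - p| <= 1 ->
  [/\ `|mu z| <= K, `|sigma z| <= K &
      `|2^-1 * sigma z * diff_or_zero sigma z| <= K].
Hypothesis s0_ge0 : 0 <= s0.
Hypothesis sigma_ge : forall p z, p \in pts -> `|z - p| <= rad -> s0 <= `|sigma z|.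
Hypothesis delta_gt0 : 0 < delta.
Let L : R := ln delta^-1 ^+ 2.
Hypothesis L_gt0 : 0 < L.
Hypothesis L_ge : 2 * K <= L.
Hypothesis eps21 : eps2 delta <= eps1 delta.
Hypothesis eps1_le : eps1 delta <= 4^-1.
Hypothesis eps1_rad : eps1 delta <= rad.

Definition lyapunov (z : R) : R :=
  delta^-1 * \sum_(p <- pts) well (eps2 delta) (z - p).

Let e2_gt0 : 0 < eps2 delta. Proof. exact: eps2_gt0. Qed.

Lemma lyapunov_ge0 z : 0 <= lyapunov z.
Proof.
by rewrite mulr_ge0 ?invr_ge0 ?(ltW delta_gt0)// sumr_ge0// => p _; exact: well_ge0.
Qed.

Lemma lyapunov_le z : lyapunov z <= (size pts)%:R / delta.
Proof.
rewrite /lyapunov mulrC ler_wpM2r ?invr_ge0 ?(ltW delta_gt0)//.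
apply: (@le_trans _ _ (\sum_(p <- pts) 1)); last by rewrite sumr_const_seq mulr1.
by apply: ler_sum => p _; exact: well_le1.
Qed.

Lemma lyapunov_lip y z :
  `|lyapunov y - lyapunov z| <= 5 * (size pts)%:R / delta * `|y - z|.
Proof.
rewrite /lyapunov -mulrBr normrM gtr0_norm ?invr_gt0//.
rewrite [_ / delta]mulrC -mulrA ler_wpM2l ?invr_ge0 ?(ltW delta_gt0)//.
rewrite -sumrB (le_trans (ler_norm_sum _ _ _))//.
apply: (@le_trans _ _ (\sum_(p <- pts) 5 * `|y - z|)); last first.
  by rewrite sumr_const_seq; lra.
apply: ler_sum => p _; rewrite (le_trans (well_lip e2_gt0 _ _))//.
by rewrite opprB addrA subrK.
Qed.

Definition near_full (z dt : R) : bool :=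
  (dist z [set` pts] < eps1 delta) && (dt == step_size [set` pts] delta z).

Let C0 := 6 * K ^+ 2 + 10 * K.

(** The slope [b] is chosen before [dt] and [x], so the linear term has mean zero once [x] is
    integrated out. The gain is taken from the nearest exceptional point alone. *)
Lemma lyapunov_step z : exists b : R, forall dt x, 0 <= dt ->
  b * x - (size pts)%:R * C0 / delta * (dt + x ^+ 2)
   + (near_full z dt && (Num.sqrt dt <= x <= 2 * Num.sqrt dt))%:R * (s0 ^+ 2 / 96)
  <= lyapunov (milstein_step mu sigma z dt x) - lyapunov z.
Proof.
have [p0 p0s dp0] := dist_attained z pts0.
have K0 : 0 <= K.
  have p00 : `|p0 - p0| <= 1 by rewrite subrr normr0.
  by have [+ _ _] := bound_coef p0s p00; exact: le_trans.
(* If [z] is farther than 1 from [p], the well of [p] vanishes at [z] and can only grow, so slope 0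
   is enough; the coefficients are bounded only at distance at most 1. *)
pose b p := if `|z - p| <= 1 then dwell (eps2 delta) (z - p) * sigma z else 0.
exists (delta^-1 * \sum_(p <- pts) b p) => dt x dt0.
rewrite /lyapunov -mulrBr -sumrB.
set I := near_full z dt && _.
have -> : delta^-1 * (\sum_(p <- pts) b p) * x
    - (size pts)%:R * C0 / delta * (dt + x ^+ 2) + I%:R * (s0 ^+ 2 / 96) =
  delta^-1 * (\sum_(p <- pts) (b p * x - C0 * (dt + x ^+ 2))
              + I%:R * (s0 ^+ 2 / 96 * delta)).
  by rewrite sumrB -mulr_suml sumr_const_seq; field; rewrite gt_eqF.
rewrite ler_wpM2l ?invr_ge0 ?(ltW delta_gt0)//.
set S := milstein_step mu sigma z dt x.
have SE p : S - p = (z - p) + (mu z * dt + sigma z * x +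
    2^-1 * sigma z * diff_or_zero sigma z * (x ^+ 2 - dt)).
  by rewrite /S /milstein_step; ring.
have base p : p \in pts ->
    b p * x - C0 * (dt + x ^+ 2) <= well (eps2 delta) (S - p) - well (eps2 delta) (z - p).
  move=> ps; rewrite /b; case: ifPn => zp.
    have [mK sK qK] := bound_coef ps zp.
    have := well_step_ge x e2_gt0 zp mK sK qK dt0; rewrite -SE.
    have : 0 <= cut (z - p + sigma z * x) * tvee (eps2 delta) (z - p) (z - p + sigma z * x).
      by rewrite mulr_ge0 ?cut_ge0 ?tvee_ge0.
    by rewrite /C0; lra.
  rewrite mul0r sub0r (@well_eq0 _ _ (z - p)); last by rewrite ltW// ltNge.
  rewrite subr0 (le_trans _ (well_ge0 _ _))// oppr_le0 mulr_ge0//.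
    by rewrite /C0 addr_ge0// mulr_ge0// sqr_ge0.
  by rewrite addr_ge0// sqr_ge0.
apply: (ler_sum_gain p0s base).
have [In|In] := boolP I; last by rewrite mul0r addr0; exact: base.
move: In => /andP[/andP[near /eqP dtE] xdt].
have zp1 : `|z - p0| <= 1.
  rewrite -dp0 (le_trans (ltW near))// (le_trans eps1_le)//.
  by rewrite invf_le1// ler1n.
rewrite /b zp1 mul1r; have [mK sK qK] := bound_coef p0s zp1.
have := well_step_ge x e2_gt0 zp1 mK sK qK dt0; rewrite -SE.
set a := Num.max (eps2 delta) (dist z [set` pts]).
have a0 : 0 < a by rewrite lt_max e2_gt0.
have sdt : Num.sqrt dt = a / L.
  by rewrite dtE step_size_near// sqrtr_sqr ger0_norm// divr_ge0// ltW.
rewrite sdt in xdt.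
have ze1 : `|z - p0| <= rad by rewrite -dp0 (le_trans (ltW near)).
have := @near_gain (eps2 delta) L s0 (sigma z) (z - p0) a x e2_gt0.
rewrite -dp0.
(* The calibration of [eps2]: the gain does not depend on the distance and is cancelled by the
   prefactor [delta^-1]. *)
have -> : s0 ^+ 2 / 96 * (eps2 delta / L ^+ 2) = s0 ^+ 2 / 96 * delta.
  by rewrite eps2E -/L mulfK// expf_neq0// gt_eqF.
have ae : a <= eps1 delta by rewrite ge_max eps21 ltW.
have d0 := dist_ge0 z pts0.
move=> /(_ _ _ _ _ L_gt0 s0_ge0 (sigma_ge p0s ze1) _ xdt) gain.
have {}gain := gain _ _ _ _ _.
have -> : C0 = 6 * K ^+ 2 + 10 * K by [].
suff : s0 ^+ 2 / 96 * delta <= cut (z - p0 + sigma z * x) *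
   tvee (eps2 delta) (z - p0) (z - p0 + sigma z * x) by lra.
apply: gain.
- by rewrite le_max lexx orbT.
- by rewrite le_max lexx.
- by rewrite ge_max lerDl d0 lerDr ltW.
- exact: le_trans ae _.
- by apply: le_trans L_ge; rewrite ler_wpM2l.
Qed.

End lyapunov.

(** * Coefficients *)

Section coefficients.
Context {R : realType}.
Implicit Types (f : R -> R) (x : R).

Lemma lipschitz_bound f : lipschitz f ->
  exists2 k : R, 0 < k & forall x y, `|f x - f y| <= k * `|x - y|.
Proof.
move=> lf; near (pinfty_nbhs R) => k.
exists k; first by near: k; exact: nbhs_pinfty_gt.
move=> x y; have : k.-lipschitz f by near: k; exact: lf.
by move=> /(_ (x, y)); apply.
Unshelve. all: by end_near. Qed.

Lemma cvg_derive1_seq f x : derivable f x 1 ->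
  (n.+1%:R * (f (x + n.+1%:R^-1) - f x)) @[n --> \oo] --> derive1 f x.
Proof.
move=> df; rewrite derive1E; have := df; rewrite /derivable /derive => /cvgr_dnbhsP H.
have u : (forall n : nat, n.+1%:R^-1 != 0 :> R) /\
    n.+1%:R^-1 @[n --> \oo] --> (0 : R).
  by split => [n|]; [rewrite invr_neq0|exact: cvg_harmonic].
have := H _ u; rewrite /shift/=.
by under eq_fun do rewrite invrK [_%:A]mulr1 [_ + x]addrC.
Qed.

Lemma lipschitz_continuous f (k : R) : 0 < k ->
  (forall x y, `|f x - f y| <= k * `|x - y|) -> continuous f.
Proof.
move=> k0 kf x; apply/cvgrPdist_le => /= e e0.
near=> y; apply: le_trans (kf x y) _.
rewrite mulrC -ler_pdivlMr//; near: y.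
by apply: cvgr_dist_le; [exact: cvg_id|rewrite divr_gt0].
Unshelve. all: by end_near. Qed.

Lemma norm_diff_or_zero_le f (k : R) x : 0 < k ->
  (forall x y, `|f x - f y| <= k * `|x - y|) -> `|diff_or_zero f x| <= k.
Proof.
move=> k0 kf; rewrite /diff_or_zero; case: asboolP => df; last first.
  by rewrite normr0 ltW.
apply: (cvgr_to_le (cvg_norm (cvg_derive1_seq df))).
near=> n; rewrite normrM ger0_norm// -ler_pdivlMl//.
apply: le_trans (kf _ _) _.
by rewrite addrAC subrr add0r ger0_norm// mulrC.
Unshelve. all: by end_near. Qed.

(** The least [k] with [x < zeta k] gives the open interval that contains [x]. *)
Lemma smooth_outside_exceptional (m : nat) (zeta : nat -> \bar R) f x :
  is_subdivision m zeta -> piecewise_C1Lip m zeta f ->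
  ~ exceptional_points m zeta x -> derivable f x 1.
Proof.
move=> [z0 zm zlt] pf xNT.
have ex : exists k, (x%:E < zeta k)%E by exists m.+1; rewrite zm ltry.
have := ex_minnP ex; case=> -[|k] xk kmin; first by move: xk; rewrite z0.
have km : (k < m.+1)%N by apply: kmin; rewrite zm ltry.
have [+ _] := pf k.+1 km; apply => /=; rewrite xk andbT.
rewrite lt_neqAle leNgt; apply/andP; split; last first.
  by apply/negP => /kmin; rewrite ltnn.
apply/negP => /eqP zk; apply: xNT; exists k => //.
have -> : (k <= m)%N by []; rewrite andbT lt0n.
by apply/eqP => k0; move: zk; rewrite k0 z0.
Qed.

(** Off the finite set the derivative is a limit of continuous difference quotients; on the finite
    set every preimage is countable. *)
Lemma measurable_diff_or_zero f (pts : seq R) : continuous f ->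
  (forall x, x \notin pts -> derivable f x 1) ->
  measurable_fun setT (diff_or_zero f).
Proof.
move=> cf df.
have mpts : measurable [set` pts].
  apply: countable_measurable => //; exact/finite_set_countable/finite_seq.
rewrite -(setUv [set` pts]); apply/measurable_funU => //; first exact: measurableC.
split.
  move=> _ Y mY; apply: countable_measurable => //.
  apply: sub_countable (_ : countable [set` pts]).
    by apply: subset_card_le => x [].
  exact/finite_set_countable/finite_seq.
apply: (@measurable_fun_cvg _ _ _ _
  (fun n x => n.+1%:R * (f (x + n.+1%:R^-1) - f x))).
  move=> n; apply: measurable_funTS; apply: measurable_funM => //.
  apply: measurable_funB; last exact: continuous_measurable_fun.
  apply: measurableT_comp; first exact: continuous_measurable_fun.
  exact: measurable_funD.
move=> x /= /negP xpts; have dx := df _ xpts.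
by rewrite /diff_or_zero asboolT//; exact: cvg_derive1_seq.
Qed.

Lemma log_large (A : R) : exists2 d1 : R, 0 < d1 &
  forall delta, 0 < delta -> delta <= d1 -> A <= ln delta^-1.
Proof.
exists (expR (- A)); first exact: expR_gt0.
move=> delta d0 dA; rewrite lnV ?posrE// lerNr -(expRK (- A)).
by rewrite ler_ln// posrE expR_gt0.
Qed.

Lemma eps1_small (r : R) : 0 < r -> exists2 d1 : R, 0 < d1 &
  forall delta, 0 < delta -> delta <= d1 -> eps1 delta <= r.
Proof.
(* With [t = ln delta^-1], [eps1] is [t ^+ 2 * expR (- (t / 2))]; the cubic term of the exponential
   series of [t / 2] has denominator [2 ^ 3 * 3! = 48]. *)
move=> r0; have [d1 d10 hd1] := log_large (Num.max 1 (48 / r)).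
exists d1 => // delta d0 /(hd1 _ d0); rewrite ge_max => /andP[t1 tr].
rewrite /eps1; set t := ln delta^-1 in t1 tr *.
have -> : delta = expR (- t) by rewrite /t lnV ?posrE// opprK lnK ?posrE.
have -> : expR (- t) = expR (- (t / 2)) ^+ 2.
  by rewrite -expRM_natl; congr expR; field.
rewrite sqrtr_sqr ger0_norm ?expR_ge0// expRN mulrC ler_pdivrMr ?expR_gt0//.
have t2 : 0 <= t / 2 by lra.
have := expR_ge1Dxn 2 t2; move=> h.
have : t ^+ 2 <= r * ((t / 2) ^+ 3 / 6).
  have h2 : 48 <= r * t by move: tr; rewrite ler_pdivrMr// mulrC.
  have -> : r * ((t / 2) ^+ 3 / 6) = t ^+ 2 * ((r * t) / 48) by field.
  by rewrite ler_peMr ?sqr_ge0//; lra.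
move=> /le_trans; apply; rewrite ler_wpM2l ?(ltW r0)//.
by apply: le_trans h; rewrite lerDr.
Qed.

End coefficients.

(** * Gaussian moments *)

Section normal_moments.
Context {R : realType}.
Local Notation mu := (@lebesgue_measure R).
Variable s : R.
Local Notation N := (normal_prob (0 : R) s).
Local Notation mR := (measurableTypeR R).
Local Notation pdf := (normal_pdf (0 : R) s).
Import HBNNSimple.

Let pdf_ge0 x : (0 <= (pdf x)%:E)%E.
Proof. by rewrite lee_fin normal_pdf_ge0. Qed.

Let mpdf : measurable_fun setT (fun x : mR => (pdf x)%:E).
Proof. by apply/measurable_EFinP; exact: measurable_normal_pdf. Qed.

Let normal_indic (E : set mR) : measurable E ->
  (\int[N]_x (\1_E x)%:E = \int[mu]_x ((\1_E x)%:E * (pdf x)%:E))%E.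
Proof.
move=> mE; rewrite integral_indic// setIT /= /normal_prob integral_mkcond/=.
by apply: eq_integral => x _; rewrite patchE indicE;
  case: ifPn => _; rewrite ?mul1e ?mul0e.
Qed.

Let normal_nnsfun (f : {nnsfun mR >-> R}) :
  (\int[N]_x (f x)%:E = \int[mu]_x ((f x)%:E * (pdf x)%:E))%E.
Proof.
under [LHS]eq_integral do rewrite fimfunE -fsumEFin//.
rewrite [LHS]ge0_integral_fsum//; last 2 first.
  - by move=> r; exact/measurable_EFinP/measurableT_comp.
  - by move=> n x _; rewrite EFinM nnfun_muleindic_ge0.
under [RHS]eq_integral.
  move=> x xD; rewrite fimfunE -fsumEFin// muleC ge0_mule_fsumr; last first.
    by move=> r; rewrite EFinM nnfun_muleindic_ge0.
  over.
rewrite [RHS]ge0_integral_fsum//; last 2 first.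
  - move=> r; apply: emeasurable_funM => //.
    by apply/measurable_EFinP/measurableT_comp.
  - by move=> n x _; rewrite mule_ge0// EFinM nnfun_muleindic_ge0.
apply: eq_fsbigr => r _.
rewrite integralZl_indic_nnsfun// integral_indic// setIT.
under [RHS]eq_integral do rewrite EFinM muleCA.
have [r0|r0] := ltP r 0.
  rewrite (_ : f @^-1` [set r] = set0) ?measure0 ?mule0; last first.
    by apply/preimage_nnfun0.
  by rewrite integral0_eq// => x _; rewrite indicE in_set0 !mule0.
rewrite ge0_integralZl//.
- have mfr : measurable (f @^-1` [set r]) by exact: measurable_sfunP.
  have := normal_indic mfr; rewrite integral_indic// setIT => ->.
  by congr (_ * _)%E; apply: eq_integral => x _; rewrite muleC.
- apply: emeasurable_funM => //.
  by apply/measurable_EFinP/measurable_indic.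
- by move=> x _; rewrite mule_ge0// lee_fin.
Qed.

(** From simple functions by monotone convergence on both sides. *)
Lemma ge0_integral_normal_prob (f : mR -> \bar R) :
  measurable_fun setT f -> (forall x, 0 <= f x)%E ->
  (\int[N]_x f x = \int[mu]_x (f x * (pdf x)%:E))%E.
Proof.
move=> mf f0; pose f_ := nnsfun_approx measurableT mf.
transitivity (lim (\int[N]_x (f_ n x)%:E @[n --> \oo])%E).
  rewrite -monotone_convergence//=.
  - apply: eq_integral => ? /[!inE] xD; apply/esym/cvg_lim => //=.
    exact: cvg_nnsfun_approx.
  - by move=> n; exact/measurable_EFinP/measurable_funTS.
  - by move=> n ? _; rewrite lee_fin.
  - by move=> ? _ ? ? mn; rewrite lee_fin; exact/lefP/nd_nnsfun_approx.
rewrite [RHS](_ : _ = lim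
    (\int[mu]_x ((f_ n x)%:E * (pdf x)%:E) @[n --> \oo])%E); last first.
  rewrite -monotone_convergence//=.
  - apply: eq_integral => x /[!inE] xD; apply/esym/cvg_lim => //.
    by apply: cvgeZr => //; exact: cvg_nnsfun_approx.
  - move=> n; apply: emeasurable_funM => //.
    exact/measurable_EFinP/measurable_funTS.
  - by move=> n ? _; rewrite mule_ge0// lee_fin.
  - move=> x _ ? ? ?; apply: lee_wpmul2r => //.
    by rewrite lee_fin; exact/lefP/nd_nnsfun_approx.
by apply: congr_lim; apply/funext => n /=; exact: normal_nnsfun.
Qed.

Hypothesis s_gt0 : 0 < s.

Let s_neq0 : s != 0. Proof. by rewrite gt_eqF. Qed.

Let pdfN x : pdf (- x) = pdf x.
Proof. by rewrite !normal_pdfE// /normal_fun !subr0 sqrrN. Qed.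

Lemma normal_probN (A : set mR) : measurable A ->
  pushforward N (-%R : mR -> mR) A = N A.
Proof.
move=> mA; rewrite /pushforward /normal_prob.
transitivity (\int[mu]_(x in -%R @^-1` A) (pdf (- x))%:E)%E.
  by apply: eq_integral => x _; rewrite pdfN.
transitivity (\int[pushforward mu (-%R : _ -> mR)]_(x in A) (pdf x)%:E)%E.
  by rewrite ge0_integral_pushforward//=; exact: measurable_funTS.
by apply: eq_measure_integral => B mB BA; exact: lebesgue_measureN.
Qed.

(* [x ^+ 2 <= 4 s^2 exp (x^2 / (4 s^2))], and the weight turns the density of
   variance [s^2] into [sqrt 2] times that of variance [2 s^2]. *)
Lemma normal_second_moment :
  (\int[N]_x (x ^+ 2)%:E <= (8 * s ^+ 2)%:E)%E.
Proof.
rewrite (@ge0_integral_normal_prob (fun x => (x ^+ 2)%:E)); first last.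
- by move=> x; rewrite lee_fin sqr_ge0.
- by apply/measurable_EFinP; exact: measurable_funX.
pose t := Num.sqrt 2 * s.
have t0 : t != 0 by rewrite gt_eqF// mulr_gt0// sqrtr_gt0.
have t2 : t ^+ 2 = 2 * s ^+ 2 by rewrite exprMn sqr_sqrtr.
have st2 : s ^+ 2 > 0 by rewrite exprn_gt0.
have mt : measurable_fun [set: mR] (fun x => (normal_pdf 0 t x)%:E).
  by apply/measurable_EFinP; exact: measurable_normal_pdf.
apply: (@le_trans _ _ (\int[mu]_x ((8 * s ^+ 2)%:E * (normal_pdf 0 t x)%:E))%E).
  apply: ge0_le_integral => //.
  - by move=> x _; rewrite mule_ge0// lee_fin sqr_ge0.
  - by apply: emeasurable_funM => //; apply/measurable_EFinP; exact: measurable_funX.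
  - by apply: emeasurable_funM.
  move=> x _; rewrite -!EFinM lee_fin !normal_pdfE//.
  rewrite /normal_fun !subr0 /normal_peak t2.
  have -> : Num.sqrt (2 * s ^+ 2 * pi *+ 2) = Num.sqrt 2 * Num.sqrt (s ^+ 2 * pi *+ 2).
    by rewrite -sqrtrM//; congr Num.sqrt; ring.
  set p := Num.sqrt (s ^+ 2 * pi *+ 2).
  have p0 : 0 < p by rewrite sqrtr_gt0 mulrn_wgt0// mulr_gt0 ?pi_gt0.
  have -> : - x ^+ 2 / (s ^+ 2 *+ 2) = - (x ^+ 2 / (4 * s ^+ 2)) + - x ^+ 2 / ((2 * s ^+ 2) *+ 2).
    by field; rewrite gt_eqF.
  rewrite expRD.
  set E1 := expR (- (_ / _)); set E2 := expR (- x ^+ 2 / _).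
  have h1 : x ^+ 2 * E1 <= 4 * s ^+ 2.
    rewrite /E1 expRN ler_pdivrMr ?expR_gt0//.
    have : x ^+ 2 / (4 * s ^+ 2) <= expR (x ^+ 2 / (4 * s ^+ 2)).
      by apply: le_trans (expR_ge1Dx _); rewrite lerDr.
    by rewrite ler_pdivrMr ?mulr_gt0// mulrC.
  have h2 : 1 <= 2 * (Num.sqrt 2)^-1 :> R.
    rewrite ler_pdivlMr ?sqrtr_gt0// mul1r.
    rewrite -[leRHS]ger0_norm// -sqrtr_sqr ler_sqrt//; lra.
  have -> : x ^+ 2 * (p^-1 * (E1 * E2)) = (x ^+ 2 * E1) * (p^-1 * E2) by ring.
  have -> : 8 * s ^+ 2 * ((Num.sqrt 2 * p)^-1 * E2) =
    (4 * s ^+ 2 * (2 * (Num.sqrt 2)^-1)) * (p^-1 * E2).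
    by rewrite invfM; ring.
  rewrite ler_wpM2r ?mulr_ge0 ?invr_ge0 ?(ltW p0) ?expR_ge0//.
  by rewrite (le_trans h1)// ler_peMr// mulr_ge0// ltW.
rewrite ge0_integralZl//; first last.
- by rewrite lee_fin mulr_ge0// ltW.
- by move=> x _; rewrite lee_fin normal_pdf_ge0.
by rewrite integral_normal_pdf mule1.
Qed.

Lemma integrable_normal_sqr : N.-integrable setT (fun x => (x ^+ 2)%:E).
Proof.
apply/integrableP; split; first by apply/measurable_EFinP; exact: measurable_funX.
under eq_integral do rewrite gee0_abs ?lee_fin ?sqr_ge0//.
by rewrite (le_lt_trans normal_second_moment)// ltry.
Qed.

Lemma integrable_normal_id : N.-integrable setT (fun x => x%:E).
Proof.
apply: (@le_integrable _ _ _ _ _ measurableT _ (fun x : mR => (1 + x ^+ 2)%:E)).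
- exact/measurable_EFinP.
- move=> x _ /=; rewrite lee_fin [leRHS]ger0_norm ?addr_ge0 ?sqr_ge0//.
  rewrite -(real_normK (num_real x)); have := sqr_ge0 (`|x| - 1).
  by rewrite sqrrB; have := normr_ge0 x; lra.
- under eq_fun do rewrite EFinD.
  apply: integrableD => //; last exact: integrable_normal_sqr.
  exact: finite_measure_integrable_cst.
Qed.

(** By symmetry the mean is its own opposite, and it is finite. *)
Lemma normal_mean : (\int[N]_x x%:E = 0)%E.
Proof.
have E : (\int[N]_x x%:E = - \int[N]_x x%:E)%E.
  rewrite -[RHS]integralN; last first.
    rewrite fin_num_adde_defl// fin_numN.
    exact: integrable_neg_fin_num integrable_normal_id.
  transitivity (\int[pushforward N (-%R : mR -> mR)]_x x%:E)%E.
    by apply: eq_measure_integral => A mA _; exact/esym/normal_probN.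
  rewrite integral_pushforward//.
  exact: integrableN integrable_normal_id.
have fin : (\int[N]_x x%:E)%E \is a fin_num.
  exact: integrable_fin_num integrable_normal_id.
move: E; rewrite -(fineK fin) -EFinN => -[] E; congr EFin.
by set y := fine _ in E *; lra.
Qed.

(** The interval has length [sqrt h], and on it the density is at least
    [expR (- 4) / sqrt (4 * pi * h)], so [h] cancels. The variance is left free up to a factor 2
    because rounded times give it only approximately. *)
Lemma normal_prob_shell (h : R) : 0 < h -> h / 2 <= s ^+ 2 -> s ^+ 2 <= 2 * h ->
  ((expR (- 4) / Num.sqrt (4 * pi))%:E <=
     N [set x : R | (Num.sqrt h <= x <= 2 * Num.sqrt h)%R])%E.
Proof.
move=> h0 hs1 hs2; rewrite -set_itvcc /normal_prob.
set J : set R := [set` _].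
pose c := expR (- 4) / Num.sqrt (4 * pi * h).
have c0 : 0 <= c by rewrite divr_ge0 ?expR_ge0 ?sqrtr_ge0.
have sh : 0 < Num.sqrt h by rewrite sqrtr_gt0.
apply: (@le_trans _ _ (\int[mu]_(x in J) c%:E)%E).
  rewrite /J integral_cst//= lebesgue_measure_itv/= lte_fin.
  rewrite ltr_pMl// ltr1n -EFinB -EFinM lee_fin /c.
  have -> : 2 * Num.sqrt h - Num.sqrt h = Num.sqrt h by ring.
  rewrite (@sqrtrM _ (4 * pi) h) ?mulr_ge0 ?pi_ge0// invfM mulrA mulfVK//.
  by rewrite gt_eqF.
apply: ge0_le_integral => //=.
- exact: measurable_itv.
- apply/measurable_EFinP/measurable_funTS; exact: measurable_normal_pdf.
move=> x; rewrite /J /= in_itv/= => /andP[x1 x2]; rewrite lee_fin normal_pdfE//.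
rewrite /normal_fun subr0 /c mulrC ler_pM ?invr_ge0 ?sqrtr_ge0 ?expR_ge0//.
  rewrite /normal_peak lef_pV2 ?posrE ?sqrtr_gt0 ?mulr_gt0 ?pi_gt0//; last first.
    by rewrite mulrn_wgt0// mulr_gt0 ?pi_gt0// exprn_gt0.
  rewrite ler_sqrt ?mulr_ge0 ?pi_ge0 ?(ltW h0)//.
  by have := pi_gt0 R => pi0; rewrite -mulr_natl; nra.
rewrite ler_expR mulNr lerNl opprK ler_pdivrMr ?mulrn_wgt0 ?exprn_gt0//.
have : x ^+ 2 <= (2 * Num.sqrt h) ^+ 2 by rewrite lerXn2r ?nnegrE//; lra.
by rewrite exprMn sqr_sqrtr ?(ltW h0)// -mulr_natl; lra.
Qed.

(** Integrates the minorant term by term: the linear part has mean zero, the quadratic part is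
    bounded by the second moment, the indicator by the shell. [kappa = 0] covers the steps that
    bring no gain. *)
Lemma normal_lower_bound (g : R -> R) (M a b c kappa h : R) :
  measurable_fun setT g -> (forall x, `|g x| <= M) -> 0 <= c ->
  0 <= kappa -> (kappa != 0 -> [/\ 0 < h, h / 2 <= s ^+ 2 & s ^+ 2 <= 2 * h]) ->
  (forall x, a + b * x - c * x ^+ 2 +
    kappa * (Num.sqrt h <= x <= 2 * Num.sqrt h)%R%:R <= g x) ->
  ((a + kappa * (expR (- 4) / Num.sqrt (4 * pi)) - 8 * c * s ^+ 2)%:E <=
   \int[N]_x (g x)%:E)%E.
Proof.
move=> mg gM c0 k0 hk lg.
have [E EE] : exists E, E = [set x : mR | (Num.sqrt h <= x <= 2 * Num.sqrt h)%R] by eexists.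
have mE : measurable E by rewrite EE -set_itvcc; exact: measurable_itv.
have EI x : (\1_E x)%:E = ((Num.sqrt h <= x <= 2 * Num.sqrt h)%R%:R)%:E :> \bar R.
  rewrite indicE EE; congr ((nat_of_bool _)%:R%:E).
  by apply/idP/idP => [/set_mem//|/mem_set].
pose l1 (x : mR) : \bar R := (b%:E * x%:E)%E.
pose l2 (x : mR) : \bar R := (a%:E - c%:E * (x ^+ 2)%:E)%E.
pose l3 (x : mR) : \bar R := (kappa%:E * (\1_E x)%:E)%E.
have isq : N.-integrable setT (fun x : mR => (c%:E * (x ^+ 2)%:E)%E).
  by apply: integrableZl => //; exact: integrable_normal_sqr.
have icst (k : R) : N.-integrable setT (fun x : mR => k%:E).
  exact: finite_measure_integrable_cst.
have i1 : N.-integrable setT l1 by apply: integrableZl => //; exact: integrable_normal_id.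
have i2 : N.-integrable setT l2 by exact: integrableB.
have iE : N.-integrable setT (fun x : mR => (\1_E x)%:E) by exact: integrable_indic.
have i3 : N.-integrable setT l3 by exact: integrableZl.
have ig : N.-integrable setT (fun x : mR => (g x)%:E).
  apply: (@le_integrable _ _ _ _ _ measurableT _ (fun x : mR => M%:E)).
  - exact/measurable_EFinP.
  - by move=> x _ /=; rewrite lee_fin (le_trans (gM x))// ler_norm.
  - exact: icst.
have il12 : N.-integrable setT (fun x => l1 x + l2 x)%E by exact: integrableD.
have il : N.-integrable setT (fun x => l1 x + l2 x + l3 x)%E by exact: integrableD.
apply: (@le_trans _ _ (\int[N]_x (l1 x + l2 x + l3 x)%E)%E); last first.
  apply: le_integral => // x _; rewrite /l1 /l2 /l3 EI.
  rewrite -!EFinM -EFinB -!EFinD lee_fin; have := lg x; lra.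
rewrite integralD// integralD// integralB// !integralZl//; first last.
- exact: integrable_normal_id.
- exact: integrable_normal_sqr.
rewrite normal_mean mule0 add0e integral_indic// setIT.
rewrite (integral_cst _ measurableT a%:E).
rewrite [X in (a%:E * X)%E](_ : _ = 1%E) ?mule1; last exact: probability_setT.
have := normal_second_moment.
have fq : (\int[N]_x (x ^+ 2)%:E)%E \is a fin_num.
  exact: integrable_fin_num integrable_normal_sqr.
have fE : (N : {measure set mR -> \bar R}) E \is a fin_num by exact: fin_num_measure.
rewrite -(fineK fq) lee_fin => h1.
apply: (@le_trans _ _ (a - c * fine (\int[N]_x (x ^+ 2)%:E) +
  kappa * fine ((N : {measure set mR -> \bar R}) E))%:E); last first.
  by rewrite EFinD EFinB !EFinM (fineK fE) (fineK fq).
rewrite lee_fin addrAC lerD//.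
  rewrite lerD2l lerN2 (mulrC 8) -mulrA ler_wpM2l//; exact: h1.
have [->|kn0] := eqVneq kappa 0; first by rewrite !mul0r.
have [h0 hs1 hs2] := hk kn0.
rewrite ler_wpM2l// -lee_fin (fineK fE) EE; exact: normal_prob_shell.
Qed.

End normal_moments.

(** * One path of the scheme *)

Section counting_path.
Context {R : realType}.
Variable N : R -> nat.
Hypothesis N_nd : forall s t, 0 <= s -> s <= t -> (N s <= N t)%N.
Hypothesis N_rc : forall t, 0 <= t ->
  ((N s)%:R : R) @[s --> t^'+] --> ((N t)%:R : R).

(** Values of a counting path that differ by less than 1 are equal. *)
Lemma right_constant t : 0 <= t ->
  exists2 e, 0 < e & forall s, t <= s < t + e -> N s = N t.
Proof.
move=> t0; have := N_rc t0 => /cvgrPdist_lt/(_ 1 ltr01) [e /= e0 he].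
exists e => // s /andP[ts ste]; have [->//|st] := eqVneq s t.
have ts' : t < s by rewrite lt_neqAle eq_sym st.
have /he/(_ ts') : ball t e s.
  by rewrite /ball/= ltr0_norm ?subr_lt0// opprB ltrBlDl.
have := N_nd t0 ts => Nts.
rewrite -normrN opprB -natrB// ger0_norm//.
by rewrite -[1]/(1%:R) ltr_nat ltnS leqn0 subn_eq0 => Nst; apply/eqP; rewrite eqn_leq Nst.
Qed.

Lemma jump_time_le i t : 0 <= t -> (i <= N t)%N -> (jump_time N i <= t%:E)%E.
Proof. by move=> t0 it; apply: ereal_inf_lbound; exists t. Qed.

Lemma jump_time_gt i t : 0 <= t -> (N t < i)%N -> (t%:E < jump_time N i)%E.
Proof.
move=> t0 Nt; have [e e0 he] := right_constant t0.
apply: (@lt_le_trans _ _ (t + e)%:E); first by rewrite lte_fin ltrDl.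
apply/ereal_infP => _ [s [s0 Ns] <-]; rewrite lee_fin leNgt; apply/negP => ste.
have : (N s < i)%N; last by rewrite ltnNge Ns.
have [ts|st] := leP t s; first by rewrite (he s)// ts ste.
exact: leq_ltn_trans (N_nd s0 (ltW st)) Nt.
Qed.

Lemma jump_time_nd i j : (i <= j)%N -> (jump_time N i <= jump_time N j)%E.
Proof.
move=> ij; apply: le_ereal_inf => _ [s [s0 Ns] <-]; exists s => //.
by split => //; exact: leq_trans Ns.
Qed.

(** Jump times are monotone in the index, those up to [N s] are at most [s], and right-continuity
    puts the following one strictly after [s]. *)
Lemma next_jumpE s : 0 <= s -> next_jump N s = jump_time N (N s).+1.
Proof.
move=> s0; apply/eqP; rewrite eq_le; apply/andP; split.
  apply: ereal_inf_lbound; exists (N s).+1 => //; split => //.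
  exact: jump_time_gt.
apply/ereal_infP => _ [i i1 [-> si]]; apply: jump_time_nd.
rewrite ltnNge; apply/negP => iN.
by move: si; rewrite ltNge jump_time_le.
Qed.

Lemma jump_at_next_jump s t : 0 <= s -> next_jump N s = t%:E -> (N s < N t)%N.
Proof.
move=> s0; rewrite next_jumpE// => jt.
have t0 : 0 <= t.
  by rewrite -lee_fin -jt; apply/ereal_infP => _ [u [u0 _] <-]; rewrite lee_fin.
rewrite ltnNge; apply/negP => NtNs.
by have := @jump_time_gt (N s).+1 t t0 NtNs; rewrite jt ltxx.
Qed.

Lemma next_jump_ge s : (s%:E <= next_jump N s)%E.
Proof. by apply/ereal_infP => _ [i _ [-> /ltW]]. Qed.

End counting_path.

(** * Deterministic step counting along one path *)

Section path.
Context {R : realType}.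
Variables (mu sigma rho : R -> R) (xi T : R) (Theta : set R) (delta : R).
Variables (W : R -> R) (N : R -> nat).
Hypothesis T_gt0 : 0 < T.
Hypothesis N_nd : forall s t, 0 <= s -> s <= t -> (N s <= N t)%N.
Hypothesis N_rc : forall t, 0 <= t ->
  ((N s)%:R : R) @[s --> t^'+] --> ((N t)%:R : R).
Hypothesis step_gt0 : forall z, 0 < step_size Theta delta z.

Local Notation nt := (next_time T Theta delta N).

Lemma next_time_min s z : 0 <= s -> s <= T ->
  (nt s z)%:E = Order.min (Order.min (s + step_size Theta delta z)%:E (next_jump N s)) T%:E.
Proof.
move=> s0 sT; rewrite /next_time fineK// fin_numElt; apply/andP; split.
  rewrite !lt_min ltNyr /= ltNyr andbT.
  by rewrite (lt_le_trans (ltNyr s) (next_jump_ge N s)).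
by rewrite gt_min ltry orbT.
Qed.

Lemma next_time_ge s z : 0 <= s -> s <= T -> s <= nt s z.
Proof.
move=> s0 sT; rewrite -lee_fin next_time_min// !le_min !lee_fin sT andbT.
by rewrite next_jump_ge lerDl ltW.
Qed.

Lemma next_time_leT s z : 0 <= s -> s <= T -> nt s z <= T.
Proof. by move=> s0 sT; rewrite -lee_fin next_time_min// ge_min lexx orbT. Qed.

(** If the minimum were attained by the next jump, [N] would have increased there. *)
Lemma next_time_full s z : 0 <= s -> s <= T -> nt s z < T -> N (nt s z) = N s ->
  nt s z - s = step_size Theta delta z.
Proof.
move=> s0 sT ntT Ns; have := next_time_min z s0 sT.
set t := nt s z in ntT Ns *.
have [h|h] := leP (Order.min (s + step_size Theta delta z)%:E (next_jump N s)) T%:E; last first.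
  by move=> [] tT; move: ntT; rewrite tT ltxx.
have [h'|h'] := leP (s + step_size Theta delta z)%:E (next_jump N s).
  by move=> [->]; rewrite addrAC subrr add0r.
move=> /esym/(jump_at_next_jump N_nd N_rc s0).
by rewrite Ns ltnn.
Qed.

Local Notation grid := (grid mu sigma rho xi T Theta delta W N).
Local Notation tau := (tau mu sigma rho xi T Theta delta W N).
Local Notation Z n := (grid n).2.

Definition dtau n := tau n.+1 - tau n.

Definition left_value n :=
  milstein_step mu sigma (Z n) (dtau n) (W (tau n.+1) - W (tau n)).

Lemma tauS n : tau n.+1 = nt (tau n) (Z n).
Proof. by rewrite /tau /=; case: (grid n). Qed.

Lemma valueS n : Z n.+1 = left_value n +
  rho (left_value n) * ((N (tau n.+1))%:R - (N (tau n))%:R).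
Proof. by rewrite /left_value /dtau /tau /=; case: (grid n). Qed.

Lemma tau_bound n : 0 <= tau n <= T.
Proof.
elim: n => [|n /andP[t0 tT]]; first by rewrite /tau/= lexx ltW.
rewrite tauS next_time_leT// andbT.
by rewrite (le_trans t0)// next_time_ge.
Qed.

Lemma tau_ge0 n : 0 <= tau n. Proof. by have /andP[] := tau_bound n. Qed.
Lemma tau_leT n : tau n <= T. Proof. by have /andP[] := tau_bound n. Qed.

Lemma tau_le n : tau n <= tau n.+1.
Proof. by rewrite tauS next_time_ge ?tau_ge0 ?tau_leT. Qed.

Lemma dtau_ge0 n : 0 <= dtau n. Proof. by rewrite subr_ge0 tau_le. Qed.

(** Each step before [T] is charged to a jump, to the arrival at [T], to [full], or to a length of
    at least [h]. The first two charges are written as increments in [n], and so is [dtau n], so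
    that they telescope. *)
Lemma step_count (full : nat -> bool) (h : R) n : 0 < h ->
  (tau n < T -> dtau n = step_size Theta delta (Z n) -> full n || (h <= dtau n)) ->
  (tau n < T)%R%:R <= ((N (tau n.+1))%:R - (N (tau n))%:R)
    + ((tau n.+1 == T)%:R - (tau n == T)%:R) + (full n)%:R + dtau n / h.
Proof.
move=> h0 fh; have [tT|tT] := ltP (tau n) T; last first.
  have tE : tau n = T by apply/eqP; rewrite eq_le tT tau_leT.
  have tE' : tau n.+1 = T.
    by apply/eqP; rewrite eq_le tau_leT/= -{1}tE tau_le.
  by rewrite /dtau tE tE' !subrr mul0r addr0 !add0r.
have a1 : 0 <= dtau n / h by rewrite divr_ge0 ?dtau_ge0// ltW.
have Nle := N_nd (tau_ge0 n) (tau_le n).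
rewrite -natrB// (lt_eqF tT) subr0 [X in X <= _](_ : _ = 1)//.
have [NN|NN] := ltnP (N (tau n)) (N (tau n.+1)).
  have : 1 <= (N (tau n.+1) - N (tau n))%:R :> R by rewrite ler1n subn_gt0.
  by have := ler0n R (tau n.+1 == T); have := ler0n R (full n); lra.
have [tT'|tT'] := eqVneq (tau n.+1) T.
  rewrite [true%:R](_ : _ = 1)//.
  by have := ler0n R (N (tau n.+1) - N (tau n)); have := ler0n R (full n); lra.
rewrite [false%:R](_ : _ = 0)//.
have /orP[fn|hn] : full n || (h <= dtau n).
  apply: fh => //; rewrite /dtau tauS; apply: next_time_full; rewrite ?tau_ge0 ?tau_leT//.
    by rewrite -tauS lt_neqAle tT' tau_leT.
  by rewrite -tauS; apply/eqP; rewrite eqn_leq NN Nle.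
  rewrite fn [true%:R](_ : _ = 1)//; have := ler0n R (N (tau n.+1) - N (tau n)); lra.
have : 1 <= dtau n / h by rewrite ler_pdivlMr// mul1r.
by have := ler0n R (N (tau n.+1) - N (tau n)); have := ler0n R (full n); lra.
Qed.

Lemma steps_count (full : nat -> bool) (h : R) (K : nat) : 0 < h ->
  (forall n, tau n < T -> dtau n = step_size Theta delta (Z n) ->
     full n || (h <= dtau n)) ->
  \sum_(n < K) (tau n < T)%R%:R <=
    (N T)%:R + 1 + \sum_(n < K) (full n)%:R + T / h.
Proof.
move=> h0 fh.
apply: (@le_trans _ _ (\sum_(0 <= n < K) (((N (tau n.+1))%:R - (N (tau n))%:R)
    + ((tau n.+1 == T)%:R - (tau n == T)%:R) + (full n)%:R + dtau n / h))).
  by rewrite big_mkord; apply: ler_sum => n _; apply: step_count => //; exact: fh.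
rewrite 3!big_split/= -mulr_suml.
rewrite (telescope_sumr (fun n => (N (tau n))%:R))//.
rewrite (telescope_sumr (fun n => (tau n == T)%:R))//.
rewrite (telescope_sumr tau)// big_mkord.
have h1 : (N (tau K))%:R - (N (tau 0))%:R <= (N T)%:R :> R.
  by rewrite lerBlDr -natrD ler_nat (leq_trans (N_nd (tau_ge0 K) (tau_leT K)))// leq_addr.
have h2 : (tau K == T)%:R - (tau 0 == T)%:R <= 1 :> R.
  rewrite lerBlDr -[1]/(1%:R) -natrD ler_nat.
  by case: (tau K == T); case: (tau 0 == T).
have h3 : (tau K - tau 0) / h <= T / h.
  rewrite ler_wpM2r ?invr_ge0 ?(ltW h0)//.
  by have := tau_ge0 0; have := tau_leT K; lra.
by lra.
Qed.

(** Before the first arrival at [T] every index counts 1 in the series. [T] is reached, since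
    otherwise all indices would count, against [steps_count] with no step marked [full]. *)
Lemma num_steps_le (h : R) : 0 < h -> (forall z, h <= step_size Theta delta z) ->
  (num_steps mu sigma rho xi T Theta delta W N <=
   \sum_(0 <= n <oo) ((tau n < T)%R%:R)%:E)%E.
Proof.
move=> h0 hh.
have [[k k1 kT]|noT] := pselect (exists2 k, (1 <= k)%N & tau k = T).
  have [k' /andP[k'1 /eqP k'T] k'min] := ex_minnP (ex_intro (fun k => (1 <= k)%N && (tau k == T)) k (introT andP (conj k1 (introT eqP kT)))).
  apply: (@le_trans _ _ (k'%:R)%:E).
    by apply: ereal_inf_lbound; exists k'.
  apply: le_trans (nneseries_lim_ge k' _); last by move=> i _; rewrite lee_fin.
  rewrite sumEFin lee_fin big_mkord (eq_bigr (fun => 1)).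
    by rewrite sumr_const card_ord.
  move=> [i ik'] _ /=; rewrite lt_neqAle tau_leT andbT.
  rewrite (_ : tau i != T)//; apply/negP => iT.
  (* Minimality concerns positive indices only; index 0 is excluded by [tau 0 = 0 < T]. *)
  have [i0|i0] := posnP i; last by have := k'min i; rewrite i0 iT leqNgt ik' => /(_ isT).
  by move: iT; rewrite i0 /tau/= lt_eqF.
have tT n : tau n < T.
  case: n => [//|n]; rewrite lt_neqAle tau_leT andbT; apply/eqP => nT.
  by apply: noT; exists n.+1.
have bound K : K%:R <= (N T)%:R + 1 + 0 + T / h.
  have := @steps_count (fun=> false) h K h0.
  rewrite (eq_bigr (fun=> 1)); last by move=> i _; rewrite tT.
  rewrite sumr_const card_ord big1//; apply => n _ ->; exact: hh.
have := bound (Num.truncn ((N T)%:R + 1 + 0 + T / h)).+1.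
rewrite leNgt => /negP; case; exact: truncnS_gt.
Qed.

(** The value just before and the value at a grid point differ only if [N] has increased; the loss,
    at most [M], is charged to that increase. *)
Lemma lyapunov_telescope (G : R -> R) (M : R) (K : nat) :
  (forall z, 0 <= G z <= M) ->
  \sum_(n < K) (G (left_value n) - G (Z n)) <= M * (1 + (N T)%:R).
Proof.
move=> GM; have M0 : 0 <= M by have /andP[g0 gM] := GM 0; exact: le_trans gM.
apply: (@le_trans _ _ (\sum_(0 <= n < K) ((G (Z n.+1) - G (Z n)) +
    M * ((N (tau n.+1))%:R - (N (tau n))%:R)))).
  rewrite big_mkord; apply: ler_sum => n _.
  have Nle := N_nd (tau_ge0 n) (tau_le n).
  have [NN|NN] := ltnP (N (tau n)) (N (tau n.+1)).
    have /andP[_ gM] := GM (left_value n); have /andP[g0 _] := GM (Z n.+1).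
    have : 1 <= (N (tau n.+1))%:R - (N (tau n))%:R :> R.
      by rewrite -natrB// ler1n subn_gt0.
    by move=> /(ler_wpM2l M0); lra.
  have NE : N (tau n.+1) = N (tau n) by apply/eqP; rewrite eqn_leq NN Nle.
  by rewrite valueS NE subrr !mulr0 !addr0.
rewrite big_split/= -mulr_sumr.
rewrite (telescope_sumr (fun n => G (Z n)))//.
rewrite (telescope_sumr (fun n => (N (tau n))%:R))//.
have h1 : (N (tau K))%:R - (N (tau 0))%:R <= (N T)%:R :> R.
  by rewrite lerBlDr -natrD ler_nat (leq_trans (N_nd (tau_ge0 K) (tau_leT K)))// leq_addr.
have := ler_wpM2l M0 h1.
by have /andP[_ gM] := GM (Z K); have /andP[g0 _] := GM (Z 0); lra.
Qed.

End path.

(** * Strong Markov property *)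

Section sub_sigma_algebra.
Context {d : measure_display} {Omega : measurableType d} {R : realType}.
Variable G : set (set Omega).
Hypothesis Gm : G `<=` measurable.
Local Notation FT := (g_sigma_algebraType G).

Lemma sub_measurable (A : set Omega) : <<s G >> A -> measurable A.
Proof. exact: (smallest_sub (@sigma_algebra_measurable _ Omega) Gm). Qed.

Lemma measurable_to_sub : measurable_fun setT (id : Omega -> FT).
Proof. by move=> _ Y mY; rewrite setTI; exact: sub_measurable. Qed.

Variable P : probability Omega R.
Variables (D : Omega -> R) (nu : probability (measurableTypeR R) R).
Hypothesis mD : measurable_fun setT D.
Hypothesis indep : forall E B, <<s G >> E -> measurable B ->
  P (E `&` D @^-1` B) = (P E * nu B)%E.

(* Given [<<s G>>], the argument [w] may be frozen while [D] is integrated out. *)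
Lemma freezing (f : FT * measurableTypeR R -> \bar R) :
  measurable_fun setT f -> (forall x, 0 <= f x)%E ->
  (\int[P]_w f (w, D w) = \int[P]_w \int[nu]_x f (w, x))%E.
Proof.
move=> mf f0.
pose phi (w : Omega) : FT * measurableTypeR R := (w, D w).
have mphi : measurable_fun setT phi.
  apply/measurable_fun_pairP; split; first exact: measurable_to_sub.
  exact: mD.
have mid := measurable_to_sub.
pose X : {mfun Omega >-> FT} := mfun_Sub (mem_set mid).
pose Phi : {mfun Omega >-> (FT * measurableTypeR R)%type} := mfun_Sub (mem_set mphi).
transitivity (\int[distribution P Phi]_z f z)%E.
  by rewrite ge0_integral_pushforward.
(* By [indep] the joint law of the identity, seen in the sub-sigma-algebra, and of [D] agrees with
   the product measure on rectangles. *)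
transitivity (\int[distribution P X \x nu]_z f z)%E.
  apply: eq_measure_integral => A mA _; apply/esym.
  by apply: product_measure_unique => // E B mE mB; exact: indep.
rewrite fubini_tonelli1// ge0_integral_pushforward//.
  exact: measurable_fun_fubini_tonelli_F.
by move=> w _; apply: integral_ge0.
Qed.

(** Localized to [E], because quantities known at a stopping time are measurable only on events of
    the form [tau <= s]; off [E] they are extended by 0. *)
Lemma freezing_le (E : set Omega) (Y1 Y2 : Omega -> R)
    (l : R * R -> R) (g : R * R * R -> R) :
  <<s G >> E -> measurable_fun (E : set FT) (Y1 : FT -> R) ->
  measurable_fun (E : set FT) (Y2 : FT -> R) ->
  measurable_fun setT l -> measurable_fun setT g ->
  (forall y, 0 <= l y) -> (forall y, 0 <= g y) ->
  (forall w, E w -> ((l (Y1 w, Y2 w))%:E <= \int[nu]_x (g (Y1 w, Y2 w, x))%:E)%E) ->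
  (\int[P]_(w in E) (l (Y1 w, Y2 w))%:E <=
   \int[P]_(w in E) (g (Y1 w, Y2 w, D w))%:E)%E.
Proof.
move=> mE mY1 mY2 ml mg l0 g0 lg.
have mEF : measurable (E : set FT) by [].
have mEO := sub_measurable mE.
pose Z1 : FT -> R := (Y1 : FT -> R) \_ E.
pose Z2 : FT -> R := (Y2 : FT -> R) \_ E.
have mZ1 : measurable_fun setT Z1 by exact: ((measurable_restrictT _ mEF).1 mY1).
have mZ2 : measurable_fun setT Z2 by exact: ((measurable_restrictT _ mEF).1 mY2).
have ZE w : E w -> (Z1 w, Z2 w) = (Y1 w, Y2 w).
  by move=> Ew; rewrite /Z1 /Z2 !patchE mem_set.
pose f (wx : FT * measurableTypeR R) : \bar R :=
  ((\1_E wx.1)%:E * (g (Z1 wx.1, Z2 wx.1, wx.2))%:E)%E.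
have mf : measurable_fun setT f.
  apply: emeasurable_funM.
    by apply/measurable_EFinP; apply: measurableT_comp.
  apply/measurable_EFinP; apply: measurableT_comp => //.
  apply/measurable_fun_pairP; split; last exact: measurable_snd.
  apply/measurable_fun_pairP; split.
    exact: (measurableT_comp mZ1).
  exact: (measurableT_comp mZ2).
have f0 x : (0 <= f x)%E by rewrite mule_ge0// lee_fin.
have := freezing mf f0.
rewrite [X in X = _](_ : _ = \int[P]_(w in E) (g (Y1 w, Y2 w, D w))%:E)%E; last first.
  rewrite [RHS]integral_mkcond; apply: eq_integral => w _.
  rewrite /f/= patchE indicE; case: ifPn => [/set_mem Ew|_]; last by rewrite mul0e.
  by rewrite mul1e ZE.
move=> ->; rewrite integral_mkcond.
have -> : (fun w => (l (Y1 w, Y2 w))%:E) \_ E =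
    (fun w => (\1_E w)%:E * (l (Z1 w, Z2 w))%:E)%E.
  apply/funext => w; rewrite patchE indicE.
  by case: ifPn => [/set_mem Ew|_]; rewrite ?mul0e// mul1e ZE.
apply: ge0_le_integral => //.
- by move=> w _; rewrite mule_ge0// lee_fin.
- have ml' : measurable_fun setT (fun w : FT => (\1_E w)%:E * (l (Z1 w, Z2 w))%:E)%E.
    apply: emeasurable_funM; first by apply/measurable_EFinP; exact: measurable_indic.
    by apply/measurable_EFinP; apply: measurableT_comp => //; exact/measurable_fun_pairP.
  exact: (measurableT_comp ml' measurable_to_sub).
- have mF := @measurable_fun_fubini_tonelli_F _ _ _ _ _ nu f mf f0.
  exact: (measurableT_comp mF measurable_to_sub).
move=> w _; rewrite /f/= indicE.
case: (boolP (w \in E)) => [/set_mem Ew|_]; last first.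
  by rewrite mul0e; apply: integral_ge0 => x _; rewrite mul0e.
rewrite mul1e; under eq_integral do rewrite mul1e.
by rewrite ZE//; exact: lg.
Qed.

End sub_sigma_algebra.

(** * Dyadic approximation of times *)

Section dyadic.
Context {R : realType}.
Implicit Types (k j : nat) (t : R).

Definition dyadic k j : R := j%:R / 2 ^+ k.

Definition dyadic_index k t : nat := Num.truncn (t * 2 ^+ k).

(** Strictly above [t], as a limit from the right requires; [dyadic_down] never looks beyond [t],
    which adaptedness requires. *)
Definition dyadic_up k t : R := dyadic k (dyadic_index k t).+1.
Definition dyadic_down k t : R := dyadic k (dyadic_index k t).

Let pow_gt0 k : 0 < 2 ^+ k :> R. Proof. by rewrite exprn_gt0. Qed.

Lemma dyadic_ge0 k j : 0 <= dyadic k j.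
Proof. by rewrite divr_ge0// ltW. Qed.

Lemma dyadic_le k i j : (i <= j)%N -> dyadic k i <= dyadic k j.
Proof. by move=> ij; rewrite ler_pM2r ?invr_gt0// ler_nat. Qed.

Lemma dyadic_lt k i j : (i < j)%N -> dyadic k i < dyadic k j.
Proof. by move=> ij; rewrite ltr_pM2r ?invr_gt0// ltr_nat. Qed.

Lemma dyadicS k j : dyadic k j.+1 = dyadic k j + 2^-1 ^+ k.
Proof. by rewrite /dyadic -natr1 mulrDl mul1r exprVn. Qed.

Lemma dyadic_double k j : dyadic k.+1 j.*2 = dyadic k j.
Proof.
by rewrite /dyadic -muln2 natrM exprSr invfM; field; rewrite gt_eqF.
Qed.

Lemma dyadic_indexP k t : 0 <= t ->
  dyadic k (dyadic_index k t) <= t < dyadic k (dyadic_index k t).+1.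
Proof.
move=> t0; have : 0 <= t * 2 ^+ k by rewrite mulr_ge0// ltW.
move=> /truncn_itv; rewrite -/(dyadic_index k t) => /andP[h1 h2].
by rewrite /dyadic ler_pdivrMr// ltr_pdivlMr// h1.
Qed.

Lemma dyadic_indexE k t j : 0 <= t ->
  (dyadic_index k t == j) = (dyadic k j <= t < dyadic k j.+1).
Proof.
move=> t0; rewrite /dyadic_index truncn_eq; last by rewrite mulr_ge0// ltW.
by rewrite /dyadic ler_pdivrMr// ltr_pdivlMr.
Qed.

Lemma dyadic_down_bound k t : 0 <= t -> t - 2^-1 ^+ k <= dyadic_down k t <= t.
Proof.
by move=> /(dyadic_indexP k) /andP[h1]; rewrite dyadicS /dyadic_down; lra.
Qed.

Lemma dyadic_up_bound k t : 0 <= t -> t < dyadic_up k t <= t + 2^-1 ^+ k.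
Proof.
by move=> /(dyadic_indexP k) /andP[h1]; rewrite /dyadic_up dyadicS; lra.
Qed.

Lemma cvg_half_pow : 2^-1 ^+ k @[k --> \oo] --> (0 : R).
Proof. by apply: cvg_expr; rewrite ger0_norm ?invr_ge0// invf_lt1// ltr1n. Qed.

Lemma cvg_dyadic_up t : 0 <= t -> dyadic_up k t @[k --> \oo] --> t.
Proof.
move=> t0; apply: (@squeeze_cvgr _ _ _ _ (fun=> t) (fun k => t + 2^-1 ^+ k)).
- by near=> k; have /andP[/ltW -> ->] := dyadic_up_bound k t0.
- exact: cvg_cst.
- by rewrite -[X in _ --> X]addr0; apply: cvgD; [exact: cvg_cst|exact: cvg_half_pow].
Unshelve. all: by end_near. Qed.

Lemma cvg_dyadic_down t : 0 <= t -> dyadic_down k t @[k --> \oo] --> t.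
Proof.
move=> t0; apply: (@squeeze_cvgr _ _ _ _ (fun k => t - 2^-1 ^+ k) (fun=> t)).
- by near=> k; exact: dyadic_down_bound.
- by rewrite -[X in _ --> X]subr0; apply: cvgB; [exact: cvg_cst|exact: cvg_half_pow].
- exact: cvg_cst.
Unshelve. all: by end_near. Qed.

End dyadic.

Lemma measurable_index d d' (T : measurableType d) (U : measurableType d')
    (D : set T) (X : nat -> T -> U) (q : T -> nat) :
  (forall j, measurable (D `&` [set w | q w = j])) ->
  (forall j, measurable_fun (D `&` [set w | q w = j]) (X j)) ->
  measurable_fun D (fun w => X (q w) w).
Proof.
move=> mq mX; rewrite (_ : D = \bigcup_j (D `&` [set w | q w = j])); last first.
  by apply/seteqP; split => [w Dw|w [j _ []]//]; exists (q w).
apply/measurable_fun_bigcup => // j; apply: eq_measurable_fun (mX j).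
by move=> w /set_mem[_ /= ->].
Qed.

Lemma dyadic_index_set {R : realType} (T : Type) (tau : T -> R) k j :
  (forall w, 0 <= tau w) ->
  [set w | dyadic_index k (tau w) = j] =
  tau @^-1` [set` `[dyadic k j, dyadic k j.+1[ ].
Proof.
move=> tau0; apply/seteqP; split => w /=; rewrite in_itv/=.
  by move=> <-; exact: dyadic_indexP.
by move=> h; apply/eqP; rewrite dyadic_indexE.
Qed.

(** The cells are enumerated by the codes of pairs; a code that is not attained gives the empty
    cell. *)
Lemma ge0_le_integral_partition d (T : measurableType d) (R : realType)
    (mu : {measure set T -> \bar R}) (q : T -> nat * nat) (f1 f2 : T -> \bar R) :
  (forall i j, measurable [set w | q w = (i, j)]) ->
  measurable_fun setT f1 -> measurable_fun setT f2 ->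
  (forall w, 0 <= f1 w)%E -> (forall w, 0 <= f2 w)%E ->
  (forall i j, \int[mu]_(w in [set w | q w = (i, j)]) f1 w <=
               \int[mu]_(w in [set w | q w = (i, j)]) f2 w)%E ->
  (\int[mu]_w f1 w <= \int[mu]_w f2 w)%E.
Proof.
move=> mq m1 m2 f10 f20 le12.
pose E n := [set w | pickle (q w) = n].
have EE n : E n = set0 \/ exists i j, E n = [set w | q w = (i, j)].
  have [En|/existsNP[w /contrapT Ew]] := pselect (forall w, ~ E n w).
    by left; apply/seteqP; split => w // /En.
  right; exists (q w).1, (q w).2; rewrite -surjective_pairing.
  apply/seteqP; split => w'; rewrite /E /= -Ew; last by move=> ->.
  exact: (pcan_inj pickleK).
have mE n : measurable (E n).
  by have [->|[i [j ->]]] := EE n.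
have tE : trivIset setT E.
  apply/trivIsetP => i j _ _ /eqP ij; apply/seteqP; split => // w [] /= wi wj.
  by apply: ij; rewrite -wi -wj.
have UE : setT = \bigcup_n E n.
  by apply/seteqP; split => // w _; exists (pickle (q w)).
rewrite UE !ge0_integral_bigcup//; last 2 first.
- exact: measurable_funTS.
- exact: measurable_funTS.
apply: lee_nneseries => [n _ _|n _]; first exact: integral_ge0.
by have [->|[i [j ->]]] := EE n; rewrite ?integral_set0.
Qed.

Section strong_markov.
Context {d : measure_display} {Omega : measurableType d} {R : realType}.
Variable P : probability Omega R.
Variable H : R -> set (set Omega).
Local Notation F s := (g_sigma_algebraType (H s)).
Hypothesis Hm : forall s, H s `<=` measurable.
Variable W : R -> Omega -> R.
Hypothesis W_adapted : forall k j s, dyadic k j <= s ->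
  measurable_fun setT (W (dyadic k j) : F s -> R).
Hypothesis W_indep : forall k i j E B, (i < j)%N -> <<s H (dyadic k i) >> E ->
  measurable B ->
  P (E `&` [set w | B (W (dyadic k j) w - W (dyadic k i) w)]) =
  (P E * normal_prob 0 (Num.sqrt (dyadic k j - dyadic k i)) B)%E.
Hypothesis W_cont : forall (w : Omega) (t : R) (u : nat -> R), 0 <= t -> (forall k, 0 <= u k) ->
  u k @[k --> \oo] --> t -> W (u k) w @[k --> \oo] --> W t w.

Definition stopping (T : R) (tau : Omega -> R) :=
  (forall w, 0 <= tau w <= T) /\ forall s, 0 <= s -> <<s H s >> [set w | tau w <= s].

(* For a stopping time [tau], this is measurability of [X] with respect to the
   sigma-algebra of events prior to [tau]. *)
Definition prior d' (U : measurableType d') (tau : Omega -> R) (X : Omega -> U) :=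
  forall s, 0 <= s -> measurable_fun ([set w | tau w <= s] : set (F s)) (X : F s -> U).

Lemma measurable_sub_fun s d' (U : measurableType d') (f : Omega -> U) :
  measurable_fun setT (f : F s -> U) -> measurable_fun setT f.
Proof. by move=> mf; exact: (measurableT_comp mf (measurable_to_sub (@Hm s))). Qed.

Lemma prior_measurable d' (U : measurableType d') T tau (X : Omega -> U) :
  stopping T tau -> prior tau X -> measurable_fun setT X.
Proof.
move=> [tau_bound _] pX; have T0 : 0 <= T.
  by have /andP[h1 h2] := tau_bound point; exact: le_trans h2.
apply: (@measurable_sub_fun T); have := pX _ T0.
rewrite (_ : [set w | tau w <= T] = setT)//.
by apply/seteqP; split => // w _ /=; have /andP[] := tau_bound w.
Qed.

Lemma measurable_W_dyadic k j : measurable_fun setT (W (dyadic k j)).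
Proof. exact: (measurable_sub_fun (W_adapted (lexx _))). Qed.

Lemma measurable_at_up (tau : Omega -> R) k : (forall w, 0 <= tau w) ->
  measurable_fun setT tau -> measurable_fun setT (fun w => W (dyadic_up k (tau w)) w).
Proof.
move=> tau0 mtau.
apply: (@measurable_index _ _ _ _ _ (fun j => W (dyadic k j.+1)) (fun w => dyadic_index k (tau w))).
  by move=> j; rewrite dyadic_index_set//; apply: mtau.
by move=> j; apply: measurable_funTS; exact: measurable_W_dyadic.
Qed.

Lemma measurable_at (tau : Omega -> R) : (forall w, 0 <= tau w) ->
  measurable_fun setT tau -> measurable_fun setT (fun w => W (tau w) w).
Proof.
move=> tau0 mtau; apply: (@measurable_fun_cvg _ _ _ _
  (fun k w => W (dyadic_up k (tau w)) w)).
  by move=> k; exact: measurable_at_up.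
move=> w _; apply: W_cont => //; last exact: cvg_dyadic_up.
by move=> k; exact: dyadic_ge0.
Qed.

(** The end time [tau'] has to be known at [tau]. Both times are rounded up to level [k]: on each
    cell the rounded increment has deterministic ends and is independent of the past, with a
    variance within [2^-1 ^+ k] of the true length. The hypothesis on [l] tolerates this error, and
    continuity of [g] in [x] with boundedness gives the limit. *)
Lemma strong_markov (T M r : R) (tau tau' Z : Omega -> R)
    (l : R * R -> R) (g : R * R * R -> R) :
  0 < r ->
  stopping T tau -> prior tau tau -> prior tau tau' -> prior tau Z ->
  (forall w, tau w <= tau' w <= T) ->
  measurable_fun setT l -> measurable_fun setT g ->
  (forall z dt, continuous (fun x => g (z, dt, x))) ->
  (forall y, 0 <= l y) -> (forall y, 0 <= g y <= M) ->
  (forall z dt v, 0 <= dt <= T -> 0 < v -> `|v - dt| <= r ->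
    ((l (z, dt))%:E <= \int[normal_prob 0 (Num.sqrt v)]_x (g (z, dt, x))%:E)%E) ->
  (forall z dt, 0 <= dt <= r -> l (z, dt) <= g (z, dt, 0)) ->
  (\int[P]_w (l (Z w, tau' w - tau w))%:E <=
   \int[P]_w (g (Z w, tau' w - tau w, W (tau' w) w - W (tau w) w))%:E)%E.
Proof.
move=> r0 st ptau ptau' pZ tautau' ml mg cg l0 g0 lg lg0.
have tau_ge0 w : 0 <= tau w by have [h _] := st; have /andP[] := h w.
have tau'_ge0 w : 0 <= tau' w.
  by have /andP[h _] := tautau' w; exact: le_trans h.
have mtau := prior_measurable st ptau.
have mtau' := prior_measurable st ptau'.
have mZ := prior_measurable st pZ.
have mdt : measurable_fun setT (fun w => tau' w - tau w) by exact: measurable_funB.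
pose G k w := g (Z w, tau' w - tau w, W (dyadic_up k (tau' w)) w - W (dyadic_up k (tau w)) w).
have mG k : measurable_fun setT (G k).
  apply: measurableT_comp => //; apply/measurable_fun_pairP; split => /=.
    by apply/measurable_fun_pairP; split.
  by apply: measurable_funB; exact: measurable_at_up.
have Gcvg : (\int[P]_w (G k w)%:E @[k --> \oo] -->
   \int[P]_w (g (Z w, tau' w - tau w, W (tau' w) w - W (tau w) w))%:E)%E.
  apply: (@dominated_cvg _ _ _ _ _ measurableT _ _ (fun=> M%:E)) => //.
  - by move=> k; apply/measurable_EFinP.
  - move=> w _; apply: cvg_EFin; first exact: nearW.
    apply: (@cvg_comp _ _ _ _ (fun x => g (Z w, tau' w - tau w, x))); last exact: cg.
    by apply: cvgB; apply: W_cont => //; do ?[by move=> k; exact: dyadic_ge0|exact: cvg_dyadic_up].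
  - exact: finite_measure_integrable_cst.
  - move=> k w _; rewrite lee_fin; have /andP[h1 h2] := g0 (Z w, tau' w - tau w, W (dyadic_up k (tau' w)) w - W (dyadic_up k (tau w)) w).
    by rewrite ger0_norm.
apply: (cvge_to_ge Gcvg).
have : 2^-1 ^+ k @[k --> \oo] --> (0 : R) by exact: cvg_half_pow.
move=> /cvgrPdist_le/(_ _ r0); apply: filterS => k; rewrite sub0r normrN => kr.
have {}kr : 2^-1 ^+ k <= r by apply: le_trans kr; exact: ler_norm.
pose q w := (dyadic_index k (tau w), dyadic_index k (tau' w)).
have qE i j : [set w | q w = (i, j)] =
    [set w | dyadic_index k (tau w) = i] `&` [set w | dyadic_index k (tau' w) = j].
  by apply/seteqP; split => w /=; [case=> -> ->|case=> <- <-].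
(* The cell is decided by the time at which the rounded increment starts, even though it also fixes
   the end time. *)
have EF i j : <<s H (dyadic k i.+1) >> [set w | q w = (i, j)].
  have s0 := dyadic_ge0 k i.+1.
  have -> : [set w | q w = (i, j)] =
    ([set w | tau w <= dyadic k i.+1] `&` tau @^-1` [set` `[dyadic k i, dyadic k i.+1[ ]) `&`
    ([set w | tau w <= dyadic k i.+1] `&` tau' @^-1` [set` `[dyadic k j, dyadic k j.+1[ ]).
    rewrite qE !dyadic_index_set//; apply/seteqP; split => w /=; rewrite !in_itv/=.
      by move=> [h1 h2]; split; split => //; case/andP: h1 => _ /ltW.
    by move=> [[_ h1] [_ h2]].
  have [_ mst] := st.
  have mtF : measurable ([set w | tau w <= dyadic k i.+1] : set (F (dyadic k i.+1))).
    exact: mst.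
  by apply: (@measurableI _ (F (dyadic k i.+1))); [apply: ptau|apply: ptau'].
apply: (@ge0_le_integral_partition _ _ _ _ q).
- by move=> i j; exact: (sub_measurable (@Hm _) (EF i j)).
- apply/measurable_EFinP; apply: (measurableT_comp ml).
  exact/measurable_fun_pairP.
- exact/measurable_EFinP.
- by move=> w; rewrite lee_fin.
- by move=> w; rewrite lee_fin; have /andP[] := g0 (Z w, tau' w - tau w, W (dyadic_up k (tau' w)) w - W (dyadic_up k (tau w)) w).
move=> i j.
have mEij := sub_measurable (@Hm _) (EF i j).
have bound w : q w = (i, j) -> [/\ dyadic k i <= tau w < dyadic k i.+1,
    dyadic k j <= tau' w < dyadic k j.+1 & 0 <= tau' w - tau w <= T].
  move=> [<- <-]; rewrite !dyadic_indexP//; split => //.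
  by have /andP[h1 h2] := tautau' w; rewrite subr_ge0 h1/= lerBlDr (le_trans h2)// lerDl.
have GE w : q w = (i, j) -> G k w =
    g (Z w, tau' w - tau w, W (dyadic k j.+1) w - W (dyadic k i.+1) w).
  by move=> [qi qj]; rewrite /G /dyadic_up qi qj.
rewrite [leRHS](_ : _ = \int[P]_(w in [set w | q w = (i, j)])
  (g (Z w, tau' w - tau w, W (dyadic k j.+1) w - W (dyadic k i.+1) w))%:E)%E; last first.
  by apply: eq_integral => w /set_mem /GE ->.
(* For [i < j] the increment is Gaussian; [j < i] contradicts [tau <= tau']; for [i = j] both ends
   round to the same time, the increment is 0 and the step is shorter than [r]. *)
have [ij|ji|ij] := ltngtP i j.
- have sub : [set w | q w = (i, j)] `<=` [set w | tau w <= dyadic k i.+1].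
    by move=> w /bound[/andP[_ /ltW]].
  have [_ mst] := st.
  have mtF : measurable ([set w | tau w <= dyadic k i.+1] : set (F (dyadic k i.+1))).
    by apply: mst; exact: dyadic_ge0.
  apply: (@freezing_le _ _ _ _ (@Hm (dyadic k i.+1)) P
    (fun w => W (dyadic k j.+1) w - W (dyadic k i.+1) w)
    (normal_prob 0 (Num.sqrt (dyadic k j.+1 - dyadic k i.+1)))
    _ _ _ Z (fun w => tau' w - tau w) l g) => //.
  + by apply: measurable_funB; exact: measurable_W_dyadic.
  + by move=> E' B mE' mB; exact: W_indep.
  + by apply: measurable_funS (pZ _ (dyadic_ge0 _ _)).
  + by apply: measurable_funB; [apply: measurable_funS (ptau' _ (dyadic_ge0 _ _))|
      apply: measurable_funS (ptau _ (dyadic_ge0 _ _))].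
  + by move=> y; have /andP[] := g0 y.
  + move=> w /bound[/andP[h1 h2] /andP[h3 h4] h5]; apply: lg => //.
      by rewrite subr_gt0 dyadic_lt.
    rewrite ler_norml; apply/andP.
    by move: h1 h2 h3 h4; rewrite !dyadicS; move: kr; split; lra.
- rewrite (_ : [set w | q w = (i, j)] = set0) ?integral_set0//.
  apply/seteqP; split => // w /bound[/andP[h1 h2] /andP[h3 h4] /andP[h5 _]].
  have : dyadic k j.+1 <= dyadic k i :> R by exact: dyadic_le.
  by lra.
- rewrite -ij in mEij bound *; apply: ge0_le_integral => //.
  + by move=> w _; rewrite lee_fin.
  + apply/measurable_EFinP/measurable_funTS; apply: (measurableT_comp ml).
    exact/measurable_fun_pairP.
  + apply/measurable_EFinP/measurable_funTS; apply: (measurableT_comp mg).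
    apply/measurable_fun_pairP; split => /=; first exact/measurable_fun_pairP.
    by apply: measurable_funB; exact: measurable_W_dyadic.
  + move=> w /bound[/andP[h1 h2] /andP[h3 h4] /andP[h5 h6]].
    rewrite lee_fin subrr lg0// h5/=.
    by move: h1 h2 h3 h4; rewrite !dyadicS; move: kr; lra.
Qed.

End strong_markov.

(** * Adaptedness of the grid *)

Section adapted_grid.
Context {d : measure_display} {Omega : measurableType d} {R : realType}.
Variable H : R -> set (set Omega).
Local Notation F s := (g_sigma_algebraType (H s)).
Hypothesis Hm : forall s, H s `<=` measurable.
Variable W : R -> Omega -> R.
Hypothesis W_adapted : forall k j s, dyadic k j <= s ->
  measurable_fun setT (W (dyadic k j) : F s -> R).
Hypothesis W_cont : forall (w : Omega) (t : R) (u : nat -> R), 0 <= t ->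
  (forall k, 0 <= u k) -> u k @[k --> \oo] --> t ->
  W (u k) w @[k --> \oo] --> W t w.
Variable N : R -> Omega -> nat.
Hypothesis N_adapted : forall (s u : R), 0 <= u ->
  measurable_fun setT (fun w : F s => (N u w)%:R : R).
Hypothesis N_nd : forall w s t, 0 <= s -> s <= t -> (N s w <= N t w)%N.
Hypothesis N_rc : forall w t, 0 <= t ->
  ((N s w)%:R : R) @[s --> t^'+] --> ((N t w)%:R : R).

Lemma prior_later d' (U : measurableType d') (T : R) (tau tau' : Omega -> R) (X : Omega -> U) :
  stopping H T tau -> (forall w, tau w <= tau' w) -> prior H tau X -> prior H tau' X.
Proof.
move=> [_ mtau] tt' pX s s0; apply: measurable_funS (pX _ s0).
  exact: mtau.
by move=> w /=; exact: le_trans.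
Qed.

Lemma measurable_prior_index (T : R) (tau : Omega -> R) k j s :
  stopping H T tau -> prior H tau tau -> 0 <= s ->
  measurable ([set w | tau w <= s] `&` [set w | dyadic_index k (tau w) = j] : set (F s)).
Proof.
move=> [tb mtau] ptau s0; rewrite dyadic_index_set; last first.
  by move=> w; have /andP[] := tb w.
by apply: ptau => //; exact: mtau.
Qed.

(** Rounding down keeps the evaluation times below [tau], hence below [s] on the event
    [tau <= s]. *)
Lemma prior_W (T : R) (tau : Omega -> R) : stopping H T tau -> prior H tau tau ->
  prior H tau (fun w => W (tau w) w).
Proof.
move=> st ptau s s0; have [tb mtau] := st.
have tau0 w : 0 <= tau w by have /andP[] := tb w.
apply: (@measurable_fun_cvg _ _ _ _
  (fun k (w : F s) => W (dyadic_down k (tau w)) w)).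
  move=> k; apply: (@measurable_index _ _ (F s) _ _ (fun j w => W (dyadic k j) w)
     (fun w => dyadic_index k (tau w))).
    by move=> j; exact: measurable_prior_index st ptau s0.
  move=> j; have [js|sj] := leP (dyadic k j) s.
    by apply: measurable_funTS; exact: W_adapted.
  rewrite (_ : _ `&` _ = set0); first exact: measurable_fun_set0.
  apply/seteqP; split => // w [/= ts wj].
  by have /andP[+ _] := dyadic_indexP k (tau0 w); rewrite wj; lra.
move=> w _; apply: W_cont => //; last exact: cvg_dyadic_down.
by move=> k; exact: dyadic_ge0.
Qed.

(** The whole jump path belongs to every [H s], so rounding up is allowed and right-continuity
    applies. *)
Lemma prior_N (T : R) (tau : Omega -> R) : stopping H T tau -> prior H tau tau ->
  prior H tau (fun w => (N (tau w) w)%:R : R).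
Proof.
move=> st ptau s s0; have [tb mtau] := st.
have tau0 w : 0 <= tau w by have /andP[] := tb w.
apply: (@measurable_fun_cvg _ _ _ _
  (fun k (w : F s) => (N (dyadic_up k (tau w)) w)%:R)).
  move=> k; apply: (@measurable_index _ _ (F s) _ _ (fun j w => (N (dyadic k j.+1) w)%:R : R)
     (fun w => dyadic_index k (tau w))).
    by move=> j; exact: measurable_prior_index st ptau s0.
  by move=> j; apply: measurable_funTS; apply: N_adapted; exact: dyadic_ge0.
move=> w _; have /cvg_at_rightP := @N_rc w (tau w) (tau0 w); apply; split.
  by move=> k; have /andP[] := dyadic_up_bound k (tau0 w).
exact: cvg_dyadic_up.
Qed.

Lemma measurable_jump_time i s :
  measurable_fun setT (fun w : F s => jump_time (N ^~ w) i).
Proof.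
(* By monotonicity of [N] the infimum may run over dyadic times. Codes of nothing give time 0,
   itself an admissible time. *)
pose u (n : nat) : R := if unpickle n is Some (k, j) then dyadic k j else 0.
have u0 n : 0 <= u n by rewrite /u; case: unpickle => // -[k j]; exact: dyadic_ge0.
pose f n (w : F s) : \bar R := if (i%:R <= (N (u n) w)%:R :> R) then (u n)%:E else +oo%E.
have mf n : measurable_fun setT (f n).
  apply: measurable_fun_ifT => //; apply: measurable_fun_ler => //.
  exact: N_adapted.
rewrite (_ : (fun w => _) = (fun w => einfs (f ^~ w) 0%N)).
  exact: measurable_fun_einfs.
apply/funext => w; apply/eqP; rewrite eq_le; apply/andP; split.
  apply/ereal_infP => _ [n _ <-]; rewrite /f; case: ifPn => [Nn|_]; last exact: leey.
  by apply: ereal_inf_lbound; exists (u n) => //; split => //; rewrite -(ler_nat R).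
apply/ereal_infP => _ [t [t0 it] <-].
have h k : (einfs (f ^~ w) 0%N <= (dyadic_up k t)%:E)%E.
  apply: ereal_inf_lbound; exists (pickle (k, (dyadic_index k t).+1)) => //.
  rewrite /f /u pickleK ler_nat (leq_trans it)//.
  by apply: N_nd => //; have /andP[/ltW] := dyadic_up_bound k t0.
have c : ((dyadic_up k t)%:E : \bar R) @[k --> \oo] --> t%:E.
  by apply: cvg_EFin; [exact: nearW|exact: cvg_dyadic_up].
by apply: (cvge_to_ge c); exact: nearW.
Qed.

Lemma prior_next_jump (T : R) (tau : Omega -> R) : stopping H T tau -> prior H tau tau ->
  prior H tau (fun w => next_jump (N ^~ w) (tau w)).
Proof.
move=> st ptau s s0; have [tb mtau] := st.
have tau0 w : 0 <= tau w by have /andP[] := tb w.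
rewrite (_ : (fun w => _) = (fun w => jump_time (N ^~ w) (N (tau w) w).+1)); last first.
  by apply/funext => w; rewrite next_jumpE//; [exact: N_nd|exact: N_rc].
apply: (@measurable_index _ _ (F s) _ _ (fun j (w : F s) => jump_time (N ^~ w) j.+1)
  (fun w => N (tau w) w)) => j.
  rewrite (_ : [set w | N (tau w) w = j] =
      (fun w => (N (tau w) w)%:R : R) @^-1` [set (j%:R : R)]).
    by apply: (prior_N st ptau) => //; exact: mtau.
  by apply/seteqP; split => w /= => [->//|/eqP]; rewrite eqr_nat => /eqP.
by apply: measurable_funTS; exact: measurable_jump_time.
Qed.

Variables (mu sigma rho : R -> R) (xi T : R) (Theta : set R) (delta : R).
Hypothesis T_gt0 : 0 < T.
Hypothesis step_gt0 : forall z, 0 < step_size Theta delta z.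
Hypothesis mstep : measurable_fun setT (step_size Theta delta).
Hypotheses (mmu : measurable_fun setT mu) (msigma : measurable_fun setT sigma)
  (mrho : measurable_fun setT rho) (mdsigma : measurable_fun setT (diff_or_zero sigma)).

Let tau n w := tau mu sigma rho xi T Theta delta (W ^~ w) (N ^~ w) n.
Let Z n w := (grid mu sigma rho xi T Theta delta (W ^~ w) (N ^~ w) n).2.

Lemma measurable_milstein_step d' (S : measurableType d') (D : set S) (z dt x : S -> R) :
  measurable_fun D z -> measurable_fun D dt -> measurable_fun D x ->
  measurable_fun D (fun w => milstein_step mu sigma (z w) (dt w) (x w)).
Proof.
move=> mz mdt mx; rewrite /milstein_step.
apply: measurable_funD.
  apply: measurable_funD; last by apply: measurable_funM => //; exact: measurableT_comp.
  by apply: measurable_funD => //; apply: measurable_funM => //; exact: measurableT_comp.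
apply: measurable_funM; last by apply: measurable_funB => //; exact: measurable_funX.
apply: measurable_funM; last exact: measurableT_comp.
by apply: measurable_funM => //; exact: measurableT_comp.
Qed.

(** The last component, that the next grid point is known at the current one, rests on the next jump
    being known in advance. *)
Lemma tau_stopping n :
  [/\ stopping H T (tau n), prior H (tau n) (tau n), prior H (tau n) (Z n)
    & prior H (tau n) (tau n.+1)].
Proof.
have bound m w : 0 <= tau m w <= T by exact: tau_bound.
have next m : stopping H T (tau m) -> prior H (tau m) (tau m) -> prior H (tau m) (Z m) ->
    prior H (tau m) (tau m.+1).
  move=> st pt pz s s0.
  rewrite (_ : tau m.+1 = (fun w => fine (Order.min (Order.min
     (tau m w + step_size Theta delta (Z m w))%:E (next_jump (N ^~ w) (tau m w))) T%:E))); last first.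
    by apply/funext => w; rewrite /tau tauS.
  apply: (measurableT_comp (fine_measurable measurableT)).
  apply: measurable_mine => //; apply: measurable_mine; last exact: (prior_next_jump st pt).
  apply/measurable_EFinP; apply: measurable_funD; first exact: pt.
  by apply: measurableT_comp => //; exact: pz.
elim: n => [|n [st pt pz pt']].
  have st : stopping H T (tau 0).
    split => // s s0; rewrite (_ : [set w | _] = setT).
      exact: (@measurableT _ (F s)).
    by apply/seteqP; split.
  have pt : prior H (tau 0) (tau 0) by move=> s s0; exact: measurable_cst.
  have pz : prior H (tau 0) (Z 0) by move=> s s0; exact: measurable_cst.
  by split => //; exact: next.
have le_tau w : tau n w <= tau n.+1 w by exact: tau_le.
have st' : stopping H T (tau n.+1).
  split => // s s0; have [_ mt] := st.
  rewrite (_ : [set w | _] = [set w | tau n w <= s] `&` tau n.+1 @^-1` [set` `]-oo, s]]).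
    by apply: pt' => //; exact: mt.
  apply/seteqP; split => w /=; rewrite in_itv/=; last by case.
  by move=> ts; split => //; exact: le_trans ts.
have pt1 : prior H (tau n.+1) (tau n.+1) by exact: prior_later st le_tau pt'.
have pt0 : prior H (tau n.+1) (tau n) by exact: prior_later st le_tau pt.
have pz0 : prior H (tau n.+1) (Z n) by exact: prior_later st le_tau pz.
have pW0 := prior_later st le_tau (prior_W st pt).
have pW1 := prior_W st' pt1.
have pN0 := prior_later st le_tau (prior_N st pt).
have pN1 := prior_N st' pt1.
have pz' : prior H (tau n.+1) (Z n.+1).
  move=> s s0; pose zl w := milstein_step mu sigma (Z n w) (tau n.+1 w - tau n w)
    (W (tau n.+1 w) w - W (tau n w) w).
  rewrite (_ : Z n.+1 = (fun w => zl w + rho (zl w) *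
     ((N (tau n.+1 w) w)%:R - (N (tau n w) w)%:R))); last first.
    by apply/funext => w; rewrite /Z valueS.
  have mzl : measurable_fun ([set w | tau n.+1 w <= s] : set (F s)) (zl : F s -> R).
    apply: measurable_milstein_step; first exact: pz0.
      by apply: measurable_funB; [exact: pt1|exact: pt0].
    by apply: measurable_funB; [exact: pW1|exact: pW0].
  apply: measurable_funD => //; apply: measurable_funM; first exact: measurableT_comp.
  by apply: measurable_funB; [exact: pN1|exact: pN0].
by split => //; exact: next.
Qed.

End adapted_grid.

(** * The filtration *)

Lemma dyadic_le_index {R : realType} k j (s : R) :
  dyadic k j <= s -> (j <= dyadic_index k s)%N.
Proof.
move=> js; have s0 : 0 <= s by rewrite (le_trans (dyadic_ge0 _ _) js).
rewrite -ltnS -(ltr_nat R); have /andP[_] := dyadic_indexP k s0.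
move=> /(le_lt_trans js); rewrite /dyadic ltr_pM2r// invr_gt0 exprn_gt0//.
Qed.

Lemma dyadic_index_dyadic {R : realType} k j : dyadic_index k (dyadic k j : R) = j.
Proof.
by apply/eqP; rewrite dyadic_indexE ?dyadic_ge0// lexx dyadic_lt.
Qed.

Section full_measure.
Context {d : measure_display} {Omega : measurableType d} {R : realType}.
Variable P : probability Omega R.
Variable Omega0 : set Omega.
Hypothesis mOmega0 : measurable Omega0.
Hypothesis Omega0C : P (~` Omega0) = 0%E.

Lemma measure_full (A : set Omega) : measurable A -> P (A `&` Omega0) = P A.
Proof.
move=> mA; rewrite (measureDI P mA mOmega0).
rewrite [X in (X + _)%E](_ : _ = 0%E) ?add0e//.
by apply: (subset_measure0 _ _ _ Omega0C); rewrite ?setDE//;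
    [exact: measurableI (measurableC _)|exact: measurableC].
Qed.

Lemma measure_eq_full (A A' : set Omega) : measurable A -> measurable A' ->
  A `&` Omega0 = A' `&` Omega0 -> P A = P A'.
Proof. by move=> mA mA' AA'; rewrite -measure_full// AA' measure_full. Qed.

End full_measure.

(** The restriction of [P] to [D] and the multiple [c] of [P] are finite measures that agree on an
    intersection-stable generator. *)
Lemma indep_extend d (Omega : measurableType d) (R : realType)
    (P : probability Omega R) (G : set (set Omega)) (D : set Omega) (c : R) :
  G `<=` measurable -> setI_closed G -> G setT -> measurable D -> 0 <= c ->
  (forall A, G A -> P (A `&` D) = (P A * c%:E)%E) ->
  forall E, <<s G >> E -> P (E `&` D) = (P E * c%:E)%E.
Proof.
move=> Gm GI GT mD c0 Gc E sE; rewrite muleC.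
apply: (@g_sigma_algebra_measure_unique _ _ _ G Gm (fun=> setT) _ _
  (mrestr P mD) (mscale (NngNum c0) P)) => //.
- exact: bigcup_const.
- by move=> A GA; rewrite -[LHS]/(P (A `&` D)) Gc// muleC.
- move=> _; rewrite -[X in (X < _)%E]/(P (setT `&` D)) setTI.
  by rewrite (le_lt_trans (probability_le1 P mD))// ltry.
Qed.

Lemma dyadic_refine {R : realType} k m i : dyadic (k + m) (i * 2 ^ m) = dyadic k i :> R.
Proof.
rewrite /dyadic exprD natrM natrX invfM; field.
by rewrite !gt_eqF// exprn_gt0.
Qed.

(** * The Brownian past enlarged by the whole jump path *)

Section filtration.
Context {d : measure_display} {Omega : measurableType d} {R : realType}.
Variable P : probability Omega R.
Variables (W : R -> {RV P >-> R}) (N : R -> {RV P >-> nat}).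
Hypothesis W_incr : independent_increments P (fun t w => W t w).
Hypothesis W_normal : forall s t : R, 0 <= s -> s < t ->
    forall B : set R, measurable B ->
      P [set w | B (W t w - W s w)] = normal_prob 0 (Num.sqrt (t - s)) B.
Hypothesis WN_indep : independent_processes P (fun t w => W t w) (fun t w => N t w).
Variable Omega0 : set Omega.
Hypothesis mOmega0 : measurable Omega0.
Hypothesis Omega0C : P (~` Omega0) = 0%E.
Hypothesis W0 : forall w, Omega0 w -> W 0 w = 0.

(** Zero off the full-measure event, where path regularity may fail. *)
Definition goodW (t : R) (w : Omega) : R := if w \in Omega0 then W t w else 0.
Definition goodN (t : R) (w : Omega) : nat := if w \in Omega0 then N t w else 0%N.

Lemma measurable_goodW t : measurable_fun setT (goodW t).
Proof.
apply: measurable_fun_ifT => //; apply: (measurable_fun_bool true).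
rewrite setTI (_ : _ @^-1` _ = Omega0)//.
by apply/seteqP; split => w /=; [move=> /set_mem|move=> /mem_set].
Qed.

Lemma measurable_goodN t : measurable_fun setT (goodN t).
Proof.
apply: measurable_fun_ifT => //; apply: (measurable_fun_bool true).
rewrite setTI (_ : _ @^-1` _ = Omega0)//.
by apply/seteqP; split => w /=; [move=> /set_mem|move=> /mem_set].
Qed.

(** Events of the jump path up to a modification off [Omega0]: the preimages under [goodN] need not
    belong to the sigma-algebra of [N] itself. *)
Definition jump_event (B : set Omega) := measurable B /\
  exists2 B0, sigma_process (fun t w => N t w) B0 & B `&` Omega0 = B0 `&` Omega0.

(** Cylinders in increments rather than values, since the increments are what is independent. *)
Definition rectangle (k n : nat) (A : set Omega) :=
  exists C : nat -> set R, exists2 B, jump_event B &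
    (forall i, measurable (C i)) /\
    A = [set w | forall i, (i < n)%N ->
      C i (goodW (dyadic k i.+1) w - goodW (dyadic k i) w)] `&` B.

(* Generates the sigma-algebra of the whole jump path and of the Brownian path up
   to [s]; the rectangles of one level are stable under intersection, and the
   sigma-algebras they generate increase with [k], so the union is stable too. *)
Definition history (s : R) (A : set Omega) :=
  exists k, <<s rectangle k (dyadic_index k s) >> A.

Lemma jump_eventT : jump_event setT.
Proof. by split => //; exists setT => //; exact: (@measurableT _ (g_sigma_algebraType _)). Qed.

Lemma jump_eventI A B : jump_event A -> jump_event B -> jump_event (A `&` B).
Proof.
move=> [mA [A0 sA AA0]] [mB [B0 sB BB0]]; split; first exact: measurableI.
exists (A0 `&` B0); first exact: (@measurableI _ (g_sigma_algebraType _)).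
by rewrite setIIl AA0 BB0 -setIIl.
Qed.

Lemma measurable_increments k n (C : nat -> set R) : (forall i, measurable (C i)) ->
  measurable [set w | forall i, (i < n)%N ->
    C i (goodW (dyadic k i.+1) w - goodW (dyadic k i) w)].
Proof.
move=> mC.
rewrite (_ : [set w | _] = \bigcap_(i in [set i | (i < n)%N])
  ((fun w => goodW (dyadic k i.+1) w - goodW (dyadic k i) w) @^-1` C i)); last first.
  by apply/seteqP; split => w.
apply: bigcap_measurableType => i _; rewrite -[X in measurable X]setTI.
by apply: measurable_funB => //; exact: measurable_goodW.
Qed.

Lemma rectangle_measurable k n : rectangle k n `<=` measurable.
Proof.
move=> _ [C [B [mB _] [mC ->]]]; apply: measurableI => //.
exact: measurable_increments.
Qed.

Lemma rectangleT k n : rectangle k n setT.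
Proof.
exists (fun=> setT), setT; first exact: jump_eventT.
by split => //; apply/seteqP; split.
Qed.

Lemma rectangleI k n : setI_closed (rectangle k n).
Proof.
move=> _ _ [C [B jB [mC ->]]] [C' [B' jB' [mC' ->]]].
exists (fun i => C i `&` C' i), (B `&` B'); first exact: jump_eventI.
split; first by move=> i; exact: measurableI.
rewrite setIACA; congr (_ `&` _); apply/seteqP; split => w /=.
  by move=> [h1 h2] i ij; split; [exact: h1|exact: h2].
by move=> h; split => i /h [].
Qed.

Lemma goodW_rectangle k n j : (j <= n)%N ->
  measurable_fun setT (goodW (dyadic k j) : g_sigma_algebraType (rectangle k n) -> R).
Proof.
elim: j => [_|j ih jn].
  rewrite (_ : goodW (dyadic k 0) = cst 0); first exact: measurable_cst.
  apply/funext => w; rewrite /goodW /dyadic mul0r.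
  by case: ifPn => // /set_mem; exact: W0.
rewrite (_ : goodW (dyadic k j.+1) =
  (fun w => goodW (dyadic k j) w + (goodW (dyadic k j.+1) w - goodW (dyadic k j) w))); last first.
  by apply/funext => w; ring.
apply: measurable_funD; first exact: ih (ltnW jn).
move=> _ Y mY; apply: sub_sigma_algebra.
exists (fun i => if i == j then Y else setT), setT; first exact: jump_eventT.
split; first by move=> i; case: ifP.
rewrite setTI setIT; apply/seteqP; split => w /=.
  by move=> Yw i _; case: eqP => // ->.
by move=> /(_ _ jn); rewrite eqxx.
Qed.

Lemma goodN_jump_event u (B : set nat) : 0 <= u -> jump_event (goodN u @^-1` B).
Proof.
move=> u0; split; first by rewrite -[X in measurable X]setTI; exact: measurable_goodN.
exists (N u @^-1` B).
  by apply: sub_sigma_algebra; exists u; split => //; exists B.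
by apply/seteqP; split => w [] /= + O; rewrite /goodN mem_set.
Qed.

Lemma jump_event_rectangle k n B : jump_event B -> rectangle k n B.
Proof.
move=> jB; exists (fun=> setT), B => //.
by split => //; rewrite [X in X `&` _](_ : _ = setT) ?setTI//; apply/seteqP; split.
Qed.

(** A coarse increment is a difference of two values on the finer grid, which are sums of fine
    increments. *)
Lemma rectangle_refine k n n' : (n.*2 <= n')%N ->
  <<s rectangle k n >> `<=` <<s rectangle k.+1 n' >>.
Proof.
move=> nn'; apply: smallest_sub; first exact: smallest_sigma_algebra.
move=> _ [C [B jB [mC ->]]].
apply: (@measurableI _ (g_sigma_algebraType (rectangle k.+1 n'))); last first.
  by apply: sub_sigma_algebra; exact: jump_event_rectangle.
rewrite (_ : [set w | _] = \bigcap_(i in [set i | (i < n)%N])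
  ((fun w => goodW (dyadic k i.+1) w - goodW (dyadic k i) w) @^-1` C i)); last first.
  by apply/seteqP; split => w.
apply: (@bigcap_measurableType _ (g_sigma_algebraType (rectangle k.+1 n'))).
move=> i /= ij; rewrite -[X in measurable X]setTI.
apply: measurable_funB => //; rewrite -dyadic_double; apply: goodW_rectangle;
  by apply: leq_trans nn'; rewrite leq_double ?(ltnW ij).
Qed.

Lemma history_level (s : R) k k' : 0 <= s -> (k <= k')%N ->
  <<s rectangle k (dyadic_index k s) >> `<=` <<s rectangle k' (dyadic_index k' s) >>.
Proof.
move=> s0; elim: k' => [|k' ih]; first by rewrite leqn0 => /eqP ->.
rewrite leq_eqVlt => /orP[/eqP ->//|/ih h]; apply: subset_trans h _.
apply: rectangle_refine; apply: dyadic_le_index; rewrite dyadic_double.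
by have /andP[] := dyadic_indexP k' s0.
Qed.

Lemma history_measurable s : history s `<=` measurable.
Proof. by move=> A [k]; apply: sub_measurable; exact: rectangle_measurable. Qed.

Lemma goodW_history k j s : dyadic k j <= s ->
  measurable_fun setT (goodW (dyadic k j) : g_sigma_algebraType (history s) -> R).
Proof.
move=> js _ Y mY; apply: sub_sigma_algebra; exists k.
by apply: goodW_rectangle => //; exact: dyadic_le_index.
Qed.

Lemma goodN_history (s u : R) : 0 <= u ->
  measurable_fun setT (fun w : g_sigma_algebraType (history s) => (goodN u w)%:R : R).
Proof.
move=> u0 _ Y mY; apply: sub_sigma_algebra; exists 0%N; apply: sub_sigma_algebra.
apply: jump_event_rectangle; rewrite setTI.
exact: (@goodN_jump_event u [set n | Y n%:R]).
Qed.

Lemma measurable_sigma_process_W (t : R) : 0 <= t ->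
  measurable_fun setT (W t : g_sigma_algebraType
    [set A | exists t : R, 0 <= t /\ exists2 B : set R, measurable B & A = W t @^-1` B] -> R).
Proof.
move=> t0 _ Y mY; rewrite setTI; apply: sub_sigma_algebra.
by exists t; split => //; exists Y.
Qed.

Lemma rectangle_indep k i j A B : (i < j)%N -> rectangle k i A -> measurable B ->
  P (A `&` [set w | B (goodW (dyadic k j) w - goodW (dyadic k i) w)]) =
  (P A * normal_prob 0 (Num.sqrt (dyadic k j - dyadic k i)) B)%E.
Proof.
move=> ij [C [J [mJ [J0 sJ0 JJ0]] [mC AE]]] mB.
(* The grid up to [i] followed by one long step to [j], so that the future increment is the last of
   [i.+1] consecutive increments. *)
pose t l : R := if (l <= i)%N then dyadic k l else dyadic k j.
have t0 l : 0 <= t l by rewrite /t; case: ifP => _; exact: dyadic_ge0.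
have t_nd l : t l <= t l.+1.
  rewrite /t; case: ltnP => [li|il]; first by rewrite (ltnW li) dyadic_le.
  by case: ifP => // li; apply: dyadic_le; exact: leq_trans (ltnW ij).
pose D Y : set Omega := [set w | Y (goodW (dyadic k j) w - goodW (dyadic k i) w)].
have mD Y : measurable Y -> measurable (D Y).
  move=> mY; rewrite -[X in measurable X]setTI.
  by apply: measurable_funB => //; exact: measurable_goodW.
have key Y : measurable Y -> P (A `&` D Y) =
    ((\prod_(l < i) P ((fun w => W (t l.+1) w - W (t l) w)%R @^-1` C l)) *
     P [set w | Y (W (dyadic k j) w - W (dyadic k i) w)%R] * P J0)%E.
  move=> mY; pose C' l := if (l < i)%N then C l else Y.
  have mC' l : measurable (C' l) by rewrite /C'; case: ifP.
  pose I : set Omega := \bigcap_(l in [set: 'I_i.+1]) ((fun w => W (t l.+1) w - W (t l) w) @^-1` C' l).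
  have sI : sigma_process (fun t w => W t w) I.
    pose S := g_sigma_algebraType [set A | exists t : R, 0 <= t /\
      exists2 B : set R, measurable B & A = W t @^-1` B].
    rewrite -[sigma_process _ _]/(@measurable _ S I).
    apply: fin_bigcap_measurable => [|l _]; first exact: finite_finset.
    rewrite -[X in measurable X]setTI.
    by apply: measurable_funB => //; exact: measurable_sigma_process_W.
  have mI : measurable I.
    apply: fin_bigcap_measurable => [|l _]; first exact: finite_finset.
    by rewrite -[X in measurable X]setTI; exact: measurable_funB.
  have mJ0 : measurable J0.
    move: sJ0; apply: sub_measurable => _ [u [u0 [B' mB' ->]]].
    by rewrite -[X in measurable X]setTI; exact: measurable_funP.
  rewrite (@measure_eq_full _ _ _ P Omega0 mOmega0 Omega0C _ (I `&` J0)); last 3 first.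
  - apply: measurableI; last exact: mD.
    by rewrite AE; apply: measurableI => //; exact: measurable_increments.
  - exact: measurableI.
  - rewrite AE [X in X `&` Omega0]setIAC -setIA JJ0 -[RHS]setIA (setIC J0) !setIA.
    congr (_ `&` _); apply/seteqP; split => w [+ Ow].
      move=> [h1]; rewrite /D /= /goodW mem_set// => h2; split => // l _ /=.
      rewrite /C' /t; have [li|il] := ltnP l i.
        by have := h1 _ li; rewrite /goodW mem_set// (ltnW li).
      have -> : l = i :> nat by apply/eqP; rewrite eqn_leq il -ltnS ltn_ord.
      by rewrite leqnn.
    move=> h; split => //; split => [l li|].
      have := h (Ordinal (ltnW li : (l < i.+1)%N)) Logic.I.
      by rewrite /= /C' li /t li (ltnW li) /goodW mem_set.
    have := h ord_max Logic.I; rewrite /= /C' ltnn /t leqnn ltnn.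
    by rewrite /D /= /goodW mem_set.
  rewrite WN_indep//; congr (_ * _)%E.
  rewrite (W_incr (t0 0%N) t_nd (B := fun l : 'I_i.+1 => C' l))//.
  rewrite big_ord_recr/=; congr (_ * _)%E.
    by apply: eq_bigr => l _; rewrite /C' ltn_ord.
  by rewrite /C' ltnn /t leqnn ltnn.
(* The case without constraint on the last increment identifies the remaining factors as [P A]. *)
have := key setT measurableT.
rewrite (_ : D setT = setT) ?setIT; last by apply/seteqP; split.
rewrite (_ : [set w | setT _] = setT); last by apply/seteqP; split.
rewrite probability_setT mule1 => ->.
rewrite key// W_normal ?dyadic_ge0 ?dyadic_lt//.
by rewrite muleAC.
Qed.

Lemma historyT s : history s setT.
Proof. by exists 0%N; exact: (@measurableT _ (g_sigma_algebraType _)). Qed.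

Lemma historyI (s : R) : 0 <= s -> setI_closed (history s).
Proof.
move=> s0 A B [k hA] [k' hB]; exists (maxn k k').
apply: (@measurableI _ (g_sigma_algebraType _)).
  by apply: history_level hA => //; exact: leq_maxl.
by apply: history_level hB => //; exact: leq_maxr.
Qed.

Let measurable_increment k i j B : measurable B ->
  measurable [set w | B (goodW (dyadic k j) w - goodW (dyadic k i) w)].
Proof.
move=> mB; rewrite -[X in measurable X]setTI.
by apply: measurable_funB => //; exact: measurable_goodW.
Qed.

Let normal_cst v (B : set R) : measurable B ->
  exists2 c : R, 0 <= c & normal_prob 0 v B = c%:E.
Proof.
move=> mB; have f := fin_num_measure (normal_prob 0 v) _ mB.
by exists (fine (normal_prob 0 v B)); [exact: fine_ge0|rewrite fineK].
Qed.

Let level_indep k i j E B : (i < j)%N -> <<s rectangle k i >> E -> measurable B ->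
  P (E `&` [set w | B (goodW (dyadic k j) w - goodW (dyadic k i) w)]) =
  (P E * normal_prob 0 (Num.sqrt (dyadic k j - dyadic k i)) B)%E.
Proof.
move=> ij hE mB.
have [c c0 cE] := normal_cst (Num.sqrt (dyadic k j - dyadic k i)) mB.
rewrite cE; apply: (indep_extend (@rectangle_measurable _ _) (@rectangleI _ _)
  (rectangleT _ _) (measurable_increment _ _ _ mB) c0 _ hE) => A hA.
by rewrite -cE; exact: rectangle_indep.
Qed.

Lemma history_indep k i j E B : (i < j)%N -> <<s history (dyadic k i) >> E ->
  measurable B ->
  P (E `&` [set w | B (goodW (dyadic k j) w - goodW (dyadic k i) w)]) =
  (P E * normal_prob 0 (Num.sqrt (dyadic k j - dyadic k i)) B)%E.
Proof.
move=> ij hE mB.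
have [c c0 cE] := normal_cst (Num.sqrt (dyadic k j - dyadic k i)) mB.
rewrite cE; apply: (indep_extend (@history_measurable _) _ (historyT _)
  (measurable_increment _ _ _ mB) c0 _ hE).
  by apply: historyI; exact: dyadic_ge0.
move=> A [k1 hA]; rewrite -cE.
have {}hA := history_level (dyadic_ge0 k i) (leq_maxr k k1) hA.
(* At the common level the coarse times are again grid points, of indices [i * 2 ^ m] and
   [j * 2 ^ m]. *)
have [m km] : exists m, maxn k k1 = (k + m)%N.
  by exists (maxn k k1 - k)%N; rewrite subnKC// leq_maxl.
move: hA; rewrite km -[X in dyadic_index _ X](dyadic_refine k m) dyadic_index_dyadic => hA.
have ijm : (i * 2 ^ m < j * 2 ^ m)%N by rewrite ltn_pmul2r// expn_gt0.
by have := level_indep ijm hA mB; rewrite !dyadic_refine.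
Qed.

End filtration.

(** * Constants uniform over the exceptional points *)

Section constants.
Context {R : realType}.

Lemma seq_upper_bound (f : R -> R) (pts : seq R) :
  exists2 B, 0 <= B & forall p, p \in pts -> f p <= B.
Proof.
elim: pts => [|q pts [B B0 HB]]; first by exists 0.
exists (Num.max (f q) B); first by rewrite le_max B0 orbT.
move=> p; rewrite inE le_max => /orP[/eqP ->|/HB ->]; first by rewrite lexx.
by rewrite orbT.
Qed.

Lemma seq_lower_bound (f : R -> R) (pts : seq R) : (forall p, p \in pts -> 0 < f p) ->
  exists2 s, 0 < s & forall p, p \in pts -> s <= f p.
Proof.
elim: pts => [_|q pts ih f0]; first by exists 1.
have [|s s0 Hs] := ih; first by move=> p pp; apply: f0; rewrite inE pp orbT.
exists (Num.min (f q) s); first by rewrite lt_min s0 f0// inE eqxx.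
move=> p; rewrite inE ge_min => /orP[/eqP ->|/Hs ->]; first by rewrite lexx.
by rewrite orbT.
Qed.

Lemma coefficient_bounds (mu sigma : R -> R) (k1 k2 : R) (pts : seq R) :
  0 < k1 -> (forall x y, `|mu x - mu y| <= k1 * `|x - y|) ->
  0 < k2 -> (forall x y, `|sigma x - sigma y| <= k2 * `|x - y|) ->
  exists2 K, 0 <= K & forall p z, p \in pts -> `|z - p| <= 1 ->
    [/\ `|mu z| <= K, `|sigma z| <= K & `|2^-1 * sigma z * diff_or_zero sigma z| <= K].
Proof.
move=> k10 mul k20 sigl.
have [B1 B10 HB1] := seq_upper_bound (fun p => `|mu p|) pts.
have [B2 B20 HB2] := seq_upper_bound (fun p => `|sigma p|) pts.
have near (f : R -> R) (k B p z : R) : 0 < k -> (forall x y, `|f x - f y| <= k * `|x - y|) ->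
    `|f p| <= B -> `|z - p| <= 1 -> `|f z| <= B + k.
  move=> k0 kf fp zp; rewrite -(subrK (f p) (f z)) addrC.
  apply: le_trans (ler_normD _ _) _; apply: lerD => //.
  apply: le_trans (kf _ _) _; rewrite -[leRHS]mulr1 ler_pM2l//.
exists (B1 + k1 + (B2 + k2) + (B2 + k2) * k2).
  by rewrite !addr_ge0// ?mulr_ge0// ?addr_ge0// ltW.
move=> p z pp zp.
have H1 := near _ _ _ _ _ k10 mul (HB1 p pp) zp.
have H2 := near _ _ _ _ _ k20 sigl (HB2 p pp) zp.
have Hd := norm_diff_or_zero_le z k20 sigl.
have Hp : 0 <= (B2 + k2) * k2 by rewrite mulr_ge0// ?addr_ge0// ltW.
split; [lra|lra|].
apply: (@le_trans _ _ ((B2 + k2) * k2)); last lra.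
rewrite -mulrA normrM ger0_norm ?invr_ge0// normrM.
apply: (@le_trans _ _ (`|sigma z| * `|diff_or_zero sigma z|)).
  by rewrite ler_piMl ?mulr_ge0// invf_le1// ler1n.
by apply: ler_pM.
Qed.

(** Half of the smallest [|sigma p|] survives within the radius given by the Lipschitz constant. *)
Lemma nondegenerate_near (sigma : R -> R) (k : R) (pts : seq R) :
  0 < k -> (forall x y, `|sigma x - sigma y| <= k * `|x - y|) ->
  (forall p, p \in pts -> sigma p != 0) ->
  exists2 s0, 0 < s0 & exists2 rad, 0 < rad &
    forall p z, p \in pts -> `|z - p| <= rad -> s0 <= `|sigma z|.
Proof.
move=> k0 sigl sig0.
have [|s s0 Hs] := @seq_lower_bound (fun p => `|sigma p|) pts.
  by move=> p pp; rewrite normr_gt0 sig0.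
exists (s / 2); first by rewrite divr_gt0.
exists (s / 2 / k); first by rewrite !divr_gt0.
move=> p z pp zp.
have := sigl p z; rewrite distrC => h.
have h2 : k * `|z - p| <= s / 2 by move: zp; rewrite ler_pdivlMr// mulrC.
have h3 := lerB_normD (sigma p) (sigma z - sigma p).
by have := Hs p pp; rewrite [_ + (_ - _)]addrC subrK in h3; rewrite [`|p - z|]distrC in h; lra.
Qed.

Lemma measurable_dist (pts : seq R) : pts != [::] ->
  measurable_fun setT (fun x : R => dist x [set` pts]).
Proof.
move=> pts0; apply: continuous_measurable_fun.
apply: (@lipschitz_continuous _ _ 1) => // x y.
by rewrite mul1r; exact: dist_lip.
Qed.

Lemma measurable_step_size (pts : seq R) (delta : R) : pts != [::] ->
  measurable_fun setT (step_size [set` pts] delta).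
Proof.
move=> /measurable_dist md.
rewrite /step_size; apply: measurable_fun_ifT => //; first exact: measurable_fun_ler.
apply: measurable_fun_ifT => //; first exact: measurable_fun_ler.
by apply: measurable_funX; apply: measurable_funM.
Qed.

End constants.

(** * Expected number of steps *)

Section monotone_integral.
Import HBNNSimple.

(** Compares the suprema over simple functions directly, so that it applies to [num_steps], whose
    measurability is not established. *)
Lemma ge0_le_integralT d (T : measurableType d) (R : realType)
    (mu : {measure set T -> \bar R}) (f g : T -> \bar R) :
  (forall x, 0 <= f x)%E -> (forall x, f x <= g x)%E ->
  (\int[mu]_x f x <= \int[mu]_x g x)%E.
Proof.
move=> f0 fg; rewrite !ge0_integralTE//; last first.
  by move=> x; exact: le_trans (f0 x) (fg x).
by apply: le_ereal_sup => _ [h hf <-]; exists h => // x; exact: le_trans (hf x) (fg x).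
Qed.

(** A simple function below [f], multiplied by the indicator of [D], keeps its integral and lies
    below [g] everywhere. *)
Lemma ge0_le_integral_full d (T : measurableType d) (R : realType)
    (mu : {measure set T -> \bar R}) (D : set T) (f g : T -> \bar R) :
  measurable D -> mu (~` D) = 0%E ->
  (forall x, 0 <= f x)%E -> (forall x, 0 <= g x)%E ->
  (forall x, D x -> f x <= g x)%E ->
  (\int[mu]_x f x <= \int[mu]_x g x)%E.
Proof.
move=> mD D0 f0 g0 fg; rewrite ge0_integralTE//.
apply: ge_ereal_sup => _ [h hf <-]; rewrite -integralT_nnsfun.
have mh : measurable_fun setT (fun x => h x * \1_D x) by apply: measurable_funM.
rewrite (@ae_eq_integral _ _ _ _ setT (fun x => (h x * \1_D x)%:E) (fun x => (h x)%:E))//.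
- apply: ge0_le_integralT => x; first by rewrite lee_fin mulr_ge0.
  rewrite indicE; case: (boolP (x \in D)) => xD; last by rewrite mulr0.
  by rewrite mulr1; apply: le_trans (hf x) (fg _ _); exact: set_mem.
- exact/measurable_EFinP.
- exact/measurable_EFinP.
- exists (~` D); split => //; first exact: measurableC.
  move=> x /= + Dx; apply => _; by rewrite indicE mem_set// mulr1.
Qed.

End monotone_integral.

Section expected_steps.
Context {d : measure_display} {Omega : measurableType d} {R : realType}.
Variable P : probability Omega R.
Variable H : R -> set (set Omega).
Local Notation F s := (g_sigma_algebraType (H s)).
Hypothesis Hm : forall s, H s `<=` measurable.
Variable W : R -> Omega -> R.
Hypothesis W_adapted : forall k j s, dyadic k j <= s ->
  measurable_fun setT (W (dyadic k j) : F s -> R).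
Hypothesis W_indep : forall k i j E B, (i < j)%N -> <<s H (dyadic k i) >> E ->
  measurable B ->
  P (E `&` [set w | B (W (dyadic k j) w - W (dyadic k i) w)]) =
  (P E * normal_prob 0 (Num.sqrt (dyadic k j - dyadic k i)) B)%E.
Hypothesis W_cont : forall (w : Omega) (t : R) (u : nat -> R), 0 <= t ->
  (forall k, 0 <= u k) -> u k @[k --> \oo] --> t ->
  W (u k) w @[k --> \oo] --> W t w.
Variable N : R -> Omega -> nat.
Hypothesis N_adapted : forall (s u : R), 0 <= u ->
  measurable_fun setT (fun w : F s => (N u w)%:R : R).
Hypothesis N_nd : forall w s t, 0 <= s -> s <= t -> (N s w <= N t w)%N.
Hypothesis N_rc : forall w t, 0 <= t ->
  ((N s w)%:R : R) @[s --> t^'+] --> ((N t w)%:R : R).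
Variables (mu sigma rho : R -> R) (xi T : R) (pts : seq R) (delta : R).
Hypothesis T_gt0 : 0 < T.
Hypothesis pts_neq0 : pts != [::].
Hypothesis mmu : measurable_fun setT mu.
Hypothesis msigma : measurable_fun setT sigma.
Hypothesis mrho : measurable_fun setT rho.
Hypothesis mdsigma : measurable_fun setT (diff_or_zero sigma).
Hypothesis delta_gt0 : 0 < delta.
Hypothesis L_gt0 : 0 < ln delta^-1 ^+ 2.
Hypothesis eps2_le1 : eps2 delta <= 1.

Local Notation Theta := [set` pts].
Local Notation Z w n := (grid mu sigma rho xi T Theta delta (W^~ w) (N^~ w) n).2.
Local Notation tau w n := (tau mu sigma rho xi T Theta delta (W^~ w) (N^~ w) n).
Local Notation dtau w n := (dtau mu sigma rho xi T Theta delta (W^~ w) (N^~ w) n).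

Let step_gt0 z : 0 < step_size Theta delta z.
Proof. exact: step_size_gt0. Qed.

Let tau_prior n := tau_stopping W_adapted W_cont N_adapted N_nd N_rc xi T_gt0
  step_gt0 (measurable_step_size delta pts_neq0) mmu msigma mrho mdsigma n.

Let measurable_tau n : measurable_fun setT (fun w => tau w n).
Proof. by have [st pt _ _] := tau_prior n; exact: prior_measurable Hm _ _ _ _ _ st pt. Qed.

Let measurable_Z n : measurable_fun setT (fun w => Z w n).
Proof. by have [st _ pz _] := tau_prior n; exact: prior_measurable Hm _ _ _ _ _ st pz. Qed.

Let measurable_NT : measurable_fun setT (fun w => (N T w)%:R : R).
Proof. by apply: (measurable_sub_fun Hm (s := 0)); exact: N_adapted (ltW T_gt0). Qed.

(** [full] marks the uncut steps that may be shorter than [h]; it is abstract because small and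
    large [delta] use different choices. *)
Lemma expected_num_steps (full : Omega -> nat -> bool) (h B : R) :
  0 < h -> 0 <= B ->
  (forall n, measurable_fun setT (fun w => full w n)) ->
  (forall w n, tau w n < T -> dtau w n = step_size Theta delta (Z w n) ->
    full w n || (h <= dtau w n)) ->
  (forall K, \int[P]_w (\sum_(n < K) (full w n)%:R)%:E <=
     B%:E * (1%:E + \int[P]_w (N T w)%:R%:E))%E ->
  (\int[P]_w num_steps mu sigma rho xi T Theta delta (W^~ w) (N^~ w) <=
   (1 + T / h + B)%:E * (1%:E + \int[P]_w (N T w)%:R%:E))%E.
Proof.
move=> h0 B0 mfull full_or Bfull.
have mfR n : measurable_fun setT (fun w => (full w n)%:R : R).
  rewrite (_ : (fun w => _) = (fun w => if full w n then 1 else 0)).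
    exact: measurable_fun_ifT.
  by apply/funext => w; case: (full w n).
have mtR n : measurable_fun setT (fun w => (tau w n < T)%R%:R : R).
  rewrite (_ : (fun w => _) = (fun w => if tau w n < T then 1 else 0)).
    by apply: measurable_fun_ifT => //; exact: measurable_fun_ltr.
  by apply/funext => w; case: ltP.
have EN0 : (0 <= \int[P]_w (N T w)%:R%:E)%E by apply: integral_ge0.
apply: (@le_trans _ _ (\int[P]_w \sum_(0 <= n <oo) ((tau w n < T)%R%:R)%:E)%E).
  apply: ge0_le_integralT => w.
    by apply: le_ereal_inf_tmp => _ [k _ <-]; rewrite lee_fin.
  have hmin : 0 < delta * eps2 delta by rewrite mulr_gt0// eps2_gt0.
  apply: (num_steps_le mu sigma rho xi (W^~ w) T_gt0 (@N_nd w) (@N_rc w) step_gt0 hmin).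
  by move=> z; exact: step_size_ge.
rewrite integral_nneseries//; last by move=> n; apply/measurable_EFinP.
apply: lime_le; first by apply: is_cvg_nneseries => n _ _; exact: integral_ge0.
near=> K; rewrite big_mkord -ge0_integral_sum//; last by move=> n; apply/measurable_EFinP.
apply: (@le_trans _ _ (\int[P]_w ((N T w)%:R%:E + ((1 + T / h)%:E + (\sum_(n < K) (full w n)%:R)%:E)))%E).
  apply: ge0_le_integralT => w; first by apply: sume_ge0.
  rewrite sumEFin -!EFinD lee_fin.
  apply: le_trans (steps_count T_gt0 (@N_nd w) (@N_rc w) step_gt0 K h0 (full_or w)) _.
  lra.
have Th : 0 <= T / h by rewrite divr_ge0// ltW.
rewrite ge0_integralD//; last 3 first.
- exact/measurable_EFinP.
- by move=> w _; rewrite -EFinD lee_fin !addr_ge0// sumr_ge0.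
- apply/measurable_EFinP; apply: measurable_funD => //; exact: measurable_sum.
rewrite ge0_integralD//; last 3 first.
- by move=> w _; rewrite lee_fin addr_ge0.
- by move=> w _; rewrite lee_fin sumr_ge0.
- by apply/measurable_EFinP; exact: measurable_sum.
have -> : (\int[P]__ (1 + T / h)%:E = (1 + T / h)%:E)%E.
  by have := expectation_cst P (1 + T / h); rewrite unlock.
apply: le_trans (leeD (lexx _) (leeD (lexx _) (Bfull K))) _.
case: (\int[P]_w _)%E EN0 => [e| |]// e0.
  rewrite lee_fin in e0; rewrite -[leLHS]/((e + (1 + T / h + B * (1 + e)))%:E)
    -[leRHS]/(((1 + T / h + B) * (1 + e))%:E) lee_fin.
  rewrite -subr_ge0; have -> : (1 + T / h + B) * (1 + e) - (e + (1 + T / h + B * (1 + e))) = T / h * e by ring.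
  exact: mulr_ge0.
rewrite -[leRHS]/((1 + T / h + B)%:E * +oo)%E [leRHS]gt0_muley ?leey//.
by rewrite lte_fin; lra.
Unshelve. all: by end_near. Qed.


Variables K s0 rad : R.
Hypothesis K_ge0 : 0 <= K.
Hypothesis bound_coef : forall p z, p \in pts -> `|z - p| <= 1 ->
  [/\ `|mu z| <= K, `|sigma z| <= K & `|2^-1 * sigma z * diff_or_zero sigma z| <= K].
Hypothesis s0_gt0 : 0 < s0.
Hypothesis sigma_ge : forall p z, p \in pts -> `|z - p| <= rad -> s0 <= `|sigma z|.
Hypothesis L_ge : 2 * K <= ln delta^-1 ^+ 2.
Hypothesis eps21 : eps2 delta <= eps1 delta.
Hypothesis eps1_le : eps1 delta <= 4^-1.
Hypothesis eps1_rad : eps1 delta <= rad.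

Let M : R := (size pts)%:R / delta.
Let C : R := (size pts)%:R * (6 * K ^+ 2 + 10 * K) / delta.
Let kappa : R := s0 ^+ 2 / 96.
Let p0 : R := expR (- 4) / Num.sqrt (4 * pi).
Local Notation G := (lyapunov pts delta).
Local Notation left w n := (left_value mu sigma rho xi T Theta delta (W^~ w) (N^~ w) n).
Local Notation full w n := (near_full pts delta (Z w n) (dtau w n)).

Let G_bound z : 0 <= G z <= M.
Proof. by rewrite lyapunov_ge0//= lyapunov_le. Qed.

Let C_ge0 : 0 <= C.
Proof. by rewrite /C divr_ge0 ?mulr_ge0 ?addr_ge0 ?mulr_ge0 ?sqr_ge0// ltW. Qed.

Let kappa_gt0 : 0 < kappa.
Proof. by rewrite divr_gt0// exprn_gt0. Qed.

Let p0_gt0 : 0 < p0.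
Proof. by rewrite divr_gt0 ?expR_gt0// sqrtr_gt0 mulr_gt0// pi_gt0. Qed.

Lemma continuous_lyapunov : continuous G.
Proof.
have sz : 0 < (size pts)%:R :> R by rewrite ltr0n lt0n size_eq0.
apply: (@lipschitz_continuous _ _ (5 * (size pts)%:R / delta)).
  by rewrite divr_gt0// mulr_gt0.
by move=> x y; exact: lyapunov_lip.
Qed.

Lemma measurable_near_full d' (S : measurableType d') (z dt : S -> R) :
  measurable_fun setT z -> measurable_fun setT dt ->
  measurable_fun setT (fun w => near_full pts delta (z w) (dt w)).
Proof.
move=> mz mdt; apply: measurable_and.
  by apply: measurable_fun_ltr => //; exact: (measurableT_comp (measurable_dist pts_neq0) mz).
apply: measurable_fun_eqr => //.
exact: (measurableT_comp (measurable_step_size delta pts_neq0) mz).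
Qed.

Lemma continuous_milstein_step z dt : continuous (milstein_step mu sigma z dt).
Proof.
move=> x; rewrite /milstein_step; apply: cvgD.
  by apply: cvgD; [exact: cvg_cst|apply: cvgMr; exact: cvg_id].
by apply: cvgMr; apply: cvgB; [exact: exprn_continuous|exact: cvg_cst].
Qed.

Lemma continuous_lyapunov_step z dt : continuous (fun x => G (milstein_step mu sigma z dt x)).
Proof.
move=> x; apply: (continuous_comp (f := milstein_step mu sigma z dt)).
  exact: continuous_milstein_step.
exact: continuous_lyapunov.
Qed.

Let dtau_bound w n : 0 <= dtau w n <= T.
Proof.
have := tau_leT mu sigma rho xi (W^~ w) (N^~ w) T_gt0 step_gt0 n.+1.
have := tau_ge0 mu sigma rho xi (W^~ w) (N^~ w) T_gt0 step_gt0 n.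
have := tau_le mu sigma rho xi (W^~ w) (N^~ w) T_gt0 step_gt0 n.
by move=> ? ? ?; change (0 <= tau w n.+1 - tau w n <= T); lra.
Qed.

(* The constant added on both sides makes the integrands nonnegative, as
   [strong_markov] requires; [r] bounds the time discretization error there. *)
Lemma lyapunov_expected_step (r : R) n : 0 < r -> 2 * r <= delta * eps2 delta ->
  (\int[P]_w (M + C * (9 * T + 8 * r) + (full w n)%:R * (kappa * p0)
       - C * (9 * dtau w n + 8 * r))%:E <=
   \int[P]_w (M + C * (9 * T + 8 * r) + (G (left w n) - G (Z w n)))%:E)%E.
Proof.
move=> r0 rh; pose A := M + C * (9 * T + 8 * r).
(* Set to 0 for lengths outside of [0, T], which never occur, to be nonnegative everywhere. *)
pose l (y : R * R) : R := if (0 <= y.2) && (y.2 <= T) then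
  A + (near_full pts delta y.1 y.2)%:R * (kappa * p0) - C * (9 * y.2 + 8 * r) else 0.
pose g (y : R * R * R) : R :=
  A + (G (milstein_step mu sigma y.1.1 y.1.2 y.2) - G y.1.1).
have := strong_markov Hm W_adapted W_indep W_cont (T := T) (M := A + M) (r := r)
  (tau := fun w => tau w n) (tau' := fun w => tau w n.+1) (Z := fun w => Z w n)
  (l := l) (g := g) r0.
have [st pt pZ pt'] := tau_prior n.
have M0 : 0 <= M by rewrite /M divr_ge0// ltW.
have AM : M <= A by rewrite /A; have := C_ge0; have := T_gt0; nra.
have step_ge z : 2 * r <= step_size Theta delta z.
  by apply: le_trans rh _; exact: step_size_ge.
have Gdiff z dt x : `|G (milstein_step mu sigma z dt x) - G z| <= M.
  have /andP[a1 a2] := G_bound z.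
  have /andP[b1 b2] := G_bound (milstein_step mu sigma z dt x).
  by rewrite ler_norml; lra.
have low z : exists b, forall dt x, 0 <= dt ->
    b * x - C * (dt + x ^+ 2) + (near_full pts delta z dt &&
      (Num.sqrt dt <= x <= 2 * Num.sqrt dt))%:R * kappa <=
    G (milstein_step mu sigma z dt x) - G z.
  exact: (lyapunov_step pts_neq0 bound_coef (ltW s0_gt0) sigma_ge delta_gt0 L_gt0 L_ge).
move=> /(_ st pt pt' pZ) sm.
have -> : (\int[P]_w (M + C * (9 * T + 8 * r) + (full w n)%:R * (kappa * p0)
       - C * (9 * dtau w n + 8 * r))%:E = \int[P]_w (l (Z w n, tau w n.+1 - tau w n))%:E)%E.
  by apply: eq_integral => w _; rewrite /l/= [X in (if X then _ else _)]dtau_bound.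
apply: sm.
- move=> w; rewrite (tau_le mu sigma rho xi (W^~ w) (N^~ w) T_gt0 step_gt0)/=.
  exact: (tau_leT mu sigma rho xi (W^~ w) (N^~ w) T_gt0 step_gt0).
- have m2 : measurable_fun setT (fun y : R * R => y.2) by exact: measurable_snd.
  have m1 : measurable_fun setT (fun y : R * R => y.1) by exact: measurable_fst.
  apply: measurable_fun_ifT => //.
    by apply: measurable_and; exact: measurable_fun_ler.
  apply: measurable_funB; last first.
    by apply: measurable_funM => //; apply: measurable_funD => //; exact: measurable_funM.
  apply: measurable_funD => //; apply: measurable_funM => //.
  rewrite (_ : (fun y => _) = (fun y : R * R => if near_full pts delta y.1 y.2 then 1 else 0)).
    by apply: measurable_fun_ifT => //; exact: measurable_near_full.
  by apply/funext => y; case: near_full.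
- have mG : measurable_fun setT G := continuous_measurable_fun continuous_lyapunov.
  have m1 : measurable_fun setT (fun y : R * R * R => y.1) by exact: measurable_fst.
  have m11 : measurable_fun setT (fun y : R * R * R => y.1.1).
    exact: (measurableT_comp measurable_fst m1).
  have m12 : measurable_fun setT (fun y : R * R * R => y.1.2).
    exact: (measurableT_comp measurable_snd m1).
  have m2 : measurable_fun setT (fun y : R * R * R => y.2) by exact: measurable_snd.
  apply: measurable_funD => //; apply: measurable_funB; last exact: measurableT_comp.
  by apply: (measurableT_comp mG); exact: measurable_milstein_step.
- move=> z dt x; rewrite /g/=; apply: cvgD; first exact: cvg_cst.
  by apply: cvgB; [exact: continuous_lyapunov_step|exact: cvg_cst].
- move=> [z dt]; rewrite /l/=; case: ifP => // /andP[dt0 dtT].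
  have : 0 <= (near_full pts delta z dt)%:R * (kappa * p0).
    by rewrite mulr_ge0// mulr_ge0// ltW.
  by rewrite /A; have := C_ge0; nra.
- move=> [[z dt] x]; rewrite /g/=; have := Gdiff z dt x; rewrite ler_norml; lra.
- move=> z dt v dtT v0 vdt; rewrite /l/= dtT.
  have [b lb] := low z.
  have /andP[dt0 _] := dtT.
  have sv : Num.sqrt v ^+ 2 = v by rewrite sqr_sqrtr// ltW.
  have svp : 0 < Num.sqrt v by rewrite sqrtr_gt0.
  (* The second moment contributes [8 * v <= 8 * dt + 8 * r]; with the [dt] already present this
     explains the 9. *)
  apply: (@le_trans _ _ ((A - C * dt + (near_full pts delta z dt)%:R * kappa * p0
      - 8 * C * Num.sqrt v ^+ 2)%:E)).
    rewrite lee_fin sv; have := C_ge0; move: vdt; rewrite ler_norml => /andP[_ vdt].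
    by rewrite mulrA; nra.
  apply: (@normal_lower_bound _ _ svp _ (A + M) _ b _ _ dt).
  + rewrite /g/=; apply: measurable_funD => //; apply: measurable_funB => //.
    by apply: continuous_measurable_fun; exact: continuous_lyapunov_step.
  + move=> x; rewrite /g/= ger0_norm; have := Gdiff z dt x; rewrite ler_norml; lra.
  + exact: C_ge0.
  + by rewrite mulr_ge0// ltW.
  (* A full step has [dt >= 2 * r], so an error of [r] keeps the variance between [dt / 2] and
     [2 * dt]. *)
  + have [nf _|_] := boolP (near_full pts delta z dt); last by rewrite mul0r eqxx.
    move: nf => /andP[_ /eqP dtE]; have := step_ge z; rewrite -dtE sv => h.
    by move: vdt; rewrite ler_norml; split; lra.
  + move=> x; have := lb dt x dt0; rewrite /g/= -mulnb natrM; lra.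
- move=> z dt /andP[dt0 dtr]; rewrite /l/=.
  have -> : near_full pts delta z dt = false.
    apply/negbTE/negP => /andP[_ /eqP dtE].
    by have := step_ge z; rewrite -dtE; lra.
  have [b lb] := low z; have := lb dt 0 dt0; rewrite /g/=.
  rewrite mulr0 expr0n addr0 mul0r addr0.
  have : 0 <= (near_full pts delta z dt && (Num.sqrt dt <= 0 <= 2 * Num.sqrt dt))%:R * kappa.
    by rewrite mulr_ge0// ltW.
  have := Gdiff z dt 0; rewrite ler_norml.
  by case: ifP => _; have := C_ge0; nra.
Qed.

Let measurable_dtau n : measurable_fun setT (fun w => dtau w n).
Proof. exact: measurable_funB. Qed.

Let measurable_left n : measurable_fun setT (fun w => left w n).
Proof.
have mW k : measurable_fun setT (fun w => W (tau w k) w).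
  apply: (measurable_at Hm W_adapted W_cont) => // w.
  exact: (tau_ge0 mu sigma rho xi (W^~ w) (N^~ w) T_gt0 step_gt0).
by apply: measurable_milstein_step => //; exact: measurable_funB.
Qed.

Let mfull n : measurable_fun setT (fun w => full w n).
Proof. exact: measurable_near_full. Qed.

Let mfullR n : measurable_fun setT (fun w => (full w n)%:R : R).
Proof.
rewrite (_ : (fun w => _) = (fun w => if full w n then 1 else 0)).
  exact: measurable_fun_ifT.
by apply/funext => w; case: near_full.
Qed.

Let integral_probability_cst (c : R) : (\int[P]__ c%:E = c%:E)%E.
Proof. by have := expectation_cst P c; rewrite unlock. Qed.

Lemma sum_dtau_le w k : \sum_(n < k) dtau w n <= T.
Proof.
rewrite -(big_mkord predT (fun n => tau w n.+1 - tau w n)) telescope_sumr//.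
have := tau_leT mu sigma rho xi (W^~ w) (N^~ w) T_gt0 step_gt0 k.
by rewrite [tau w 0]/= subr0.
Qed.

(** Sums the one-step inequality and bounds the right side by the telescoped Lyapunov function. The
    bound is uniform in [k], so [r] may depend on [k]. *)
Lemma expected_near_full k :
  (\int[P]_w (\sum_(n < k) (full w n)%:R)%:E <=
   ((M + 9 * C * T + 1) / (kappa * p0))%:E * (1%:E + \int[P]_w (N T w)%:R%:E))%E.
Proof.
have kp0 : 0 < kappa * p0 by rewrite mulr_gt0.
have M0 : 0 <= M by rewrite /M divr_ge0// ltW.
have C0 := C_ge0.
have hmin : 0 < delta * eps2 delta by rewrite mulr_gt0// eps2_gt0.
(* small enough for the discretization errors of [k] steps to add up to at most 1 *)
have [r [r0 rh rk]] : exists r, [/\ 0 < r, 2 * r <= delta * eps2 delta & 8 * C * r * k%:R <= 1].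
  have q0 : 0 < 8 * C * k%:R + 1 by rewrite ltr_wpDl// mulr_ge0// mulr_ge0.
  exists (Num.min (delta * eps2 delta / 2) (8 * C * k%:R + 1)^-1); split.
  - by rewrite lt_min divr_gt0//= invr_gt0.
  - by rewrite mulrC -ler_pdivlMr// ge_min lexx.
  - apply: (@le_trans _ _ ((8 * C * k%:R) * (8 * C * k%:R + 1)^-1)).
      by rewrite mulrAC ler_wpM2l ?(mulr_ge0 (mulr_ge0 _ C0))// ge_min lexx orbT.
    by rewrite ler_pdivrMr// mul1r lerDl.
set A := M + C * (9 * T + 8 * r).
have A0 : 0 <= A by rewrite /A addr_ge0// mulr_ge0// addr_ge0// mulr_ge0// ltW.
pose X n w := A + (full w n)%:R * (kappa * p0) - C * (9 * dtau w n + 8 * r).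
pose Y n w := A + (G (left w n) - G (Z w n)).
have X0 n w : 0 <= X n w.
  have /andP[_ h] := dtau_bound w n.
  have : 0 <= (full w n)%:R * (kappa * p0) by rewrite mulr_ge0// ltW.
  by rewrite /X /A; nra.
have Y0 n w : 0 <= Y n w.
  have /andP[a1 a2] := G_bound (left w n).
  have /andP[b1 b2] := G_bound (Z w n).
  have : 0 <= C * (9 * T + 8 * r) by rewrite mulr_ge0// addr_ge0// mulr_ge0// ltW.
  by rewrite /Y /A; lra.
have mX n : measurable_fun setT (X n).
  apply: measurable_funB; first by apply: measurable_funD => //; exact: measurable_funM.
  by apply: measurable_funM => //; apply: measurable_funD => //; exact: measurable_funM.
have mG : measurable_fun setT G := continuous_measurable_fun continuous_lyapunov.
have mY n : measurable_fun setT (Y n).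
  apply: measurable_funD => //; apply: measurable_funB.
    exact: (measurableT_comp mG (measurable_left n)).
  exact: (measurableT_comp mG (measurable_Z n)).
have XY : (\int[P]_w (\sum_(n < k) X n w)%:E <= \int[P]_w (\sum_(n < k) Y n w)%:E)%E.
  under eq_integral do rewrite -sumEFin.
  under [leRHS]eq_integral do rewrite -sumEFin.
  rewrite !ge0_integral_sum//.
  - by apply: lee_sum => n _; exact: lyapunov_expected_step.
  - by move=> n; apply/measurable_EFinP.
  - by move=> n w _; rewrite lee_fin.
  - by move=> n; apply/measurable_EFinP.
  - by move=> n w _; rewrite lee_fin.
have lowX : ((kappa * p0)%:E * \int[P]_w (\sum_(n < k) (full w n)%:R)%:E + (A * k%:R)%:E <=
    \int[P]_w (\sum_(n < k) X n w)%:E + (9 * C * T + 1)%:E)%E.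
  rewrite -[in leLHS](integral_probability_cst (A * k%:R)).
  rewrite -[in leRHS](integral_probability_cst (9 * C * T + 1)).
  have mS : measurable_fun setT (fun w => \sum_(n < k) (full w n)%:R : R).
    exact: measurable_sum.
  have S0 w : 0 <= \sum_(n < k) (full w n)%:R :> R by apply: sumr_ge0.
  rewrite -ge0_integralZl_EFin//; last 3 first.
  - by move=> w _; rewrite lee_fin.
  - exact/measurable_EFinP.
  - exact: ltW.
  rewrite -ge0_integralD//; last 3 first.
  - by move=> w _; rewrite -EFinM lee_fin mulr_ge0// ltW.
  - by apply/measurable_EFinP; exact: measurable_funM.
  - by move=> w _; rewrite lee_fin mulr_ge0.
  rewrite -ge0_integralD//; last 3 first.
  - by move=> w _; rewrite lee_fin sumr_ge0.
  - by apply/measurable_EFinP; exact: measurable_sum.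
  - by move=> w _; rewrite lee_fin addr_ge0// mulr_ge0 ?(ltW T_gt0)// mulr_ge0.
  apply: ge0_le_integralT => w; rewrite -EFinM -!EFinD lee_fin.
    by rewrite addr_ge0// mulr_ge0// ltW.
  rewrite /X sumrB big_split/= -mulr_suml sumr_const card_ord -mulr_natr.
  rewrite -mulr_sumr big_split/= -mulr_sumr sumr_const card_ord -(mulr_natr (8 * r)).
  have := sum_dtau_le w k; move: rk => ?; nra.
have highY : (\int[P]_w (\sum_(n < k) Y n w)%:E <=
    (A * k%:R + M)%:E + M%:E * \int[P]_w (N T w)%:R%:E)%E.
  rewrite -[in leRHS](integral_probability_cst (A * k%:R + M)).
  rewrite -ge0_integralZl_EFin//; last exact/measurable_EFinP.
  rewrite -ge0_integralD//; last 3 first.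
  - by move=> w _; rewrite lee_fin addr_ge0// mulr_ge0.
  - by move=> w _; rewrite -EFinM lee_fin mulr_ge0.
  - by apply/measurable_EFinP; exact: measurable_funM.
  apply: ge0_le_integralT => w; rewrite -?EFinM -?EFinD lee_fin.
    by apply: sumr_ge0.
  rewrite /Y big_split/= sumr_const card_ord -mulr_natr.
  have := lyapunov_telescope mu sigma rho xi (W^~ w) T_gt0 (@N_nd w) step_gt0 k G_bound.
  lra.
have EN0 : (0 <= \int[P]_w (N T w)%:R%:E)%E by apply: integral_ge0.
have ES0 : (0 <= \int[P]_w (\sum_(n < k) (full w n)%:R)%:E)%E.
  by apply: integral_ge0 => w _; rewrite lee_fin sumr_ge0.
have := le_trans lowX (leeD XY (lexx _)).
move=> /le_trans /(_ (leeD highY (lexx _))) {lowX highY XY X Y X0 Y0 mX mY}.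
have cT : 0 <= 9 * C * T by rewrite mulr_ge0 ?(ltW T_gt0)// mulr_ge0.
have B0 : 0 < (M + 9 * C * T + 1) / (kappa * p0) by rewrite divr_gt0//; lra.
(* Once all terms are finite, [A * k] cancels from both sides. *)
case: (\int[P]_w (N T w)%:R%:E)%E EN0 => [e| |]// e0; last first.
  by move=> _; rewrite -[leRHS]/(((M + 9 * C * T + 1) / (kappa * p0))%:E * +oo)%E gt0_muley ?leey.
case: (\int[P]_w _)%E ES0 => [e'| |]// e'0; last by rewrite gt0_muley.
rewrite !lee_fin in e0 e'0 * => h.
rewrite mulrAC ler_pdivlMr//.
nra.
Qed.

(** Taken with [h = delta]: an uncut step is a near one or has length [delta]. *)
Lemma expected_num_steps_near :
  (\int[P]_w num_steps mu sigma rho xi T Theta delta (W^~ w) (N^~ w) <=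
   (1 + T / delta + (M + 9 * C * T + 1) / (kappa * p0))%:E *
   (1%:E + \int[P]_w (N T w)%:R%:E))%E.
Proof.
have kp0 : 0 < kappa * p0 by rewrite mulr_gt0.
have M0 : 0 <= M by rewrite /M divr_ge0// ltW.
apply: (@expected_num_steps (fun w n => full w n)) => //.
- have ? : 0 <= 9 * C * T by rewrite mulr_ge0 ?(ltW T_gt0)// mulr_ge0.
  by rewrite divr_ge0 ?(ltW kp0)//; lra.
- move=> w n _ dtE; rewrite /near_full dtE eqxx andbT.
  by have [//|far] := ltP (dist (Z w n) Theta) (eps1 delta); rewrite step_size_far ?lexx.
- exact: expected_near_full.
Qed.

Lemma expected_num_steps_crude :
  (\int[P]_w num_steps mu sigma rho xi T Theta delta (W^~ w) (N^~ w) <=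
   (1 + T / (delta * eps2 delta))%:E * (1%:E + \int[P]_w (N T w)%:R%:E))%E.
Proof.
have := @expected_num_steps (fun=> xpred0) (delta * eps2 delta) 0.
rewrite addr0; apply => //.
- by rewrite mulr_gt0// eps2_gt0.
- by move=> w n _ ->; rewrite step_size_ge.
- move=> k; rewrite mul0e integral0_eq// => w _.
  by rewrite big1.
Qed.

End expected_steps.

(** * An event of full measure with regular paths *)

Section good_paths.
Context {d : measure_display} {Omega : measurableType d} {R : realType}.
Variable P : probability Omega R.
Variables (W : R -> {RV P >-> R}) (N : R -> {RV P >-> nat}) (lambda : R).
Hypothesis W_bm : standard_brownian_motion W.
Hypothesis N_poisson : poisson_process lambda N.
Hypothesis complete_P : measure_is_complete P.

Definition good_paths : set Omega := [set w | [/\ W 0 w = 0,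
  {within [set t : R | 0 <= t], continuous (fun t => W t w)},
  (forall s t : R, 0 <= s -> s <= t -> (N s w <= N t w)%N) &
  (forall t : R, 0 <= t ->
    ((N s w)%:R : R) @[s --> t^'+] --> ((N t w)%:R : R))]].

Lemma negligible_good_paths : P.-negligible (~` good_paths).
Proof.
have : {ae P, forall w, good_paths w}.
  have h1 := bm_start W_bm; have h2 := bm_continuous W_bm.
  have h3 := pp_nondecreasing N_poisson; have h4 := pp_right_continuous N_poisson.
  by apply: filterS (filterI (filterI h1 h2) (filterI h3 h4)) => w [[? ?] [? ?]]; split.
by [].
Qed.

(** The conditions involve uncountably many times; completeness gives measurability, as the
    complement is negligible. *)
Lemma measurable_good_paths : measurable good_paths.
Proof.
rewrite -(setCK good_paths); apply: measurableC.
exact: complete_P negligible_good_paths.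
Qed.

Lemma good_pathsC : P (~` good_paths) = 0%E.
Proof.
apply: (measure_negligible (measurableC measurable_good_paths)).
exact: negligible_good_paths.
Qed.

Lemma goodW_cvg w (t : R) (u : nat -> R) : 0 <= t -> (forall k, 0 <= u k) ->
  u k @[k --> \oo] --> t ->
  goodW W good_paths (u k) w @[k --> \oo] --> goodW W good_paths t w.
Proof.
move=> t0 u0 ut; rewrite /goodW; case: ifPn => [/set_mem[_ Wc _ _]|_]; last exact: cvg_cst.
move/subspace_continuousP : Wc => /(_ t t0) Wt.
have uw : u k @[k --> \oo] --> within [set t : R | 0 <= t] (nbhs t).
  move=> V tV; have {tV} : \forall k \near \oo, 0 <= u k -> V (u k) := ut _ tV.
  by apply: filterS => k; apply; exact: u0.
exact: (cvg_comp _ _ uw Wt).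
Qed.

Lemma goodN_nd w (s t : R) : 0 <= s -> s <= t ->
  (goodN N good_paths s w <= goodN N good_paths t w)%N.
Proof. by move=> s0 st; rewrite /goodN; case: ifPn => [/set_mem[_ _ + _]|//]; apply. Qed.

Lemma goodN_rc w (t : R) : 0 <= t ->
  ((goodN N good_paths s w)%:R : R) @[s --> t^'+] --> ((goodN N good_paths t w)%:R : R).
Proof.
move=> t0; rewrite /goodN; case: ifPn => [/set_mem[_ _ _]|_]; last exact: cvg_cst.
exact.
Qed.

End good_paths.

(** Used with [i = delta^-1]; since [1 <= i], the terms free of [i] may be multiplied by [i] too. *)
Lemma near_bound_le (R : realFieldType) (T s q k e i : R) : 0 < k -> 0 <= e -> 1 <= i ->
  (1 + T * i + (s * i + 9 * (q * i) * T + 1) / k) * (1 + e) <=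
  (1 + T + (s + 9 * q * T + 1) / k) * (1 + e) * i.
Proof.
move=> k0 e0 i1.
have -> : 1 + T * i + (s * i + 9 * (q * i) * T + 1) / k =
    (1 + T + (s + 9 * q * T + 1) / k) * i - (i - 1) * (1 + k^-1) by ring.
rewrite mulrBl [leRHS]mulrAC lerBlDr lerDl !mulr_ge0 ?subr_ge0 ?addr_ge0//.
by rewrite invr_ge0 ltW.
Qed.

Theorem theorem3p17 (R : realType) (d : measure_display)
    (Omega : measurableType d) (P : probability Omega R)
    (complete_P : measure_is_complete P)
    (T lambda : R) (T_gt0 : 0 < T) (lambda_gt0 : 0 < lambda)
    (W : R -> {RV P >-> R}) (N : R -> {RV P >-> nat})
    (W_bm : standard_brownian_motion W)
    (N_poisson : poisson_process lambda N)
    (WN_indep : independent_processes P (fun t w => W t w) (fun t w => N t w))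
    (mu sigma rho : R -> R)
    (mu_lip : lipschitz mu) (sigma_lip : lipschitz sigma)
    (rho_lip : lipschitz rho)
    (m : nat) (m_gt0 : (1 <= m)%N) (zeta : nat -> \bar R)
    (zeta_subdiv : is_subdivision m zeta)
    (mu_pw : piecewise_C1Lip m zeta mu)
    (sigma_pw : piecewise_C1Lip m zeta sigma)
    (sigma_neq0 : forall x, exceptional_points m zeta x -> sigma x != 0)
    (xi : R)
    (eps0 : R) (eps0_gt0 : 0 < eps0) (eps0_le1 : eps0 <= 1)
    (eps0_gap : forall i, (2 <= i <= m)%N ->
       (eps0%:E <= (2^-1)%:E * (zeta i - zeta i.-1))%E)
    (delta0 : R) (delta0_gt0 : 0 < delta0) (delta0_lt1 : delta0 < 1)
    (delta0_eps : forall delta : R, 0 < delta -> delta <= delta0 ->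
       eps2 delta <= eps1 delta /\ eps1 delta <= eps0 / 2) :
  exists2 c11 : R, 0 < c11 &
    forall delta : R, 0 < delta -> delta <= delta0 ->
      (\int[P]_w num_steps mu sigma rho xi T (exceptional_points m zeta) delta
                   (fun t => W t w) (fun t => N t w)
       <= c11%:E * ((delta^-1)%:E + 'E_P[fun w => (N T w)%:R]))%E.
Proof.
rewrite unlock.
have EN0 : (0 <= \int[P]_w (N T w)%:R%:E)%E by apply: integral_ge0.
have [ENoo|ENfin] := eqVneq (\int[P]_w (N T w)%:R%:E)%E +oo%E.
  (* the right-hand side is infinite *)
  exists 1 => // delta _ _.
  by rewrite ENoo addey// mul1e leey.
have [e e0 EN] : exists2 e, 0 <= e & (\int[P]_w (N T w)%:R%:E)%E = e%:E.
  move: EN0 ENfin; case: (\int[P]_w _)%E => [e| |]//.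
  by rewrite lee_fin => e0 _; exists e.
pose pts := [seq fine (zeta k.+1) | k <- iota 0 m].
have ThetaE : exceptional_points m zeta = [set` pts] by exact: exceptional_points_seq.
have pts0 : pts != [::] by rewrite /pts -size_eq0 size_map size_iota -lt0n.
have sigma_pts p : p \in pts -> sigma p != 0.
  by move=> pp; apply: sigma_neq0; rewrite ThetaE.
have [k1 k10 mul] := lipschitz_bound mu_lip.
have [k2 k20 sigl] := lipschitz_bound sigma_lip.
have [k3 k30 rhol] := lipschitz_bound rho_lip.
have [K K0 HK] := coefficient_bounds pts k10 mul k20 sigl.
have [s0 s00 [rad rad0 Hrad]] := nondegenerate_near k20 sigl sigma_pts.
have mmu := continuous_measurable_fun (lipschitz_continuous k10 mul).
have csig := lipschitz_continuous k20 sigl.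
have mrho := continuous_measurable_fun (lipschitz_continuous k30 rhol).
have mdsig : measurable_fun setT (diff_or_zero sigma).
  apply: (measurable_diff_or_zero (pts := pts)) => // x xp.
  apply: (smooth_outside_exceptional zeta_subdiv sigma_pw); rewrite ThetaE.
  exact/negP.
have ln_pos delta : 0 < delta -> delta <= delta0 -> 0 < ln delta^-1.
  by move=> d0 dd0; rewrite ln_gt0// invf_gt1//; exact: le_lt_trans delta0_lt1.
have L_pos delta : 0 < delta -> delta <= delta0 -> 0 < ln delta^-1 ^+ 2.
  by move=> d0 dd0; rewrite exprn_gt0// ln_pos.
have eps2_le1 delta : 0 < delta -> delta <= delta0 -> eps2 delta <= 1.
  by move=> d0 dd0; have [h1 h2] := delta0_eps _ d0 dd0; lra.
pose Omega0 := good_paths W N.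
have mO := measurable_good_paths W_bm N_poisson complete_P.
have OC := good_pathsC W_bm N_poisson complete_P.
have W0 w : Omega0 w -> W 0 w = 0 by case.
pose W' := goodW W Omega0; pose N' := goodN N Omega0.
have Hm := @history_measurable _ _ _ _ W N _ mO.
have Wad := fun k j s => @goodW_history _ _ _ _ W N _ W0 k j s.
have Nad := fun s u => @goodN_history _ _ _ _ W N _ mO s u.
have Wind := fun k i j E B => @history_indep _ _ _ _ _ _ (bm_indep W_bm) (bm_normal W_bm)
  WN_indep _ mO OC W0 k i j E B.
have Wcv := @goodW_cvg _ _ _ _ W N.
have Nnd := @goodN_nd _ _ _ _ W N.
have Nrc := @goodN_rc _ _ _ _ W N.
have EN' : (1%:E + \int[P]_w (N' T w)%:R%:E <= (1 + e)%:E)%E.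
  rewrite EFinD leeD2l// -EN; apply: ge0_le_integralT => w //.
  by rewrite lee_fin ler_nat /N' /goodN; case: ifP.
(* Passes from the modified paths to the given ones and absorbs the factor [1 + E N_T] into the
   constant. *)
have reduce delta c c' : 0 < delta -> 0 <= c -> c * (1 + e) <= c' * delta^-1 -> 0 <= c' ->
   (\int[P]_w num_steps mu sigma rho xi T [set` pts] delta (W'^~ w) (N'^~ w)
     <= c%:E * (1%:E + \int[P]_w (N' T w)%:R%:E))%E ->
   (\int[P]_w num_steps mu sigma rho xi T (exceptional_points m zeta) delta
      (fun t => W t w) (fun t => N t w)
     <= c'%:E * ((delta^-1)%:E + \int[P]_w (N T w)%:R%:E))%E.
  move=> d0 c0 cc' c'0 H.
  have num0 (A : Omega -> R -> R) (B : Omega -> R -> nat) (Th : set R) w :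
      (0 <= num_steps mu sigma rho xi T Th delta (A w) (B w))%E.
    by apply: le_ereal_inf_tmp => _ [k _ <-]; rewrite lee_fin.
  apply: (@le_trans _ _ (\int[P]_w num_steps mu sigma rho xi T [set` pts] delta (W'^~ w) (N'^~ w))%E).
    apply: (ge0_le_integral_full mO OC) => w.
    - exact: (num0 (fun w t => W t w) (fun w t => N t w)).
    - exact: (num0 (fun w => W'^~ w) (fun w => N'^~ w)).
    - move=> Ow; rewrite ThetaE le_eqVlt; apply/orP; left; apply/eqP.
      by congr num_steps; apply/funext => t; rewrite /W' /N' /goodW /goodN mem_set.
  apply: le_trans H _; rewrite EN.
  apply: (@le_trans _ _ (c%:E * (1 + e)%:E)%E); first exact: lee_wpmul2l.
  rewrite -EFinD -!EFinM lee_fin; apply: le_trans cc' _.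
  by rewrite ler_wpM2l// lerDl.
(* The lower bound 1 is there because [L] is the square of the logarithm: it gives
   [2 * K <= ln delta^-1 <= L]. *)
have [d1 d10 Hd1] := log_large (Num.max 1 (2 * K)).
have [d2 d20 Hd2] := @eps1_small R 4^-1 ltac:(by []).
have [d3 d30 Hd3] := eps1_small rad0.
pose d4 := Num.min d1 (Num.min d2 d3).
have d40 : 0 < d4 by rewrite !lt_min d10 d20 d30.
pose s : R := (size pts)%:R.
pose q : R := s * (6 * K ^+ 2 + 10 * K).
pose kp : R := s0 ^+ 2 / 96 * (expR (- 4) / Num.sqrt (4 * pi)).
have kp0 : 0 < kp.
  by rewrite /kp mulr_gt0// divr_gt0 ?exprn_gt0 ?expR_gt0 ?sqrtr_gt0 ?mulr_gt0 ?pi_gt0.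
have q0 : 0 <= q by rewrite /q mulr_ge0// addr_ge0// mulr_ge0// sqr_ge0.
pose l0 := ln delta0^-1.
have l00 : 0 < l0 by exact: ln_pos.
(* A lower bound for the smallest step size [delta * eps2 delta] over all [delta] between [d4] and
   [delta0]. *)
pose h := d4 * (d4 * l0 ^+ 4).
have h0 : 0 < h by rewrite !mulr_gt0// exprn_gt0.
pose c1 := (1 + T + (s + 9 * q * T + 1) / kp) * (1 + e).
pose c2 := (1 + T / h) * (1 + e).
have num0 : 0 <= (s + 9 * q * T + 1) / kp.
  by rewrite divr_ge0 ?(ltW kp0)// !addr_ge0// mulr_ge0 ?(ltW T_gt0)// mulr_ge0.
have c10 : 0 < c1.
  by rewrite /c1 mulr_gt0 ?ltr_wpDr ?(ltW T_gt0).
have Th0 : 0 <= T / h by rewrite divr_ge0// ltW.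
have c20 : 0 < c2 by rewrite /c2 mulr_gt0 ?ltr_wpDr.
exists (c1 + c2); first exact: addr_gt0.
move=> delta d_gt0 dd0.
have di : 1 <= delta^-1 by rewrite invf_ge1// ltW// (le_lt_trans dd0).
have Ld := L_pos _ d_gt0 dd0.
have e21 := eps2_le1 _ d_gt0 dd0.
have e20 := eps2_gt0 d_gt0 Ld.
have [small|big] := leP delta d4.
  have near := expected_num_steps_near Hm Wad Wind Wcv Nad Nnd Nrc xi T_gt0 pts0 mmu
    (continuous_measurable_fun csig) mrho mdsig d_gt0 Ld e21 K0 HK s00 Hrad.
  move: small; rewrite !le_min => /and3P[sd1 sd2 sd3].
  have := Hd1 _ d_gt0 sd1; rewrite ge_max => /andP[ln1 lnK].
  have LK : 2 * K <= ln delta^-1 ^+ 2.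
    by rewrite (le_trans lnK)// expr2 ler_peMr// ltW// ln_pos.
  have [eps21 _] := delta0_eps _ d_gt0 dd0.
  have := near LK eps21 (Hd2 _ d_gt0 sd2) (Hd3 _ d_gt0 sd3).
  apply: reduce => //.
  - rewrite addr_ge0//; first by rewrite addr_ge0// divr_ge0// ltW.
    rewrite divr_ge0 ?(ltW kp0)// addr_ge0// addr_ge0 ?divr_ge0 ?(ltW d_gt0)//.
    by rewrite mulr_ge0 ?(ltW T_gt0)// mulr_ge0// divr_ge0// ltW.
  - apply: (le_trans (near_bound_le T s q kp0 e0 di)).
    by rewrite ler_wpM2r ?invr_ge0 ?(ltW d_gt0)// lerDl ltW.
  - by rewrite addr_ge0// ltW.
have := expected_num_steps_crude P Hm Wad Wcv Nad Nnd Nrc xi T_gt0 pts0 mmu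
    (continuous_measurable_fun csig) mrho mdsig d_gt0 Ld e21.
apply: reduce => //.
- have ? := mulr_ge0 (ltW d_gt0) (ltW e20).
  by rewrite addr_ge0// divr_ge0// ltW.
- apply: (@le_trans _ _ c2).
    have l0d : l0 <= ln delta^-1 by rewrite /l0 ler_ln ?posrE ?invr_gt0// lef_pV2.
    have l4 : l0 ^+ 4 <= ln delta^-1 ^+ 4 by rewrite lerXn2r ?nnegrE ?(le_trans (ltW l00)) ?(ltW l00).
    have d4d := ltW big; have d4_ge0 := ltW d40.
    have l4_ge0 : 0 <= l0 ^+ 4 by rewrite exprn_ge0// ltW.
    have hd : h <= delta * eps2 delta.
      by apply: ler_pM => //; [exact: mulr_ge0|exact: ler_pM].
    rewrite /c2 ler_wpM2r ?addr_ge0// lerD2l ler_pM2l// lef_pV2 ?posrE//.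
    exact: mulr_gt0.
  apply: (@le_trans _ _ (c1 + c2)); first by rewrite lerDr ltW.
  by rewrite ler_peMr// addr_ge0// ltW.
- by rewrite addr_ge0// ltW.
Qed.
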